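(* Let $l>0$, $T>0$, $Q=(0,l)\times(0,T]$. Assume that $p\in L^\infty([0,T])$; that $\varphi\in C^2([0,l])$ with $\varphi(0)=\varphi(l)=0$; and that $f\in C^{2,1}(\overline{Q})$ with $f(0,t)=f(l,t)=0$ for all $t\in[0,T]$. Then the initial-boundary value problem $$u_t(x,t)=u_{xx}(x,t)-p(t)u(x,t)+f(x,t),\quad (x,t)\in Q,$$ $$u(x,0)=\varphi(x),\quad x\in[0,l],\qquad u(0,t)=u(l,t)=0,\quad t\in[0,T],$$ admits a unique solution $u\in C([0,T];H^2(0,l)\cap H_0^1(0,l))$ with $u_t\in L^2(0,T;L^2(0,l))$.
   Context: Functions are scalar (real- or complex-) valued. $C^{2,1}(\overline{Q})$ denotes functions on $\overline{Q}=[0,l]\times[0,T]$ with continuous derivatives up to order $2$ in $x$ and order $1$ in $t$. For $u\in C([0,T];H^2(0,l)\cap H^1_0(0,l))$ with $u_t\in L^2(0,T;L^2(0,l))$, the differential equation is understood to hold almost everywhere in $Q$ (equivalently, in $L^2(0,l)$ for a.e. $t$), the boundary conditions are encoded in $H_0^1(0,l)$, and the initial condition is $u(\cdot,0)=\varphi$. *)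

(* Defs.v *)
From HB Require Import structures.
From mathcomp Require Import all_boot all_order all_algebra.
From mathcomp Require Import complex.
From mathcomp Require Import all_classical all_reals all_analysis.

Set Implicit Arguments.
Unset Strict Implicit.
Unset Printing Implicit Defensive.
Import Order.TTheory GRing.Theory Num.Theory.
Import numFieldNormedType.Exports.

Local Open Scope classical_set_scope.
Local Open Scope ring_scope.

Notation leb R := (@lebesgue_measure R).

(** A function of space and time is a function of the pair (x, t); only its
    values on the closed rectangle matter.  Complex-valued functions belong to
    a function space when their real and imaginary parts do. *)

Definition re (R : realType) (A : Type) (g : A -> R[i]) : A -> R :=
  fun a => complex.Re (g a).
Definition im (R : realType) (A : Type) (g : A -> R[i]) : A -> R :=
  fun a => complex.Im (g a).

Definition at_time (R : realType) (B : Type) (u : R * R -> B) (t : R) : R -> B :=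
  fun x => u (x, t).

Definition rect (R : realType) (l T : R) : set (R * R) :=
  `]0, l[%classic `*` `]0, T[%classic.
Definition closed_rect (R : realType) (l T : R) : set (R * R) :=
  `[0, l]%classic `*` `[0, T]%classic.

(** Derivatives relative to the set [A]: one-sided at the end points of an
    interval. *)

Definition has_deriv_on (R : realType) (A : set R) (g g' : R -> R) : Prop :=
  forall x, A x -> (g y - g x) / (y - x) @[y --> within A x^'] --> g' x.

Definition C2_on (R : realType) (l : R) (g : R -> R) : Prop :=
  exists g1 g2 : R -> R,
    [/\ has_deriv_on `[0, l] g g1, has_deriv_on `[0, l] g1 g2
      & {within `[0, l], continuous g2}].

Definition C21_on (R : realType) (l T : R) (f : R * R -> R) : Prop :=
  exists fx fxx ft : R * R -> R,
    [/\ [/\ {within closed_rect l T, continuous f},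
            {within closed_rect l T, continuous fx},
            {within closed_rect l T, continuous fxx}
          & {within closed_rect l T, continuous ft}],
        forall t : R, t \in `[0, T] ->
          has_deriv_on `[0, l] (at_time f t) (at_time fx t),
        forall t : R, t \in `[0, T] ->
          has_deriv_on `[0, l] (at_time fx t) (at_time fxx t)
      & forall x : R, x \in `[0, l] ->
          has_deriv_on `[0, T] (fun t => f (x, t)) (fun t => ft (x, t))].

(** Iterated directional derivatives; on R and R * R this is the usual C^n. *)
Fixpoint C_n (R : realType) (V : normedModType R) (n : nat) (g : V -> R)
    : Prop :=
  continuous g /\
  if n is n'.+1 then
    forall v : V, (forall z, derivable g z v) /\ C_n n' ('D_v g)
  else True.

Definition test_fun (R : realType) (V : normedModType R) (D : set V)
    (g : V -> R) : Prop :=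
  (forall n, C_n n g) /\
  exists K : set V, [/\ compact K, K `<=` D & forall z, ~ K z -> g z = 0].

Definition Lp_on d (S : measurableType d) (R : realType)
    (m : {measure set S -> \bar R}) (q : \bar R) (D : set S) (g : S -> R)
    : Prop :=
  g \_ D \in Lfun m q.

Definition L2sqnorm (R : realType) (l : R) (g : R -> R) : \bar R :=
  ('N[leb R]_2%:E[EFin \o (g \_ `]0%R, l[)] ^+ 2)%E.

(** Below, a Sobolev function comes with its weak derivatives as extra arguments;
    they are unique almost everywhere. *)
Definition weak_deriv (R : realType) (l : R) (g g' : R -> R) : Prop :=
  forall psi : R -> R, test_fun (`]0, l[%classic : set R) psi ->
    \int[leb R]_(x in `]0, l[) (g x * 'D_1 psi x) =
    - \int[leb R]_(x in `]0, l[) (g' x * psi x).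

Definition H1 (R : realType) (l : R) (g g' : R -> R) : Prop :=
  [/\ Lp_on (leb R) 2%:E `]0, l[ g, Lp_on (leb R) 2%:E `]0, l[ g'
    & weak_deriv l g g'].

Definition H2 (R : realType) (l : R) (g g1 g2 : R -> R) : Prop :=
  H1 l g g1 /\ H1 l g1 g2.

Definition H1sqnorm (R : realType) (l : R) (g g1 : R -> R) : \bar R :=
  (L2sqnorm l g + L2sqnorm l g1)%E.

Definition H2sqnorm (R : realType) (l : R) (g g1 g2 : R -> R) : \bar R :=
  (L2sqnorm l g + L2sqnorm l g1 + L2sqnorm l g2)%E.

(** Closure of the test functions in the H1 norm. *)
Definition H10 (R : realType) (l : R) (g g1 : R -> R) : Prop :=
  H1 l g g1 /\
  forall eps : R, 0 < eps ->
    exists2 psi : R -> R, test_fun (`]0, l[%classic : set R) psi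
      & (H1sqnorm l (g \- psi)%R (g1 \- 'D_1 psi)%R < eps%:E)%E.

(** [u] is in C([0,T]; H2(0,l) cap H10(0,l)), where [ux] and [uxx] give the first
    two weak space derivatives at each time. *)
Definition C_H2_H10 (R : realType) (l T : R) (u ux uxx : R * R -> R) : Prop :=
  (forall t : R, t \in `[0, T] ->
     H2 l (at_time u t) (at_time ux t) (at_time uxx t) /\
     H10 l (at_time u t) (at_time ux t)) /\
  (forall t0 : R, t0 \in `[0, T] ->
     H2sqnorm l (at_time u t \- at_time u t0)
                (at_time ux t \- at_time ux t0)
                (at_time uxx t \- at_time uxx t0)
       @[t --> within `[0, T] (nbhs t0)] --> 0%E).

(** The integrals are iterated, x first, so that the left-hand side is the
    integral in time of the L2(0,l) pairing of [u(., t)] with the time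
    derivative of [Phi]: no joint measurability is asked of [u], whose slices
    are only determined almost everywhere. *)
Definition weak_dt (R : realType) (l T : R) (u ut : R * R -> R) : Prop :=
  forall Phi : R * R -> R, test_fun (rect l T) Phi ->
    \int[leb R]_(t in `]0, T[)
      (\int[leb R]_(x in `]0, l[) (u (x, t) * 'D_((0, 1) : R * R) Phi (x, t))) =
    - \int[leb R]_(t in `]0, T[)
      (\int[leb R]_(x in `]0, l[) (ut (x, t) * Phi (x, t))).

(** L2(0,T; L2(0,l)) is identified with L2 of the rectangle. *)
Definition regular (R : realType) (l T : R) (u ux uxx ut : R * R -> R) : Prop :=
  [/\ C_H2_H10 l T u ux uxx,
      Lp_on (leb R \x leb R)%E 2%:E (rect l T) ut
    & weak_dt l T u ut].

Definition solution (R : realType) (l T : R) (p phi : R -> R[i])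
    (f : R * R -> R[i]) (u : R * R -> R[i]) : Prop :=
  exists ux uxx ut : R * R -> R[i],
    [/\ regular l T (re u) (re ux) (re uxx) (re ut),
        regular l T (im u) (im ux) (im uxx) (im ut),
        \forall t \ae leb R, t \in `]0, T[ ->
          \forall x \ae leb R, x \in `]0, l[ ->
            ut (x, t) = uxx (x, t) - p t * u (x, t) + f (x, t)
      & \forall x \ae leb R, x \in `]0, l[ -> u (x, 0) = phi x].

(** The scalars are a set of complex numbers: all of them, or the reals. *)
Definition scalar_field (R : realType) (K : set R[i]) : Prop :=
  K = setT \/ K = [set z | complex.Im z = 0].

(* Main.v *)
Require Import Defs.
From HB Require Import structures.
From mathcomp Require Import all_boot all_order all_algebra.
From mathcomp Require Import complex.
From mathcomp Require Import all_classical all_reals all_analysis.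
From mathcomp Require Import measurable_realfun ess_sup_inf ring lra.
Set Implicit Arguments.
Unset Strict Implicit.
Unset Printing Implicit Defensive.
Import Order.TTheory GRing.Theory Num.Theory.
Import numFieldNormedType.Exports.
Local Open Scope classical_set_scope.
Local Open Scope ring_scope.

(** Expand in the sine basis sn_n(x) = sin ((n + 1) pi x / l), with eigenvalues
    k_n = ((n + 1) pi / l)^2.  Pairing the equation with sn_n turns it into the
    linear ordinary differential equation c_n' = - (k_n + p) c_n + f_n.

    Uniqueness: sn_n is an H1 limit of test functions, and so are functions in H10,
    whence no boundary terms appear and the coefficients of any solution satisfy
    this equation, which determines them by Gronwall's lemma; the sine system is
    complete because the Bernstein polynomials in cos (pi x / l) times
    sin (pi x / l) are sine polynomials.

    Existence: the equation is solved explicitly.  Two integrations by parts give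
    k_n phi_n = - (phi'')_n and k_n f_n = - (f_xx)_n, hence the bound
    k_n |c_n(t)| <= K exp (- k_n t) |(phi'')_n| + A / k_n, whose right-hand side is
    square summable uniformly in t and summable for t > 0.  The sine series and
    its termwise derivatives u_x, u_xx therefore converge in L2(0, l) uniformly in
    time, and every property of the solution passes to the limit.

    Complex-valued functions are treated through real and imaginary parts, which
    p couples. *)

(** * Square integrable functions *)

(** As [p] is only bounded and measurable, a coefficient is merely Lipschitz in time and its
    equation is read in integrated form, [LI T c h]. The product and chain rules for such primitives
    avoid differentiation almost everywhere: the defect on an interval is quadratic in its length,
    and subdividing shows that it vanishes. Beforehand [p] is replaced by a representative bounded
    everywhere, which affects the equation only on a null set of times.

    For complex [p] one mode is a real two-by-two system, solvable in closed form because damping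
    and rotation commute.

    The obstacle at time 0 is that [phi''] need not vanish at the ends: its sine series converges in
    L2(0, l) but has in general no summable majorant. Uniform convergence down to [t = 0] therefore
    rests on orthogonality and square summability, whereas for [t > 0] the exponential restores
    absolute convergence, hence pointwise sums and the joint measurability of [ut] on the open
    rectangle. *)

Lemma poweR2E (R : realType) (x : \bar R) : (0 <= x)%E -> (x `^ 2 = x ^+ 2)%E.
Proof.
case: x => [r|_|//]; last by rewrite poweRyr//= expe2 mulyy.
by rewrite lee_fin => r0; rewrite poweR_EFin powR_mulrn// expe2 -EFinM expr2.
Qed.

Lemma ae_mono d (S : measurableType d) (R : realType) (m : {measure set S -> \bar R})
  (P Q : S -> Prop) : (forall x, P x -> Q x) -> (\forall x \ae m, P x) -> \forall x \ae m, Q x.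
Proof. by move=> PQ; apply: filterS. Qed.

Lemma ae_mono2 d (S : measurableType d) (R : realType) (m : {measure set S -> \bar R})
  (P P' Q : S -> Prop) : (forall x, P x -> P' x -> Q x) ->
  (\forall x \ae m, P x) -> (\forall x \ae m, P' x) -> \forall x \ae m, Q x.
Proof. by move=> PQ; apply: filterS2. Qed.

Section SquareIntegrable.
Context d (S : measurableType d) (R : realType).
Variables (m : {measure set S -> \bar R}) (D : set S).
Hypothesis mD : measurable D.

Definition L2 (f : S -> R) : Prop :=
  measurable_fun D f /\ m.-integrable D (EFin \o (fun x => f x * f x)).

Definition ip (f g : S -> R) : R := \int[m]_(x in D) (f x * g x).

(** Domination by [f^2 + g^2]. *)
Lemma L2_mul f g : L2 f -> L2 g -> m.-integrable D (EFin \o (fun x => f x * g x)).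
Proof.
move=> [mf if2] [mg ig2].
apply: (@le_integrable _ _ _ m D mD _ (EFin \o (fun x => f x * f x + g x * g x))).
- by apply/measurable_EFinP; exact: measurable_funM.
- move=> x _ /=; rewrite lee_fin [leRHS]ger0_norm; last by nra.
  by rewrite ler_norml; apply/andP; split; nra.
- exact: integrableD if2 ig2.
Qed.

Lemma integrable_eq f g : (forall x, D x -> f x = g x) ->
  m.-integrable D (EFin \o f) -> m.-integrable D (EFin \o g).
Proof.
by move=> fg; apply: eq_integrable => // x /set_mem xD /=; rewrite fg.
Qed.

Lemma integrable_add f g : m.-integrable D (EFin \o f) ->
  m.-integrable D (EFin \o g) -> m.-integrable D (EFin \o (fun x => f x + g x)).
Proof. exact: integrableD. Qed.

Lemma integrable_scale (c : R) f : m.-integrable D (EFin \o f) ->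
  m.-integrable D (EFin \o (fun x => c * f x)).
Proof. exact: integrableZl. Qed.

Lemma integrable_sub f g : m.-integrable D (EFin \o f) ->
  m.-integrable D (EFin \o g) -> m.-integrable D (EFin \o (fun x => f x - g x)).
Proof. exact: integrableB. Qed.

Lemma L2D f g : L2 f -> L2 g -> L2 (fun x => f x + g x).
Proof.
move=> Lf Lg; have [[mf if2] [mg ig2]] := (Lf, Lg).
have ifg := L2_mul Lf Lg; split; first exact: measurable_funD.
apply: integrable_eq (integrable_add (integrable_add if2 ig2)
  (integrable_scale 2 ifg)) => x _.
by ring.
Qed.

Lemma L2Z c f : L2 f -> L2 (fun x => c * f x).
Proof.
move=> [mf if2]; split; first by apply: measurable_funM => //; exact: measurable_cst.
by apply: integrable_eq (integrable_scale (c * c) if2) => x _; ring.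
Qed.

Lemma L2_eq f g : (forall x, D x -> f x = g x) -> L2 f -> L2 g.
Proof.
move=> fg [mf if2]; split.
  by apply: eq_measurable_fun mf => x /set_mem/fg.
by apply: integrable_eq if2 => x Dx; rewrite fg.
Qed.

Lemma L2N f : L2 f -> L2 (fun x => - f x).
Proof. by move=> /(L2Z (-1)); apply: L2_eq => x _; ring. Qed.

Lemma L2B f g : L2 f -> L2 g -> L2 (fun x => f x - g x).
Proof. by move=> Lf /L2N; exact: L2D. Qed.

Lemma L2_0 : L2 (fun=> 0).
Proof.
split; first exact: measurable_cst.
by apply: integrable_eq (integrable0 m D) => x _ /=; rewrite mulr0.
Qed.

Lemma L2_sum N (F : nat -> S -> R) : (forall n, (n < N)%N -> L2 (F n)) ->
  L2 (fun x => \sum_(n < N) F n x).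
Proof.
elim: N => [|N IH] LF.
  by apply: L2_eq L2_0 => x _; rewrite big_ord0.
apply: L2_eq (L2D (IH _) (LF N _)) => // [x _|n nN].
  by rewrite big_ord_recr.
by apply: LF; rewrite ltnS ltnW.
Qed.

Lemma ipC f g : ip f g = ip g f.
Proof. by apply: eq_Rintegral => x _; rewrite mulrC. Qed.

Lemma eq_ip f g f' g' : (forall x, D x -> f x = f' x) ->
  (forall x, D x -> g x = g' x) -> ip f g = ip f' g'.
Proof. by move=> ff gg; apply: eq_Rintegral => x /set_mem xD; rewrite ff// gg. Qed.

Lemma ipDl f g h : L2 f -> L2 g -> L2 h ->
  ip (fun x => f x + g x) h = ip f h + ip g h.
Proof.
move=> Lf Lg Lh; rewrite /ip -RintegralD//; [|exact: L2_mul..].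
by apply: eq_Rintegral => x _; rewrite mulrDl.
Qed.

Lemma ipZl c f h : L2 f -> L2 h -> ip (fun x => c * f x) h = c * ip f h.
Proof.
move=> Lf Lh; rewrite /ip -RintegralZl//; last exact: L2_mul.
by apply: eq_Rintegral => x _; rewrite mulrA.
Qed.

Lemma ipBl f g h : L2 f -> L2 g -> L2 h ->
  ip (fun x => f x - g x) h = ip f h - ip g h.
Proof.
move=> Lf Lg Lh; rewrite /ip -RintegralB//; [|exact: L2_mul..].
by apply: eq_Rintegral => x _; rewrite mulrBl.
Qed.

Lemma ip0l h : ip (fun=> 0) h = 0.
Proof.
rewrite /ip; under eq_Rintegral do rewrite mul0r.
by rewrite Rintegral_cst ?mul0r.
Qed.

Lemma ip_suml N (F : nat -> S -> R) h : (forall n, (n < N)%N -> L2 (F n)) -> L2 h ->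
  ip (fun x => \sum_(n < N) F n x) h = \sum_(n < N) ip (F n) h.
Proof.
move=> + Lh; elim: N => [|N IH] LF.
  rewrite big_ord0 -[RHS](ip0l h); apply: eq_ip => // x _; exact: big_ord0.
rewrite big_ord_recr/= -IH; last by move=> n nN; apply: LF; rewrite ltnS ltnW.
rewrite -ipDl//; last 2 first.
- by apply: L2_sum => n nN; apply: LF; rewrite ltnS ltnW.
- exact: LF.
by apply: eq_ip => // x _; rewrite big_ord_recr.
Qed.

Lemma ipDr f g h : L2 f -> L2 g -> L2 h ->
  ip h (fun x => f x + g x) = ip h f + ip h g.
Proof. by move=> *; rewrite ipC ipDl// !(ipC h). Qed.

Lemma ipBr f g h : L2 f -> L2 g -> L2 h ->
  ip h (fun x => f x - g x) = ip h f - ip h g.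
Proof. by move=> *; rewrite ipC ipBl// !(ipC h). Qed.

Lemma ipZr c f h : L2 f -> L2 h -> ip h (fun x => c * f x) = c * ip h f.
Proof. by move=> *; rewrite ipC ipZl// !(ipC h). Qed.

Lemma ip_ge0 f : 0 <= ip f f.
Proof. by apply: Rintegral_ge0 => x _; nra. Qed.

Lemma ip_sqD f g : L2 f -> L2 g ->
  ip (fun x => f x + g x) (fun x => f x + g x) = ip f f + 2 * ip f g + ip g g.
Proof.
move=> Lf Lg; have Lfg := L2D Lf Lg.
by rewrite ipDl// !ipDr// (ipC g f); ring.
Qed.

Lemma ip_sqB f g : L2 f -> L2 g ->
  ip (fun x => f x - g x) (fun x => f x - g x) = ip f f - 2 * ip f g + ip g g.
Proof.
move=> Lf Lg; have Lfg := L2B Lf Lg.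
by rewrite ipBl// !ipBr// (ipC g f); ring.
Qed.

Lemma ip_sqD_le f g : L2 f -> L2 g ->
  ip (fun x => f x + g x) (fun x => f x + g x) <= 2 * (ip f f + ip g g).
Proof.
by move=> Lf Lg; have := ip_ge0 (fun x => f x - g x); rewrite (ip_sqB Lf Lg) (ip_sqD Lf Lg); lra.
Qed.

Lemma ip_sqZ c f : L2 f -> ip (fun x => c * f x) (fun x => c * f x) = c ^+ 2 * ip f f.
Proof. by move=> Lf; rewrite (ipZl _ Lf (L2Z c Lf)) (ipZr _ Lf Lf); ring. Qed.

(** The square norm of [f - s g] is nonnegative for every real [s]; its minimizer
    [s = ip f g / ip g g] gives the inequality. *)
Lemma cauchy_schwarz f g : L2 f -> L2 g -> ip f g ^+ 2 <= ip f f * ip g g.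
Proof.
move=> Lf Lg.
have H s : 0 <= ip f f - 2 * s * ip f g + s ^+ 2 * ip g g.
  have := ip_ge0 (fun x => f x - s * g x).
  rewrite (ip_sqB Lf (L2Z s Lg)) (ip_sqZ _ Lg) (ipZr _ Lg Lf).
  by rewrite mulrA.
have [g0|] := eqVneq (ip g g) 0; last first.
  move=> g0; have gp : 0 < ip g g by rewrite lt_def g0 ip_ge0.
  have := H (ip f g / ip g g).
  rewrite -(ler_pM2r gp) mul0r => /le_trans; move=> /(_ (ip f f * ip g g - ip f g ^+ 2)).
  rewrite subr_ge0; apply; rewrite le_eqVlt; apply/orP; left; apply/eqP.
  by field.
rewrite g0 mulr0 in H *.
have [->|fg0] := eqVneq (ip f g) 0; first by rewrite expr0n.
(* When [ip g g = 0] the expression is affine in [s]; at this [s] it would equal -1. *)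
have := H ((ip f f + 1) / (2 * ip f g)).
rewrite (_ : 2 * _ * _ = ip f f + 1); last by field.
by rewrite mulr0; lra.
Qed.

Lemma ip_le_norm f g (a b : R) : L2 f -> L2 g -> ip f f <= a -> ip g g <= b ->
  `|ip f g| <= Num.sqrt (a * b).
Proof.
move=> Lf Lg fa gb; rewrite -sqrtr_sqr ler_sqrt.
  by apply: le_trans (cauchy_schwarz Lf Lg) _; apply: ler_pM => //; exact: ip_ge0.
by apply: mulr_ge0; [apply: le_trans fa|apply: le_trans gb]; exact: ip_ge0.
Qed.

Lemma ip_sq_eq0 f : L2 f -> ip f f = 0 -> \forall x \ae m, D x -> f x = 0.
Proof.
move=> [mf if2] f0.
have : (\int[m]_(x in D) `|(f x * f x)%:E|)%E = 0.
  have -> : (\int[m]_(x in D) `|(f x * f x)%:E|)%E = (\int[m]_(x in D) (f x * f x)%:E)%E.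
    by apply: eq_integral => x _; rewrite gee0_abs// lee_fin; nra.
  move: f0; rewrite /ip /Rintegral => /eqP; rewrite fine_eq0; first by move=> /eqP.
  exact: integrable_fin_num.
move=> /(ae_eq_integral_abs _ mD _).1; case => [|N HN].
  by apply/measurable_EFinP; exact: measurable_funM.
exists N; case: HN => ? ? sub; split=> // x /= H; apply: sub => /= H2; apply: H => Dx.
by have := H2 Dx => -[] /eqP; rewrite mulf_eq0 orbb => /eqP.
Qed.

Lemma ae_eq_ip f g f' g' : L2 f -> L2 g -> L2 f' -> L2 g' ->
  (\forall x \ae m, D x -> f x = f' x) -> (\forall x \ae m, D x -> g x = g' x) ->
  ip f g = ip f' g'.
Proof.
move=> Lf Lg Lf' Lg' ff gg; congr fine; apply: ae_eq_integral => //.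
- by have /integrableP[] := L2_mul Lf Lg.
- by have /integrableP[] := L2_mul Lf' Lg'.
- apply: filterS2 ff gg => x /= H1 H2 xD.
  by rewrite H1// H2.
Qed.

Lemma L2_bounded (f : S -> R) (M : R) : (m D < +oo)%E -> measurable_fun D f ->
  (forall x, D x -> `|f x| <= M) -> L2 f.
Proof.
move=> Dfin mf fM; split=> //.
apply: (@le_integrable _ _ _ m D mD _ (EFin \o cst (M * M))).
- by apply/measurable_EFinP; exact: measurable_funM.
- move=> x Dx /=; rewrite lee_fin [leLHS]normrM [leRHS]ger0_norm; last first.
    by rewrite mulr_ge0 ?(le_trans _ (fM x Dx)).
  by rewrite ler_pM// fM.
- apply/integrableP; split.
    by apply/measurable_EFinP; exact: measurable_cst.
  under eq_integral do rewrite /=; rewrite integral_cst// lte_mul_pinfty//.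
Qed.

Lemma Lnorm2_sq (f : S -> R) : measurable_fun D f ->
  ('N[m]_2%:E[EFin \o (f \_ D)] ^+ 2 = \int[m]_(x in D) (f x * f x)%:E)%E.
Proof.
move=> mf.
rewrite -poweR2E ?Lnorm_ge0// poweR_Lnorm// [RHS]integral_mkcond.
apply: eq_integral => x _; rewrite poweR2E ?abse_ge0// expe2 patchE /=.
rewrite patchE; case: ifPn => _; rewrite -EFinM; congr EFin.
  by rewrite -expr2 -normrX ger0_norm ?exprn_even_ge0// expr2.
by rewrite normr0 mulr0.
Qed.

(** The bridge to the function spaces of the statement: [Lp_on] speaks of the extension by zero to
    the whole space, [L2] of integrals over [D], on which [ip] can be computed as a real scalar
    product. *)
Lemma Lp_on_L2 f : Lp_on m 2%:E D f <-> L2 f.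
Proof.
rewrite /Lp_on /L2; split.
- move=> fL; have := Lfun2_integrable_sqr fL; move: fL.
  rewrite inE => /andP[]; rewrite !inE/= => mf _ if2.
  have mfD : measurable_fun D f by apply/measurable_restrictT.
  split=> //; apply/integrable_mkcond => //.
  move: if2; apply: eq_integrable => // x _ /=.
  by rewrite !patchE; case: ifPn => //; rewrite ?expr2 ?mulr0.
- move=> [mf if2]; rewrite inE; apply/andP; split; rewrite inE/=.
    by apply/(measurable_restrictT _ mD).
  apply: (@lty_poweRy _ _ 2) => //.
  rewrite poweR2E ?Lnorm_ge0// Lnorm2_sq//.
  move/integrableP : if2 => [_]; apply: le_lt_trans.
  apply: ge0_le_integral => //.
  + by move=> x _; rewrite lee_fin; nra.
  + by apply/measurable_EFinP; exact: measurable_funM.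
  + by apply: measurableT_comp => //; apply/measurable_EFinP; exact: measurable_funM.
  + by move=> x _ /=; rewrite lee_fin ler_norm.
Qed.

Lemma Lnorm2_ip f : L2 f -> ('N[m]_2%:E[EFin \o (f \_ D)] ^+ 2 = (ip f f)%:E)%E.
Proof.
move=> [mf if2]; rewrite Lnorm2_sq// /ip /Rintegral fineK//.
exact: integrable_fin_num.
Qed.

End SquareIntegrable.

(** * Integrals and derivatives on bounded intervals *)

Section OpenInterval.
Variable R : realType.
Implicit Types (f g F : R -> R) (a b c : R).
Local Notation mu := (leb R).

Lemma leb_oo a b : a <= b -> leb R `]a, b[ = (b - a)%:E.
Proof.
move=> ab; rewrite lebesgue_measure_itv/= lte_fin.
by case: ltP => // ba; rewrite (@le_anti _ _ a b) ?ab// subrr.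
Qed.

Lemma leb_oo_fin a b : (leb R `]a, b[ < +oo)%E.
Proof.
by rewrite lebesgue_measure_itv/=; case: ifP => _; rewrite ?ltry// -EFinB ltry.
Qed.

Lemma bounded_integrable_oo a b f (M : R) : measurable_fun `]a, b[ f ->
  (forall x, a < x < b -> `|f x| <= M) -> mu.-integrable `]a, b[ (EFin \o f).
Proof.
move=> mf fM.
apply: (@le_integrable _ _ _ mu `]a, b[%classic _ _ (EFin \o cst M)) => //.
- exact/measurable_EFinP.
- move=> x /=; rewrite in_itv/= lee_fin => xab; rewrite (le_trans (fM _ xab))//.
  exact: ler_norm.
- apply/integrableP; split; first by apply/measurable_EFinP; exact: measurable_cst.
  under eq_integral do rewrite /=; rewrite integral_cst// lte_mul_pinfty//.
  exact: leb_oo_fin.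
Qed.

Lemma within_continuous_integrable_oo a b f :
  {within `[a, b], continuous f} -> mu.-integrable `]a, b[ (EFin \o f).
Proof.
move=> cf; have := continuous_compact_integrable (@segment_compact _ a b) cf.
by apply: integrableS => //; exact: subset_itv_oo_cc.
Qed.

Lemma continuous_integrable_oo a b f :
  continuous f -> mu.-integrable `]a, b[ (EFin \o f).
Proof.
by move=> cf; apply: within_continuous_integrable_oo; exact: continuous_subspaceT.
Qed.

Lemma continuous_measurable_oo a b f : continuous f -> measurable_fun `]a, b[ f.
Proof.
by move=> cf; apply: (@measurable_funS _ _ _ _ setT) => //; exact: continuous_measurable_fun.
Qed.

Lemma within_measurable_oo a b f : {within `[a, b], continuous f} -> measurable_fun `]a, b[ f.
Proof.
by move=> /within_continuous_integrable_oo/integrableP[/measurable_EFinP].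
Qed.

Lemma Rint_oo_cc a b f : mu.-integrable `]a, b[ (EFin \o f) ->
  \int[mu]_(x in `]a, b[) f x = \int[mu]_(x in `[a, b]) f x.
Proof.
move=> fi; have [ab|ba] := ltP a b; last first.
  rewrite [in LHS]set_itv_ge ?bnd_simp -?leNgt//.
  move: ba; rewrite le_eqVlt => /predU1P[->|ba]; rewrite ?set_itv1 ?Rintegral_set1 ?Rintegral_set0//.
  by rewrite set_itv_ge ?Rintegral_set0// bnd_simp -ltNge.
rewrite Rintegral_itv_bndo_bndc// Rintegral_itv_obnd_cbnd//.
have : mu.-integrable ([set b] `|` `]a, b[) (EFin \o f).
  apply/integrableP; split.
    apply/measurable_EFinP; apply/measurable_funU => //; split.
      exact: measurable_fun_set1.
    by case/integrableP : fi => /measurable_EFinP.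
  rewrite ge0_integral_setU//=; last 2 first.
  - apply: measurableT_comp => //; apply: measurableT_comp => //.
    apply/measurable_funU => //; split.
      exact: measurable_fun_set1.
    by case/integrableP : fi => /measurable_EFinP.
  - by apply/disj_setPLR => x /= -> ; rewrite in_itv/= ltxx andbF.
  rewrite integral_set1 add0e.
  by case/integrableP : fi.
by rewrite setUC setUitv1 ?bnd_simp.
Qed.

Lemma Rint_oo_self a f : \int[mu]_(x in `]a, a[) f x = 0.
Proof. by rewrite set_itv_ge ?Rintegral_set0// bnd_simp -leNgt. Qed.

(** Near [x] the difference quotient stays below [|g' x| + 1], which bounds the increments of
    [g]. *)
Lemma has_deriv_on_within (A : set R) g g' :
  has_deriv_on A g g' -> {within A, continuous g}.
Proof.
move=> H; apply/subspace_continuousP => x Ax.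
apply/cvgrPdist_lt => e e0.
have /cvgrPdist_lt/(_ _ ltr01) := H x Ax.
rewrite !near_withinE => H1.
have M0 : 0 < `|g' x| + 1 by rewrite ltr_wpDl.
have : \forall y \near x, `|x - y| < e / (`|g' x| + 1).
  by apply: nbhsx_ballx; rewrite divr_gt0.
apply: filterS2 H1 => y H1 H2 Ay.
have [->|yx] := eqVneq y x; first by rewrite subrr normr0.
have yx0 : y - x != 0 by rewrite subr_eq0.
have {}H1 := H1 yx Ay.
have : `|(g y - g x) / (y - x)| < `|g' x| + 1.
  rewrite -ltrBlDl; apply: le_lt_trans H1.
  by rewrite (distrC (g' x)); exact: lerB_dist.
rewrite normrM normfV ltr_pdivrMr ?normr_gt0// distrC => /lt_trans; apply.
by rewrite mulrC -ltr_pdivlMr// distrC.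
Qed.

Lemma has_deriv_on_is_derive (A : set R) g g' (x : R) :
  has_deriv_on A g g' -> nbhs x A -> is_derive x 1 g (g' x).
Proof.
move=> H Anx.
have cv : h^-1 *: (g (h *: 1 + x) - g x) @[h --> 0^'] --> g' x.
  apply/cvgrPdist_lt => e e0.
  have /cvgrPdist_lt/(_ _ e0) := H x (nbhs_singleton Anx).
  rewrite !near_withinE => H1.
  have H2 : \forall y \near x, A y /\ (y != x -> A y -> `|g' x - (g y - g x) / (y - x)| < e).
    exact: filterI Anx H1.
  have /nbhs_ballP[d /= d0 sub] := H2.
  apply/nbhs_ballP; exists d => // h; rewrite /ball/= sub0r normrN => hd h0.
  have [|Ay] := sub (h + x).
    by rewrite /ball/= opprD addrCA subrr addr0 normrN.
  rewrite -subr_eq0 addrK => /(_ h0 Ay).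
  by rewrite [_%:A]mulr1 [_ *: _]mulrC.
by apply: DeriveDef; [apply/cvg_ex; exists (g' x)|apply/cvg_lim].
Qed.

Lemma is_derive_continuous (F f : R -> R) : (forall x : R, is_derive x 1 F (f x)) -> continuous F.
Proof.
move=> dF x; apply: differentiable_continuous; apply/derivable1_diffP.
by have [] := dF x.
Qed.

Lemma has_deriv_on_interior a b g g' (x : R) :
  has_deriv_on `[a, b] g g' -> a < x < b -> is_derive x 1 g (g' x).
Proof.
move=> dg xab; apply: has_deriv_on_is_derive dg _.
have xab' : x \in `]a, b[ by rewrite in_itv.
by apply: filterS (near_in_itvoo xab'); exact: subset_itv_oo_cc.
Qed.

(** Derivatives are asked for only inside the interval, because functions of class [C2_on] have
    one-sided derivatives at the ends. *)
Lemma ftc_interior a b F f : a < b -> {within `[a, b], continuous F} ->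
  (forall x : R, a < x < b -> is_derive x 1 F (f x)) ->
  {within `[a, b], continuous f} -> \int[mu]_(x in `]a, b[) f x = F b - F a.
Proof.
move=> ab cF dF cf; rewrite Rint_oo_cc; last exact: within_continuous_integrable_oo.
have dFx x : x \in `]a, b[ -> is_derive x 1 F (f x) by rewrite in_itv; exact: dF.
have [_ Fa Fb] := (continuous_within_itvP F ab).1 cF.
rewrite /Rintegral (@continuous_FTC2 _ f F)//.
  split=> // x xab; by have [] := dFx x xab.
move=> x xab; rewrite derive1E; have Hx := dFx x xab; exact: derive_val.
Qed.

Lemma ftc a b F f : a <= b -> (forall x : R, is_derive x 1 F (f x)) ->
  continuous f -> \int[mu]_(x in `]a, b[) f x = F b - F a.
Proof.
rewrite le_eqVlt => /predU1P[->|ab] dF cf.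
  by rewrite Rint_oo_self subrr.
apply: ftc_interior => //; apply: continuous_subspaceT => //; exact: is_derive_continuous dF.
Qed.

Lemma Rint_split a b c f : a <= b -> b <= c -> mu.-integrable `]a, c[ (EFin \o f) ->
  \int[mu]_(x in `]a, c[) f x = \int[mu]_(x in `]a, b[) f x + \int[mu]_(x in `]b, c[) f x.
Proof.
rewrite le_eqVlt => /predU1P[->|ab].
  by rewrite Rint_oo_self add0r.
rewrite le_eqVlt => /predU1P[->|bc].
  by rewrite Rint_oo_self addr0.
move=> fi.
have iS : forall u v : R, a <= u -> v <= c -> mu.-integrable `]u, v[ (EFin \o f).
  move=> u v au vc; apply: integrableS fi => // x /=; rewrite !in_itv/= => /andP[? ?].
  by apply/andP; split; [apply: le_lt_trans au _|apply: lt_le_trans vc].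
have := @Rintegral_itvB R f (BRight a) (BLeft c) b fi.
rewrite !bnd_simp => /(_ (ltW ab) bc) <-.
by rewrite -Rintegral_itv_bndo_bndc ?subrKC//; apply: iS => //; exact: ltW.
Qed.

Lemma Rint_oo_cst a b (c : R) : a <= b -> \int[mu]_(x in `]a, b[) c = c * (b - a).
Proof. by move=> ab; rewrite Rintegral_cst//= leb_oo. Qed.

Lemma Rint_oo_bound a b f (M : R) : a <= b -> measurable_fun `]a, b[ f ->
  (forall x, a < x < b -> `|f x| <= M) -> `|\int[mu]_(x in `]a, b[) f x| <= M * (b - a).
Proof.
move=> ab mf fM; have fi := bounded_integrable_oo mf fM.
apply: le_trans (le_normr_Rintegral _ fi) _ => //.
rewrite -Rint_oo_cst//; apply: le_Rintegral => //.
- exact: integrable_norm.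
- apply: (@bounded_integrable_oo _ _ _ `|M|) => // x _; exact: lexx.
Qed.

Lemma within_continuous_bounded a b f : {within `[a, b], continuous f} ->
  exists2 M : R, 0 <= M & forall x : R, a <= x <= b -> `|f x| <= M.
Proof.
move=> cf.
have : compact (f @` `[a, b]%classic).
  by apply: continuous_compact => //; exact: segment_compact.
move=> /compact_bounded[M [_ HM]].
exists (`|M| + 1); first by rewrite addr_ge0.
move=> x xab; apply: HM; first by rewrite (le_lt_trans (ler_norm _))// ltrDl.
by exists x => //=; rewrite in_itv.
Qed.

Lemma within_L2 a b f : {within `[a, b], continuous f} -> L2 mu `]a, b[ f.
Proof.
move=> cf; have [M _ HM] := within_continuous_bounded cf.
apply: (L2_bounded _ (leb_oo_fin a b) (M := M)) => //.
- exact: within_measurable_oo.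
- move=> x /=; rewrite in_itv/= => /andP[ax xb]; apply: HM.
  by rewrite !ltW.
Qed.

Lemma continuous_L2 a b f : continuous f -> L2 mu `]a, b[ f.
Proof. by move=> cf; apply: within_L2; exact: continuous_subspaceT. Qed.

End OpenInterval.

(** * Smooth cutoff functions *)

Section IteratedDerivatives.
Context (R : realType) (V : normedModType R).
Implicit Types f g : V -> R.

Definition smooth f := forall n, C_n n f.

Lemma C_n_continuous n f : C_n n f -> continuous f.
Proof. by case: n => [|n] []. Qed.

Lemma C_nW n f : C_n n.+1 f -> C_n n f.
Proof.
elim: n f => [|n IH] f [cf H]; first by split.
by split=> // v; have [df /IH] := H v.
Qed.

Lemma C_n_cst n (c : R) : C_n n (fun _ : V => c).
Proof.
elim: n c => [|n IH] c; split; try by move=> ?; exact: cvg_cst.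
  by [].
move=> v; split; first by move=> z; exact: derivable_cst.
by rewrite (_ : 'D_v _ = fun=> 0); [exact: IH|apply/funext => z; exact: derive_cst].
Qed.

Lemma C_nD n f g : C_n n f -> C_n n g -> C_n n (fun x => f x + g x).
Proof.
elim: n f g => [|n IH] f g [cf Hf] [cg Hg].
  by split=> // x; apply: cvgD; [exact: cf|exact: cg].
split; first by move=> x; apply: cvgD; [exact: cf|exact: cg].
move=> v; have [df Cf] := Hf v; have [dg Cg] := Hg v; split.
  by move=> z; exact: derivableD.
rewrite (_ : 'D_v _ = fun x => 'D_v f x + 'D_v g x); first exact: IH.
by apply/funext => z; rewrite deriveD.
Qed.

Lemma C_nM n f g : C_n n f -> C_n n g -> C_n n (fun x => f x * g x).
Proof.
elim: n f g => [|n IH] f g Cf Cg.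
  by split=> // x; apply: cvgM; [exact: (C_n_continuous Cf)|exact: (C_n_continuous Cg)].
have [Cfn Cgn] := (C_nW Cf, C_nW Cg).
split; first by move=> x; apply: cvgM; [exact: (C_n_continuous Cf)|exact: (C_n_continuous Cg)].
case: Cf Cg => _ Hf [_ Hg] v; have [df Cf] := Hf v; have [dg Cg] := Hg v; split.
  by move=> z; exact: derivableM.
rewrite (_ : 'D_v _ = fun x => f x * 'D_v g x + g x * 'D_v f x).
  by apply: C_nD; exact: IH.
by apply/funext => z; rewrite deriveM.
Qed.

(** The derivative [- (f^-1)^2 f'] contains [f^-1] again, at one order less, so the induction closes
    through [C_nM]. *)
Lemma C_nV n f : (forall x, f x != 0) -> C_n n f -> C_n n (fun x => (f x)^-1).
Proof.
move=> f0; elim: n => [|n IH] Cf.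
  by split=> // x; apply: cvgV => //; exact: (C_n_continuous Cf).
have Cfn := C_nW Cf.
split; first by move=> x; apply: cvgV => //; exact: (C_n_continuous Cf).
case: Cf => _ Hf v; have [df Cf] := Hf v; split.
  by move=> z; exact: derivableV.
rewrite (_ : 'D_v _ = fun x => (-1) * ((f x)^-1 * (f x)^-1 * 'D_v f x)).
  apply: C_nM; first exact: C_n_cst.
  by apply: C_nM => //; apply: C_nM; exact: IH.
apply/funext => z; rewrite deriveV//= /GRing.scale/= -expr2 exprVn; ring.
Qed.

Lemma smooth_cst (c : R) : smooth (fun _ : V => c).
Proof. by move=> n; exact: C_n_cst. Qed.

Lemma smoothD f g : smooth f -> smooth g -> smooth (fun x => f x + g x).
Proof. by move=> sf sg n; exact: C_nD. Qed.

Lemma smoothM f g : smooth f -> smooth g -> smooth (fun x => f x * g x).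
Proof. by move=> sf sg n; exact: C_nM. Qed.

Lemma smoothV f : (forall x, f x != 0) -> smooth f -> smooth (fun x => (f x)^-1).
Proof. by move=> f0 sf n; exact: C_nV. Qed.

Lemma smooth_continuous f : smooth f -> continuous f.
Proof. by move=> /(_ 0) []. Qed.

Lemma smooth_sum N (F : nat -> V -> R) : (forall n, smooth (F n)) ->
  smooth (fun x => \sum_(n < N) F n x).
Proof.
move=> sF; elim: N => [|N IH].
  by rewrite (_ : (fun _ => _) = fun=> 0); [exact: smooth_cst|apply/funext => x; rewrite big_ord0].
rewrite (_ : (fun _ => _) = fun x => \sum_(n < N) F n x + F N x); first exact: smoothD.
by apply/funext => x; rewrite big_ord_recr.
Qed.

End IteratedDerivatives.

(** * Calculus in one variable and smooth cutoffs *)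

Section Smooth1D.
Variable R : realType.
Implicit Types f g : R -> R.

Lemma derive_scale f (x v : R) : derivable f x 1 ->
  derivable f x v /\ 'D_v f x = v * 'D_1 f x.
Proof.
move=> /derivable1_diffP df; split; first exact: diff_derivable.
rewrite !deriveE//.
have -> : 'd f x v = 'd f x (v *: 1) by rewrite [v *: 1]mulr1.
by rewrite linearZ.
Qed.

(** [C_n] quantifies over all directions; on the line they are multiples of 1, so one derivative
    suffices. *)
Lemma C_n_is_derive n f f' : (forall x : R, is_derive x 1 f (f' x)) -> C_n n f' -> C_n n.+1 f.
Proof.
move=> df Cf'; split.
  move=> x; apply: differentiable_continuous; apply/derivable1_diffP.
  by have [] := df x.
move=> v; split.
  by move=> z; have [dz _] := df z; have [] := derive_scale v dz.
rewrite (_ : 'D_v f = fun x => v * f' x); first by apply: C_nM => //; exact: C_n_cst.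
apply/funext => x; have [dz <-] := df x; by have [] := derive_scale v dz.
Qed.

Lemma smooth_is_derive f : smooth f -> forall x : R, is_derive x 1 f ('D_1 f x).
Proof. by move=> /(_ 1%N)[_ /(_ 1)[df _]] x; exact: DeriveDef. Qed.

Lemma smooth_derive f : smooth f -> smooth ('D_1 f).
Proof. by move=> sf n; have [_ /(_ 1)[]] := sf n.+1. Qed.

Lemma C_n_affine n (a b : R) f : C_n n f -> C_n n (fun x => f (a * x + b)).
Proof.
have caff : continuous (fun x : R => a * x + b).
  by move=> x; apply: cvgD; [apply: cvgM; [exact: cvg_cst|exact: cvg_id]|exact: cvg_cst].
elim: n f => [|n IH] f [cf Hf].
  by split=> // x; apply: (continuous_comp (caff x)); exact: cf.
split; first by move=> x; apply: (continuous_comp (caff x)); exact: cf.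
move=> v; have [df Cf] := Hf (a * v).
have E z : (fun h : R => h^-1 *: (f (a * (h *: v + z) + b) - f (a * z + b))) =
           (fun h : R => h^-1 *: (f (h *: (a * v) + (a * z + b)) - f (a * z + b))).
  apply/funext => h; congr (_ *: (f _ - _)).
  by rewrite /GRing.scale/=; ring.
split.
  by move=> z; rewrite /derivable/= E; exact: df.
rewrite (_ : 'D_v _ = fun x => 'D_(a * v) f (a * x + b)); first exact: (IH _ Cf).
by apply/funext => z; rewrite /derive/= E.
Qed.

Lemma smooth_affine (a b : R) f : smooth f -> smooth (fun x => f (a * x + b)).
Proof. by move=> sf n; exact: C_n_affine. Qed.

(** Along [v] the difference quotient of [f] composed with [fst] is convertible to that of [f] along
    [v.1], so the derivative keeps the same form. *)
Lemma C_n_fst n f : C_n n f -> C_n n (fun z : R * R => f z.1).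
Proof.
elim: n f => [|n IH] f [cf Hf].
  by split=> // x; apply: (@continuous_comp _ _ _ fst f); [exact: cvg_fst|exact: cf].
split; first by move=> x; apply: (@continuous_comp _ _ _ fst f); [exact: cvg_fst|exact: cf].
move=> v; have [df Cf] := Hf v.1; split; first by move=> z; exact: df z.1.
exact: (IH _ Cf).
Qed.

Lemma C_n_snd n f : C_n n f -> C_n n (fun z : R * R => f z.2).
Proof.
elim: n f => [|n IH] f [cf Hf].
  by split=> // x; apply: (@continuous_comp _ _ _ snd f); [exact: cvg_snd|exact: cf].
split; first by move=> x; apply: (@continuous_comp _ _ _ snd f); [exact: cvg_snd|exact: cf].
move=> v; have [df Cf] := Hf v.2; split; first by move=> z; exact: df z.2.
exact: (IH _ Cf).
Qed.

Lemma is_derive_mul f g (x df dg : R) : is_derive x 1 f df -> is_derive x 1 g dg ->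
  is_derive x 1 (fun y => f y * g y) (f x * dg + g x * df).
Proof. by move=> Hf Hg; exact: (is_deriveM Hf Hg). Qed.

Lemma is_derive_add f g (x df dg : R) : is_derive x 1 f df -> is_derive x 1 g dg ->
  is_derive x 1 (fun y => f y + g y) (df + dg).
Proof. by move=> Hf Hg; exact: (is_deriveD Hf Hg). Qed.

Lemma is_derive_scale f (c x df : R) : is_derive x 1 f df ->
  is_derive x 1 (fun y => c * f y) (c * df).
Proof.
move=> Hf; have := is_derive_mul (is_derive_cst c x 1) Hf.
by rewrite mulr0 addr0.
Qed.

Lemma is_derive_affine (a b x : R) : is_derive x 1 (fun y => a * y + b) a.
Proof.
have := is_derive_add (is_derive_scale a (is_derive_id x 1)) (is_derive_cst b x 1).
by rewrite addr0 mulr1.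
Qed.

Lemma is_derive_eq f (x df df' : R) : is_derive x 1 f df -> df = df' -> is_derive x 1 f df'.
Proof. by move=> ? <-. Qed.

Lemma is_derive_pow f (x df : R) k : is_derive x 1 f df ->
  is_derive x 1 (fun y => f y ^+ k) (k%:R * f x ^+ k.-1 * df).
Proof.
move=> Hf; elim: k => [|k IH].
  by rewrite !mul0r; exact: (is_derive_cst (1 : R) x 1).
rewrite (_ : (fun y => _) = fun y => f y * f y ^+ k); last first.
  by apply/funext => y; rewrite exprS.
apply: is_derive_eq (is_derive_mul Hf IH) _.
case: k {IH} => [|k] /=; first by rewrite !expr0; ring.
by rewrite exprS -[k.+2]addn1 natrD; ring.
Qed.

Lemma derive_tensor f g (x t : R) : smooth g ->
  'D_((0, 1) : R * R) (fun z => f z.1 * g z.2) (x, t) = f x * 'D_1 g t.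
Proof.
move=> /smooth_is_derive/(_ t) dg.
have -> : 'D_((0, 1) : R * R) (fun z => f z.1 * g z.2) (x, t) =
          'D_1 (fun s => f x * g s) t.
  apply: (congr1 (fun q : R -> R => lim (q @ 0^'))); apply/funext => h.
  by rewrite /= scaler0 add0r.
by have dM := is_derive_scale (f x) dg; exact: derive_val.
Qed.

Lemma test_fun_tensor (A B : set R) f g : test_fun A f -> test_fun B g ->
  test_fun (A `*` B) (fun z : R * R => f z.1 * g z.2).
Proof.
move=> [sf [K [cK KA f0]]] [sg [L [cL LB g0]]]; split.
  by move=> n; apply: C_nM; [exact: C_n_fst|exact: C_n_snd].
exists (K `*` L); split; first exact: compact_setX.
  by move=> z [/KA ? /LB ?].
move=> [x t] /= H; have [Kx|/f0 ->] := pselect (K x); last by rewrite mul0r.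
have [Lt|/g0 ->] := pselect (L t); last by rewrite mulr0.
by case: H.
Qed.

Lemma test_funM (A : set R) f g : smooth f -> test_fun A g -> test_fun A (fun x => f x * g x).
Proof.
move=> sf [sg [K [cK KA g0]]]; split; first exact: smoothM.
by exists K; split=> // z /g0 ->; rewrite mulr0.
Qed.

(* [x^-k exp(-1/x)], extended by zero: a family closed under differentiation. *)
Definition flat k (x : R) : R := if 0 < x then (x^-1) ^+ k * expR (- x^-1) else 0.

Lemma flat_ge0 k x : 0 <= flat k x.
Proof.
rewrite /flat; case: ifP => // x0.
by rewrite mulr_ge0 ?expR_ge0 ?exprn_ge0 ?invr_ge0// ltW.
Qed.

Lemma flat_gt0 x : 0 < x -> 0 < flat 0 x.
Proof. by move=> x0; rewrite /flat x0 mul1r expR_gt0. Qed.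

Lemma flat_le0 k x : x <= 0 -> flat k x = 0.
Proof. by move=> x0; rewrite /flat ltNge x0. Qed.

(** This is [exp y >= y^(k+1) / (k+1)!] at [y = 1/x]. It controls the family at 0, the only delicate
    point for smoothness. *)
Lemma flat_small k x : 0 < x -> flat k x <= (k.+1)`!%:R * x.
Proof.
move=> x0; rewrite /flat x0 expRN.
have y0 : 0 < x^-1 by rewrite invr_gt0.
rewrite ler_pdivrMr ?expR_gt0//.
have := expR_ge1Dxn k (ltW y0).
have f0 : 0 < (k.+1)`!%:R :> R by rewrite ltr0n fact_gt0.
move=> H; have {}H : x^-1 ^+ k.+1 / (k.+1)`!%:R <= expR x^-1 by apply: le_trans H; rewrite lerDr.
rewrite ler_pdivrMr// in H.
apply: le_trans (_ : x * x^-1 ^+ k.+1 <= _).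
  by rewrite exprS mulrA mulfV ?gt_eqF// mul1r.
by rewrite -mulrA (mulrC _ (x * _)) -mulrA ler_pM2l.
Qed.

Lemma is_derive_flat k (x : R) : is_derive x 1 (flat k) (flat k.+2 x - k%:R * flat k.+1 x).
Proof.
have [x0|x0|->] := ltgtP x 0.
- rewrite !flat_le0 ?ltW// mulr0 subr0.
  apply: (near_eq_is_derive (f := fun=> 0)).
  by near=> y; rewrite /= flat_le0// ltW//; near: y; exact: lt_nbhsl.
- apply: (near_eq_is_derive (f := fun y : R => (y^-1) ^+ k * expR (- y^-1))).
    near=> y; rewrite /flat ifT//; near: y; exact: lt_nbhsr.
  have xn0 : x != 0 by rewrite gt_eqF.
  have dV : is_derive x 1 (fun y : R => y^-1) (- x ^- 2).
    by have := @is_deriveV R id x 1 1 xn0 (is_derive_id _ _); rewrite [_ *: _]mulr1.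
  have dX : is_derive x 1 (fun y : R => y^-1 ^+ k) (k%:R * (x^-1) ^+ k.-1 * (- x ^- 2)).
    exact: is_derive_pow.
  have dN : is_derive x 1 (fun y : R => - y^-1) (x ^- 2).
    by have := is_deriveN dV; rewrite opprK.
  have dE : is_derive x 1 (fun y : R => expR (- y^-1)) (expR (- x^-1) * x ^- 2).
    exact: (is_derive1_comp (is_derive_expR _) dN).
  apply: is_derive_eq (is_derive_mul dX dE) _.
  rewrite /flat x0 -exprVn; case: k {dX} => [|k] /=; first by rewrite !expr0; ring.
  by rewrite !exprS; ring.
- rewrite !flat_le0// mulr0 subr0.
  have cv : h^-1 *: (flat k (h *: 1 + 0) - flat k 0) @[h --> 0^'] --> (0 : R).
    apply/cvgrPdist_lt => e e0; rewrite near_withinE.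
    have f0 : 0 < (k.+2)`!%:R :> R by rewrite ltr0n fact_gt0.
    have : \forall h \near (0 : R), `|0 - h| < e / (k.+2)`!%:R.
      by apply: nbhsx_ballx; rewrite divr_gt0.
    apply: filterS => h; rewrite sub0r normrN ltr_pdivlMr// => he h0.
    rewrite addr0 [_%:A]mulr1 (flat_le0 _ (lexx 0)) subr0 sub0r normrN.
    have [hn|hp] := leP h 0; first by rewrite flat_le0// scaler0 normr0.
    (* Dividing by [h] only raises the index, so the difference quotient at 0 is again covered by
       [flat_small]. *)
    have -> : h^-1 *: flat k h = flat k.+1 h.
      by rewrite /flat hp exprS -mulrA.
    rewrite ger0_norm ?flat_ge0//; apply: le_lt_trans (flat_small _ hp) _.
    by rewrite mulrC (le_lt_trans _ he)// ler_pM2r// ler_norm.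
  by apply: DeriveDef; [apply/cvg_ex; exists 0|apply/cvg_lim].
Unshelve. all: by end_near. Qed.

Lemma smooth_flat k : smooth (flat k).
Proof.
move=> n; elim: n k => [|n IH] k.
  split=> // x; apply: differentiable_continuous; apply/derivable1_diffP.
  by have [] := is_derive_flat k x.
apply: C_n_is_derive (is_derive_flat k) _.
rewrite (_ : (fun _ => _) = fun x => flat k.+2 x + (- k%:R) * flat k.+1 x).
  by apply: C_nD => //; apply: C_nM => //; exact: C_n_cst.
by apply/funext => x; rewrite mulNr.
Qed.

(** The standard quotient of flat functions, rising from 0 to 1 on [1, 2]. As [y - 1] and [2 - y]
    are never both nonpositive, the denominator is positive. *)
Definition step (y : R) : R := flat 0 (y - 1) / (flat 0 (y - 1) + flat 0 (2 - y)).

Lemma step_den y : 0 < flat 0 (y - 1) + flat 0 (2 - y).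
Proof.
have [y1|y1] := leP y 1.
  by rewrite ltr_wpDl ?flat_ge0// flat_gt0//; lra.
by rewrite ltr_wpDr ?flat_ge0// flat_gt0//; lra.
Qed.

Lemma smooth_step : smooth step.
Proof.
have s1 : smooth (fun y : R => flat 0 (y - 1)).
  have -> : (fun y => flat 0 (y - 1)) = (fun y => flat 0 (1 * y + (-1))).
    by apply/funext => y; rewrite mul1r.
  exact/smooth_affine/smooth_flat.
have s2 : smooth (fun y : R => flat 0 (2 - y)).
  have -> : (fun y => flat 0 (2 - y)) = (fun y => flat 0 ((-1) * y + 2)).
    by apply/funext => y; rewrite mulN1r addrC.
  exact/smooth_affine/smooth_flat.
apply: smoothM => //; apply: smoothV; last exact: smoothD.
by move=> y; rewrite gt_eqF// step_den.
Qed.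

Lemma step_le1 y : y <= 1 -> step y = 0.
Proof. by move=> y1; rewrite /step flat_le0 ?mul0r// subr_le0. Qed.

Lemma step_ge2 y : 2 <= y -> step y = 1.
Proof.
move=> y2; rewrite /step (flat_le0 _ (x := 2 - y)) ?subr_le0//.
by rewrite addr0 mulfV// gt_eqF// flat_gt0//; lra.
Qed.

Lemma step_ge0 y : 0 <= step y.
Proof. by rewrite /step divr_ge0 ?flat_ge0// ltW// step_den. Qed.

Lemma step_leone y : step y <= 1.
Proof. by rewrite /step ler_pdivrMr ?step_den// mul1r lerDl flat_ge0. Qed.

(** [step] is constant off [1, 2], so compactness of [0, 3] bounds the derivative; thanks to the
    margins, [step] is locally constant at every point outside. *)
Lemma derive_step_bounded : exists2 S : R, 0 < S & forall y : R, `|'D_1 step y| <= S.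
Proof.
have cs : continuous ('D_1 step) by apply: smooth_continuous; apply: smooth_derive; exact: smooth_step.
have [M M0 HM] := @within_continuous_bounded R 0 3 _ (continuous_subspaceT cs).
exists (M + 1); first by rewrite ltr_wpDl.
move=> y; rewrite (le_trans _ (_ : M <= _)) ?lerDl//.
have [/HM //|] := boolP (0 <= y <= 3).
rewrite negb_and -!ltNge => /orP[y0|y3].
- rewrite (@near_eq_derive _ _ _ _ (cst (0 : R))) ?derive_cst ?normr0//.
  near=> z; rewrite step_le1// (@le_trans _ _ 0)// ltW//; near: z; exact: lt_nbhsl.
- rewrite (@near_eq_derive _ _ _ _ (cst (1 : R))) ?derive_cst ?normr0//.
  near=> z; rewrite step_ge2// (@le_trans _ _ 3)//; first by lra.
  by rewrite ltW//; near: z; exact: lt_nbhsr.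
Unshelve. all: by end_near. Qed.

(** The product of a rising and a falling copy of [step] at scale [e], each contributing one half of
    the constant. [S] is fixed before [a], [b] and [e]: however thin the transition layers of width
    [2 * e], the integral of the absolute value of the derivative over them stays bounded. *)
Lemma cutoff_exists : exists2 S : R, 0 < S & forall a b e : R, 0 < e -> 4 * e < b - a ->
  exists2 theta : R -> R, test_fun (`]a, b[%classic : set R) theta &
  [/\ forall x, 0 <= theta x <= 1, forall x, a + 2 * e <= x <= b - 2 * e -> theta x = 1
    & forall x, `|'D_1 theta x| <= S / e].
Proof.
have [S S0 HS] := derive_step_bounded.
exists (S + S); first by rewrite addr_gt0.
move=> a b e e0 ab.
have en0 : e != 0 by rewrite gt_eqF.
pose u x := step (e^-1 * x + (- a / e)).
pose w x := step ((- e^-1) * x + b / e).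
have su : smooth u by exact/smooth_affine/smooth_step.
have sw : smooth w by exact/smooth_affine/smooth_step.
have uE x : e^-1 * x + (- a / e) = (x - a) / e by field.
have wE x : (- e^-1) * x + b / e = (b - x) / e by field.
exists (fun x => u x * w x).
  split; first exact: smoothM.
  exists `[a + e, b - e]%classic; split; first exact: segment_compact.
    move=> x /=; rewrite !in_itv/= => /andP[? ?]; apply/andP; split; lra.
  move=> x /=; rewrite in_itv/= => /negP; rewrite negb_and -!ltNge => /orP[H|H].
    by rewrite /u uE step_le1 ?mul0r// ler_pdivrMr//; lra.
  by rewrite /w wE step_le1 ?mulr0// ler_pdivrMr//; lra.
split.
- by move=> x; rewrite mulr_ge0 ?step_ge0//= mulr_ile1 ?step_ge0 ?step_leone.
- by move=> x /andP[x1 x2]; rewrite /u /w uE wE !step_ge2 ?mulr1// ler_pdivlMr//; lra.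
move=> x.
have du (c d : R) : is_derive x 1 (fun y => step (c * y + d)) ('D_1 step (c * x + d) * c).
  exact: (is_derive1_comp (smooth_is_derive smooth_step _) (is_derive_affine c d x)).
have dM := is_derive_mul (du e^-1 (- a / e)) (du (- e^-1) (b / e)).
rewrite (@derive_val _ _ _ _ _ _ _ dM).
have ei0 : 0 < e^-1 by rewrite invr_gt0.
apply: le_trans (ler_normD _ _) _.
rewrite mulrDl; apply: lerD; rewrite normrM ger0_norm ?step_ge0// -[leRHS]mul1r;
  apply: ler_pM => //; rewrite ?step_ge0 ?step_leone// normrM ?normrN (gtr0_norm ei0);
  by rewrite ler_pM2r.
Qed.

End Smooth1D.

(** * Completeness of the sine system *)

Section Bernstein.
Variable R : realFieldType.
Implicit Types (y : R).

Definition bern N j y : R := 'C(N, j)%:R * y ^+ j * (1 - y) ^+ (N - j).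

Lemma bern_ge0 N j y : 0 <= y <= 1 -> 0 <= bern N j y.
Proof. by move=> /andP[? ?]; rewrite !mulr_ge0 ?exprn_ge0 ?subr_ge0. Qed.

Lemma sum_bern N y : \sum_(j < N.+1) bern N j y = 1.
Proof.
rewrite -[RHS](expr1n _ N) -[X in X ^+ N](subrK y 1) exprDn.
by apply: eq_bigr => j _; rewrite /bern -mulr_natl; ring.
Qed.

(** The identity [j C(N+1, j) = (N+1) C(N, j-1)]. The weight [h] lets the same step serve the first
    and the second moment. *)
Lemma sum_bern_absorb N y (h : nat -> R) :
  \sum_(j < N.+2) j%:R * bern N.+1 j y * h j =
  N.+1%:R * y * \sum_(j < N.+1) bern N j y * h j.+1.
Proof.
rewrite big_ord_recl !mul0r add0r mulr_sumr; apply: eq_bigr => j _.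
rewrite lift0 /bern subSS exprS.
have := congr1 (fun k : nat => k%:R : R) (mul_bin_diag N.+1 j).
rewrite /= !natrM => H.
transitivity (j.+1%:R * 'C(N.+1, j.+1)%:R * (y * y ^+ j * (1 - y) ^+ (N - j) * h j.+1)).
  by ring.
by rewrite -H; ring.
Qed.

Lemma sum_bern1 N y : \sum_(j < N.+2) j%:R * bern N.+1 j y = N.+1%:R * y.
Proof.
rewrite -[RHS]mulr1 -[X in _ = _ * X](sum_bern N y).
transitivity (\sum_(j < N.+2) j%:R * bern N.+1 j y * 1).
  by apply: eq_bigr => j _; rewrite mulr1.
rewrite (sum_bern_absorb N y (fun=> 1)); congr (_ * _).
by apply: eq_bigr => j _; rewrite mulr1.
Qed.

Lemma sum_bern2 N y : \sum_(j < N.+2) j%:R ^+ 2 * bern N.+1 j y =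
  N.+1%:R * y * (N%:R * y + 1).
Proof.
transitivity (\sum_(j < N.+2) j%:R * bern N.+1 j y * j%:R).
  by apply: eq_bigr => j _; ring.
rewrite (sum_bern_absorb N y (fun j => j%:R)); congr (_ * _).
transitivity (\sum_(j < N.+1) (j%:R * bern N j y + bern N j y)).
  by apply: eq_bigr => j _; rewrite -[j.+1]addn1 natrD; ring.
rewrite big_split/= sum_bern; congr (_ + 1).
by case: N => [|N]; rewrite ?sum_bern1// big_ord_recl big_ord0 !mul0r add0r.
Qed.

Lemma bern_variance N y :
  \sum_(j < N.+2) bern N.+1 j y * (y - j%:R / N.+1%:R) ^+ 2 = y * (1 - y) / N.+1%:R.
Proof.
have n0 : N.+1%:R != 0 :> R by rewrite pnatr_eq0.
transitivity (\sum_(j < N.+2) ((y ^+ 2 * bern N.+1 j y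
   + (- 2 * y / N.+1%:R) * (j%:R * bern N.+1 j y))
   + (N.+1%:R ^- 2) * (j%:R ^+ 2 * bern N.+1 j y))).
  by apply: eq_bigr => j _; rewrite -exprVn; ring.
rewrite !big_split/= -!mulr_sumr sum_bern sum_bern1 sum_bern2.
by rewrite -[in N%:R * y + 1](addnK 1%N N) addn1 natrB//; field.
Qed.

End Bernstein.

(** * Retraction onto an interval *)

Section Clamp.
Variable R : realType.
Implicit Types (a b x : R).

(** The retraction of the line onto [a, b]. Composition with it on the right extends functions
    continuously beyond the interval; composition on the left truncates values. *)
Definition clamp a b x : R := Num.max a (Num.min b x).

Lemma clamp_itv a b x : a <= b -> a <= clamp a b x <= b.
Proof. by move=> ab; rewrite /clamp le_max lexx/= ge_max ab ge_min lexx. Qed.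

Lemma clamp_id a b x : a <= x <= b -> clamp a b x = x.
Proof. by move=> /andP[ax xb]; rewrite /clamp (min_idPr xb) (max_idPr ax). Qed.

Lemma clamp_lip a b x y : `|clamp a b x - clamp a b y| <= `|x - y|.
Proof.
rewrite /clamp.
have h1 : x - y <= `|x - y| by exact: ler_norm.
have h2 : y - x <= `|x - y| by rewrite distrC; exact: ler_norm.
rewrite ler_norml; move: `|x - y| h1 h2 => d h1 h2.
rewrite !maxEle !minEle; apply/andP.
by do ! case: ifPn; rewrite -?ltNge => *; split; lra.
Qed.

Lemma clamp_continuous (T : topologicalType) a b (f : R -> T) : a <= b ->
  {within `[a, b], continuous f} -> continuous (f \o clamp a b).
Proof.
move=> ab /subspace_continuousP cf x.
have Ax : `[a, b]%classic (clamp a b x) by rewrite /= in_itv/= clamp_itv.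
move: (cf _ Ax) => /=; apply: cvg_trans.
rewrite /from_subspace.
apply: (@cvg_comp _ _ _ (clamp a b) f (nbhs x) (within `[a, b]%classic (nbhs (clamp a b x)))) => //.
move=> B; rewrite /within/= => -/nbhs_ballP[e /= e0 eB].
apply/nbhs_ballP; exists e => // y xy.
apply: eB => /=; last by rewrite in_itv/= clamp_itv.
by rewrite /ball/=; apply: le_lt_trans xy; exact: clamp_lip.
Qed.

End Clamp.

(** * Sine functions, their span and its density *)

Section SineSystem.
Variables (R : realType) (l : R).
Hypothesis hl : 0 < l.
Local Notation D := (`]0, l[%classic : set R).
Local Notation L2 := (L2 (leb R) (`]0, l[%classic : set R)).
Local Notation ip := (ip (leb R) (`]0, l[%classic : set R)).

Definition freq n : R := n.+1%:R * pi / l.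
Definition sn n (x : R) : R := sin (freq n * x).
Definition csn n (x : R) : R := cos (freq n * x).

Lemma freq_gt0 n : 0 < freq n.
Proof. by rewrite /freq divr_gt0// mulr_gt0 ?pi_gt0. Qed.

Lemma freq_inj : injective freq.
Proof.
move=> m n /eqP; have pl : pi / l != 0 :> R by rewrite gt_eqF// divr_gt0// pi_gt0.
by rewrite /freq -!mulrA (inj_eq (mulIf pl)) eqr_nat => /eqP[].
Qed.

Lemma is_derive_sn n (x : R) : is_derive x 1 (sn n) (freq n * csn n x).
Proof.
have := is_derive1_comp (is_derive_sin _) (is_derive_affine (freq n) 0 x).
rewrite (_ : _ \o _ = sn n); last by apply/funext => y; rewrite /sn /= addr0.
by move=> H; apply: is_derive_eq H _; rewrite addr0 mulrC.
Qed.

Lemma is_derive_csn n (x : R) : is_derive x 1 (csn n) (- freq n * sn n x).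
Proof.
have := is_derive1_comp (is_derive_cos _) (is_derive_affine (freq n) 0 x).
rewrite (_ : _ \o _ = csn n); last by apply/funext => y; rewrite /csn /= addr0.
by move=> H; apply: is_derive_eq H _; rewrite addr0 mulrC mulrN mulNr.
Qed.

Lemma continuous_sn n : continuous (sn n).
Proof. exact: is_derive_continuous (is_derive_sn n). Qed.

Lemma continuous_csn n : continuous (csn n).
Proof. exact: is_derive_continuous (is_derive_csn n). Qed.

Lemma smooth_sn_csn n : smooth (sn n) /\ smooth (csn n).
Proof.
have H k : C_n k (sn n) /\ C_n k (csn n).
  elim: k => [|k [IHs IHc]].
    by split; split=> //; [exact: continuous_sn|exact: continuous_csn].
  split.
    apply: C_n_is_derive (is_derive_sn n) _.
    by apply: C_nM => //; exact: C_n_cst.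
  apply: C_n_is_derive (is_derive_csn n) _.
  by apply: C_nM => //; exact: C_n_cst.
by split=> k; have [] := H k.
Qed.

Lemma sn0 n : sn n 0 = 0.
Proof. by rewrite /sn mulr0 sin0. Qed.

Lemma snl n : sn n l = 0.
Proof.
rewrite /sn /freq divfK ?gt_eqF//; elim: n.+1 => [|m IH]; first by rewrite mul0r sin0.
by rewrite -addn1 natrD mulrDl mul1r sinDpi IH oppr0.
Qed.

Lemma sn_bound n x : `|sn n x| <= 1.
Proof. exact: sin_max. Qed.

Lemma csn_bound n x : `|csn n x| <= 1.
Proof. exact: cos_max. Qed.

Lemma L2_sn n : L2 (sn n).
Proof. exact/continuous_L2/continuous_sn. Qed.

Lemma L2_csn n : L2 (csn n).
Proof. exact/continuous_L2/continuous_csn. Qed.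

Lemma csn_sn_sqr n x : csn n x ^+ 2 = 1 - sn n x ^+ 2.
Proof. by rewrite -(cos2Dsin2 (freq n * x)) addrK. Qed.

Lemma ip_sn_sn m n : ip (sn m) (sn n) = if m == n then l / 2 else 0.
Proof.
have cp : continuous (fun x => sn m x * sn n x).
  by move=> x; apply: cvgM; exact: continuous_sn.
rewrite /ip; case: eqVneq => [mn|mn].
- subst n.
  pose F x := 2^-1 * x + (- (2 * freq m)^-1) * (sn m x * csn m x).
  have dF (x : R) : is_derive x 1 F (sn m x * sn m x).
    have := is_derive_add (is_derive_scale 2^-1 (is_derive_id x 1)) (is_derive_scale
      (- (2 * freq m)^-1) (is_derive_mul (is_derive_sn m x) (is_derive_csn m x))).
    move=> H; apply: is_derive_eq H _.
    have f0 : freq m != 0 by rewrite gt_eqF// freq_gt0.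
    transitivity (2^-1 - 2^-1 * (csn m x ^+ 2 - sn m x ^+ 2)); first by field.
    by rewrite csn_sn_sqr; field.
  rewrite (ftc (ltW hl) dF cp) /F sn0 snl; ring.
- have d0 : freq m ^+ 2 - freq n ^+ 2 != 0.
    rewrite subr_sqr mulf_eq0 negb_or subr_eq0 (inj_eq freq_inj) mn/=.
    by rewrite gt_eqF// addr_gt0 ?freq_gt0.
  (* The Wronskian of two eigenfunctions divided by the difference of the eigenvalues, a primitive
     of their product. *)
  pose F x := (freq m ^+ 2 - freq n ^+ 2)^-1 *
    (freq n * (sn m x * csn n x) + (- freq m) * (csn m x * sn n x)).
  have dF (x : R) : is_derive x 1 F (sn m x * sn n x).
    have := is_derive_scale (freq m ^+ 2 - freq n ^+ 2)^-1 (is_derive_add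
      (is_derive_scale (freq n) (is_derive_mul (is_derive_sn m x) (is_derive_csn n x)))
      (is_derive_scale (- freq m) (is_derive_mul (is_derive_csn m x) (is_derive_sn n x)))).
    by move=> H; apply: is_derive_eq H _; field.
  rewrite (ftc (ltW hl) dF cp) /F !sn0 !snl; ring.
Qed.

Definition psum (c : nat -> R) N (x : R) : R := \sum_(n < N) c n * sn n x.

Lemma L2_psum c N : L2 (psum c N).
Proof.
apply: (@L2_sum _ _ R (leb R) D _ N (fun n x => c n * sn n x)) => // n _.
by apply: L2Z => //; exact: L2_sn.
Qed.

Lemma continuous_psum c N : continuous (psum c N).
Proof.
apply: smooth_continuous.
apply: (smooth_sum N (F := fun n x => c n * sn n x)) => n; apply: smoothM.
  exact: smooth_cst.
by have [] := smooth_sn_csn n.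
Qed.

Lemma ip_psum c N g : L2 g -> ip (psum c N) g = \sum_(n < N) c n * ip (sn n) g.
Proof.
move=> Lg; transitivity (\sum_(n < N) ip (fun x => c n * sn n x) g).
  apply: (@ip_suml _ _ R (leb R) D _ N (fun n x => c n * sn n x)) => // n _.
  by apply: L2Z => //; exact: L2_sn.
by apply: eq_bigr => n _; rewrite ipZl//; exact: L2_sn.
Qed.

Lemma ip_psum_sn c N m : ip (psum c N) (sn m) = if (m < N)%N then c m * (l / 2) else 0.
Proof.
rewrite ip_psum; last exact: L2_sn.
have [mN|Nm] := ltnP m N.
  rewrite (bigD1 (Ordinal mN))//= ip_sn_sn eqxx big1 ?addr0// => n nm.
  rewrite ip_sn_sn; case: eqP => [E|]; last by rewrite mulr0.
  by move/eqP: nm; case; apply/val_inj.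
rewrite big1// => n _; rewrite ip_sn_sn; case: eqP => [E|]; last by rewrite mulr0.
by move: (ltn_ord n); rewrite E ltnNge Nm.
Qed.

Lemma ip_psum_psum c N : ip (psum c N) (psum c N) = l / 2 * \sum_(n < N) c n ^+ 2.
Proof.
rewrite ip_psum; last exact: L2_psum.
rewrite mulr_sumr; apply: eq_bigr => n _.
have -> : ip (sn n) (psum c N) = ip (psum c N) (sn n) by exact: ipC.
by rewrite ip_psum_sn ltn_ord; ring.
Qed.

Lemma psum_widen c N M x : (N <= M)%N ->
  psum c N x = psum (fun n => if (n < N)%N then c n else 0) M x.
Proof.
move=> NM; rewrite /psum (big_ord_widen _ (fun n => c n * sn n x) NM) big_mkcond.
by apply: eq_bigr => n _; case: ifP => // _; rewrite mul0r.
Qed.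

(** A tail is written as a partial sum with zeroed coefficients, so that [ip_psum_psum] computes its
    norm. *)
Lemma psum_tail c N M x : (N <= M)%N ->
  psum c M x - psum c N x = psum (fun n => if (n < N)%N then 0 else c n) M x.
Proof.
move=> NM; rewrite (psum_widen c x NM) /psum -sumrB.
by apply: eq_bigr => n _; case: ifP; rewrite ?subrr ?mul0r ?subr0.
Qed.

Definition coef (g : R -> R) n : R := 2 / l * ip g (sn n).

Lemma ip_sn_coef g n : ip g (sn n) = l / 2 * coef g n.
Proof. by rewrite /coef; field; rewrite gt_eqF. Qed.

(** Completing the square in each coefficient. The choice [c = coef g] gives Bessel's inequality,
    and comparison with any other [c] shows that Fourier partial sums are optimal. *)
Lemma best_approx g c N : L2 g ->
  ip (fun x => g x - psum c N x) (fun x => g x - psum c N x) =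
  ip g g - l / 2 * \sum_(n < N) coef g n ^+ 2 + l / 2 * \sum_(n < N) (coef g n - c n) ^+ 2.
Proof.
move=> Lg; rewrite ip_sqB//; last exact: L2_psum.
rewrite ip_psum_psum (ipC _ _ g) ip_psum//.
have -> : \sum_(n < N) (coef g n - c n) ^+ 2 =
  \sum_(n < N) coef g n ^+ 2 + (- 2) * \sum_(n < N) c n * coef g n + \sum_(n < N) c n ^+ 2.
  rewrite mulr_sumr -!big_split/=; apply: eq_bigr => n _; ring.
have -> : \sum_(n < N) c n * ip (sn n) g = l / 2 * \sum_(n < N) c n * coef g n.
  rewrite mulr_sumr; apply: eq_bigr => n _; rewrite ipC ip_sn_coef; ring.
by ring.
Qed.

Lemma bessel g N : L2 g -> l / 2 * \sum_(n < N) coef g n ^+ 2 <= ip g g.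
Proof.
move=> Lg; have := ip_ge0 (leb R) D (fun x => g x - psum (coef g) N x).
rewrite best_approx// [X in _ + _ * X]big1 ?mulr0 ?addr0 ?subr_ge0// => n _.
by rewrite subrr expr0n.
Qed.

Definition sine_poly (f : R -> R) : Prop := exists c N, f = psum c N.

Lemma sine_poly_sn n : sine_poly (sn n).
Proof.
exists (fun m => (m == n)%:R), n.+1; apply/funext => x.
rewrite /psum (bigD1 ord_max)//= eqxx mul1r big1 ?addr0// => m mn.
case: eqP => [E|]; last by rewrite mul0r.
by move/eqP: mn; case; apply/val_inj.
Qed.

Lemma sine_polyZ a f : sine_poly f -> sine_poly (fun x => a * f x).
Proof.
move=> [c [N ->]]; exists (fun n => a * c n), N; apply/funext => x.
by rewrite /psum mulr_sumr; apply: eq_bigr => n _; rewrite mulrA.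
Qed.

Lemma sine_polyD f g : sine_poly f -> sine_poly g -> sine_poly (fun x => f x + g x).
Proof.
move=> [c [N ->]] [d [M ->]].
exists (fun n => (if (n < N)%N then c n else 0) + (if (n < M)%N then d n else 0)), (maxn N M).
apply/funext => x; rewrite (psum_widen c x (leq_maxl N M)) (psum_widen d x (leq_maxr N M)).
by rewrite /psum -big_split/=; apply: eq_bigr => n _; rewrite mulrDl.
Qed.

Lemma sine_poly0 : sine_poly (fun=> 0).
Proof. by exists (fun=> 0), 0%N; apply/funext => x; rewrite /psum big_ord0. Qed.

Lemma sine_poly_sum N (F : nat -> R -> R) : (forall n, sine_poly (F n)) ->
  sine_poly (fun x => \sum_(n < N) F n x).
Proof.
move=> HF; elim: N => [|N IH].
  by rewrite (_ : (fun _ => _) = fun=> 0); [exact: sine_poly0|apply/funext => x; rewrite big_ord0].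
rewrite (_ : (fun _ => _) = fun x => \sum_(n < N) F n x + F N x); first exact: sine_polyD.
by apply/funext => x; rewrite big_ord_recr.
Qed.

(** Product-to-sum formula. For [n = 0] the lower term would be sin 0, whence the case distinction.
    It makes sine polynomials stable under multiplication by polynomials in the cosine. *)
Lemma sn_mul_csn0 n x : sn n x * csn 0 x =
  2^-1 * sn n.+1 x + (if n is m.+1 then 2^-1 * sn m x else 0).
Proof.
have fS m : freq m.+1 = freq m + freq 0 by rewrite /freq -(addn1 m.+1) natrD; ring.
have E1 : sn n.+1 x = sn n x * csn 0 x + csn n x * sn 0 x.
  by rewrite /sn /csn fS mulrDl sinD.
case: n E1 => [|m] E1; rewrite E1.
  by rewrite (mulrC (csn 0 x)) addr0; field.
have -> : sn m x = sn m.+1 x * csn 0 x - csn m.+1 x * sn 0 x.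
  have -> : sn m x = sin (freq m.+1 * x + - (freq 0 * x)) by rewrite /sn fS; congr sin; ring.
  by rewrite sinD sinN cosN /sn /csn; ring.
by field.
Qed.

Lemma sine_poly_csn0 f : sine_poly f -> sine_poly (fun x => f x * csn 0 x).
Proof.
move=> [c [N ->]].
rewrite (_ : (fun x => _) = fun x => \sum_(n < N) c n * (sn n x * csn 0 x)); last first.
  by apply/funext => x; rewrite mulr_suml; apply: eq_bigr => n _; rewrite mulrA.
apply: (sine_poly_sum N (F := fun n x => c n * (sn n x * csn 0 x))) => n.
apply: sine_polyZ; rewrite (_ : (fun x => _) =
  fun x => 2^-1 * sn n.+1 x + (if n is m.+1 then 2^-1 * sn m x else 0)).
  apply: sine_polyD; first exact/sine_polyZ/sine_poly_sn.
  case: n => [|m]; first exact: sine_poly0.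
  exact/sine_polyZ/sine_poly_sn.
by apply/funext => x; exact: sn_mul_csn0.
Qed.

Lemma sine_poly_pow f (a b : R) j : sine_poly f ->
  sine_poly (fun x => f x * (a + b * csn 0 x) ^+ j).
Proof.
move=> sf; elim: j => [|j IH].
  by rewrite (_ : (fun x => _) = f)//; apply/funext => x; rewrite expr0 mulr1.
have sg := sine_polyD (sine_polyZ a IH) (sine_polyZ b (sine_poly_csn0 IH)).
rewrite (_ : (fun x => f x * _) = fun x : R => a * (f x * (a + b * csn 0 x) ^+ j) +
  b * (f x * (a + b * csn 0 x) ^+ j * csn 0 x))//.
by apply/funext => x; rewrite exprS; ring.
Qed.

Lemma sine_poly_bern N j : sine_poly (fun x => sn 0 x * bern N j ((1 - csn 0 x) / 2)).
Proof.
have s := sine_polyZ 'C(N, j)%:R (sine_poly_pow (2^-1) (2^-1) (N - j)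
  (sine_poly_pow (2^-1) (- 2^-1) j (sine_poly_sn 0))).
rewrite (_ : (fun x => sn 0 x * _) = fun x : R => 'C(N, j)%:R *
  (sn 0 x * (2^-1 + - 2^-1 * csn 0 x) ^+ j * (2^-1 + 2^-1 * csn 0 x) ^+ (N - j)))//.
apply/funext => x; rewrite /bern.
have -> : (1 - csn 0 x) / 2 = 2^-1 + - 2^-1 * csn 0 x by field.
have -> : 1 - (2^-1 + - 2^-1 * csn 0 x) = 2^-1 + 2^-1 * csn 0 x by field.
by ring.
Qed.

Lemma freq0_itv (x : R) : 0 <= x <= l -> freq 0 * x \in `[0, pi].
Proof.
move=> /andP[x0 xl]; rewrite in_itv/= mulr_ge0 ?(ltW (freq_gt0 0))//=.
have -> : freq 0 * x = pi * (x / l) by rewrite /freq; field; rewrite gt_eqF.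
by rewrite ler_piMr ?pi_ge0// ler_pdivrMr// mul1r.
Qed.

(** The modulus needed by a Korovkin argument. Pairs with oscillation at least [e] form a compact
    set off the diagonal, where the cosines differ since cosine is injective on [0, pi]; there the
    bounded oscillation is dominated by a multiple of the squared difference of the cosines. *)
Lemma cosine_modulus (k : R -> R) (e : R) : 0 < e -> {within `[0, l], continuous k} ->
  exists2 C : R, 0 <= C & forall x z : R, 0 <= x <= l -> 0 <= z <= l ->
    `|k x - k z| <= e + C * (csn 0 x - csn 0 z) ^+ 2.
Proof.
move=> e0 ck.
pose k' := k \o clamp 0 l.
have ck' : continuous k' by apply: clamp_continuous => //; exact: ltW.
pose A : set (R * R) := `[0, l]%classic `*` `[0, l]%classic.
pose G : R * R -> R := fun z => `|k' z.1 - k' z.2|.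
have cG : continuous G.
  move=> z; apply: (@cvg_norm _ R^o); apply: cvgB.
    by apply: (@continuous_comp _ _ _ fst k'); [exact: cvg_fst|exact: ck'].
  by apply: (@continuous_comp _ _ _ snd k'); [exact: cvg_snd|exact: ck'].
pose S := A `&` G @^-1` [set y | e <= y].
have cA : compact A by apply: compact_setX; exact: segment_compact.
have cS : compact S.
  apply: subclosed_compact cA _; last by move=> z [].
  apply: closedI.
    have cf : closed ((fst : R * R -> R) @^-1` `[0, l]%classic).
      by apply: closed_comp => [? _|]; [exact: cvg_fst|exact: interval_closed].
    have cs : closed ((snd : R * R -> R) @^-1` `[0, l]%classic).
      by apply: closed_comp => [? _|]; [exact: cvg_snd|exact: interval_closed].
    exact: (closedI cf cs).
  by apply: closed_comp => [? _|]; [exact: cG|exact: closed_ge].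
pose q : R * R -> R := fun z => ((csn 0 z.1 - csn 0 z.2) ^+ 2)^-1.
have q0 z : S z -> csn 0 z.1 - csn 0 z.2 != 0.
  move=> [[/= z1 z2] /= Gz]; rewrite subr_eq0; apply/eqP => E.
  rewrite !in_itv/= in z1 z2.
  have := cos_inj (freq0_itv z1) (freq0_itv z2) E.
  move=> /(mulfI (negbT (gt_eqF (freq_gt0 0)))) Z.
  by move: Gz; rewrite /G Z subrr normr0 leNgt e0.
have cq : {within S, continuous q}.
  apply/subspace_continuousP => z Sz; apply: cvg_within_filter.
  apply: cvgV; first by rewrite expf_eq0 negb_and q0// orbT.
  have cd : {for z, continuous (fun z : R * R => csn 0 z.1 - csn 0 z.2)}.
    apply: cvgB.
      by apply: (@continuous_comp _ _ _ fst (csn 0)); [exact: cvg_fst|exact: continuous_csn].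
    by apply: (@continuous_comp _ _ _ snd (csn 0)); [exact: cvg_snd|exact: continuous_csn].
  by apply: cvgM; exact: cd.
have /compact_bounded[Q [_ HQ]] := continuous_compact cq cS.
have [M M0 HM] := within_continuous_bounded ck.
(* [2 * M] bounds every oscillation of [k], and [|Q| + 1] bounds the inverse squared difference of
   the cosines on [S]. *)
exists (2 * M * (`|Q| + 1)); first by rewrite !mulr_ge0// addr_ge0.
move=> x z x0l z0l.
have [|ek] := leP `|k x - k z| e.
  by move=> /le_trans; apply; rewrite lerDl mulr_ge0 ?sqr_ge0// !mulr_ge0// addr_ge0.
have Sxz : S (x, z).
  split; first by split; rewrite /= in_itv.
  by rewrite /= /G/= /k'/= !clamp_id// ltW.
have := HQ (`|Q| + 1); rewrite (le_lt_trans (ler_norm _)) ?ltrDl// => /(_ isT (q (x, z))).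
move=> /(_ (ex_intro2 _ _ (x, z) Sxz erefl)).
have d0 := q0 _ Sxz; rewrite /= in d0.
have d2 : 0 < (csn 0 x - csn 0 z) ^+ 2 by rewrite exprn_even_gt0.
rewrite /q/= ger0_norm ?invr_ge0 ?(ltW d2)// => H.
have {}H : 1 <= (`|Q| + 1) * (csn 0 x - csn 0 z) ^+ 2 by rewrite -ler_pdivrMr// mul1r.
have kb : `|k x - k z| <= 2 * M.
  apply: le_trans (ler_normB _ _) _.
  by have := HM _ x0l; have := HM _ z0l; lra.
apply: le_trans kb _; apply: le_trans (_ : 2 * M * ((`|Q| + 1) * (csn 0 x - csn 0 z) ^+ 2) <= _).
  by rewrite ler_peMr// mulr_ge0.
by rewrite mulrA lerDr ltW.
Qed.

(* Bernstein polynomials of [k] in the variable (1 - cos (pi x / l)) / 2, times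
   sin (pi x / l), are sine polynomials. *)
Lemma sine_poly_dense_uniform (k : R -> R) (e : R) : 0 < e -> {within `[0, l], continuous k} ->
  exists2 f, sine_poly f & forall x : R, 0 <= x <= l -> `|sn 0 x * k x - f x| <= e.
Proof.
move=> e0 ck.
have [C C0 HC] := cosine_modulus (divr_gt0 e0 (ltr0Sn R 1)) ck.
(* The variance term will be at most [C / N.+1], because [4 y (1 - y) <= 1]. *)
have [N HN] : exists N, C / N.+1%:R <= e / 2.
  exists (Num.truncn (C / (e / 2))); rewrite ler_pdivrMr// mulrC -ler_pdivrMr ?divr_gt0//.
  by apply: ltW; exact: truncnS_gt.
(* The nodes of the Bernstein sum: the points of [0, l] at which [(1 - cos (pi x / l)) / 2] equals
   [j / N.+1]. *)
pose nd (j : nat) : R := acos (1 - 2 * (j%:R / N.+1%:R)) / freq 0.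
have ndP (j : nat) : (j <= N.+1)%N -> 0 <= nd j <= l /\ csn 0 (nd j) = 1 - 2 * (j%:R / N.+1%:R).
  move=> jN.
  have q1 : 0 <= (j%:R / N.+1%:R : R) <= 1.
    by rewrite divr_ge0//= ler_pdivrMr// mul1r ler_nat.
  have i1 : is_true (-1 <= (1 - 2 * (j%:R / N.+1%:R) : R) <= 1).
    move: (j%:R / _) q1 => q /andP[? ?]; apply/andP; split; lra.
  split; last first.
    by rewrite /csn /nd mulrC divfK ?gt_eqF ?freq_gt0// acosK// in_itv.
  rewrite /nd divr_ge0 ?acos_ge0 ?(ltW (freq_gt0 0))//= ler_pdivrMr ?freq_gt0//.
  have -> : l * freq 0 = pi by rewrite /freq; field; rewrite gt_eqF.
  exact: acos_lepi.
pose f x := \sum_(j < N.+2) k (nd j) * (sn 0 x * bern N.+1 j ((1 - csn 0 x) / 2)).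
exists f.
  apply: (sine_poly_sum N.+2 (F := fun j x => k (nd j) * (sn 0 x * bern N.+1 j ((1 - csn 0 x) / 2)))).
  by move=> j; apply: sine_polyZ; exact: sine_poly_bern.
move=> x xl; set y := (1 - csn 0 x) / 2.
have y01 : 0 <= y <= 1.
  have : -1 <= csn 0 x <= 1 by rewrite -ler_norml csn_bound.
  by rewrite /y => /andP[? ?]; apply/andP; split; lra.
have -> : sn 0 x * k x - f x = sn 0 x * \sum_(j < N.+2) bern N.+1 j y * (k x - k (nd j)).
  rewrite /f mulr_sumr.
  have -> : sn 0 x * k x = \sum_(j < N.+2) sn 0 x * k x * bern N.+1 j y.
    by rewrite -mulr_sumr sum_bern mulr1.
  by rewrite -sumrB; apply: eq_bigr => j _; rewrite -/y; ring.
rewrite normrM -[leRHS]mul1r; apply: ler_pM => //; first exact: sn_bound.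
apply: le_trans (ler_norm_sum _ _ _) _.
apply: (@le_trans _ _ (\sum_(j < N.+2) (e / 2 * bern N.+1 j y +
    4 * C * (bern N.+1 j y * (y - j%:R / N.+1%:R) ^+ 2)))).
  apply: ler_sum => j _; rewrite normrM ger0_norm ?bern_ge0//.
  have jN : (j <= N.+1)%N by rewrite -ltnS.
  have [nd0 ndc] := ndP j jN.
  have := HC x (nd j) xl nd0; rewrite ndc.
  (* In the variable [y] the cosine is [1 - 2 y]; squaring puts the factor 4 on the variance. *)
  have -> : csn 0 x - (1 - 2 * (j%:R / N.+1%:R)) = (- 2) * (y - j%:R / N.+1%:R).
    by rewrite /y; field; rewrite ?pnatr_eq0.
  move=> H; have b0 : 0 <= bern N.+1 j y by exact: bern_ge0.
  apply: le_trans (ler_wpM2l b0 H) _; rewrite le_eqVlt; apply/orP; left; apply/eqP.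
  by ring.
rewrite big_split/= -!mulr_sumr sum_bern bern_variance mulr1.
have y4 : 4 * (y * (1 - y)) <= 1.
  by rewrite -subr_ge0 (_ : _ - _ = (1 - 2 * y) ^+ 2) ?sqr_ge0//; ring.
have : 4 * C * (y * (1 - y) / N.+1%:R) <= C / N.+1%:R.
  have -> : 4 * C * (y * (1 - y) / N.+1%:R) = (4 * (y * (1 - y))) * (C / N.+1%:R) by ring.
  by rewrite ler_piMl// divr_ge0.
move=> H; rewrite [leRHS](splitr e).
by rewrite lerD2l; exact: le_trans H HN.
Qed.

(** Two end layers of width [d] are split off: a crude bound [A] suffices there once [d] is small,
    and a fine bound [B] is needed only inside. It serves constructions that degenerate at the ends,
    such as cutoffs and division by the sine. *)
Lemma ip_three_pieces (f : R -> R) (A B d : R) : L2 f -> 0 <= A -> 0 <= B -> 0 < d -> 2 * d < l ->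
  (forall x, 0 < x < l -> `|f x| <= A) -> (forall x, d < x < l - d -> `|f x| <= B) ->
  ip f f <= 2 * A ^+ 2 * d + B ^+ 2 * l.
Proof.
move=> Lf A0 B0 d0 dl fA fB; have [mf if2] := Lf.
have mff : measurable_fun D (fun x => f x * f x) by exact: measurable_funM.
have sub (u v : R) : 0 <= u -> v <= l -> measurable_fun `]u, v[ (fun x => f x * f x).
  move=> u0 vl; apply: measurable_funS mff => // x /=; rewrite !in_itv/= => /andP[? ?].
  by apply/andP; split; lra.
have bd (u v C : R) : 0 <= u -> u <= v -> v <= l -> 0 <= C ->
    (forall x, u < x < v -> `|f x| <= C) ->
    \int[leb R]_(x in `]u, v[) (f x * f x) <= C ^+ 2 * (v - u).
  move=> u0 uv vl C0 fC; apply: le_trans (ler_norm _) _.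
  apply: Rint_oo_bound => //; first exact: sub.
  by move=> x xuv; rewrite normrM -expr2 lerXn2r ?nnegrE// fC.
rewrite /ip (@Rint_split _ 0 d l)//; [|lra|lra].
rewrite (@Rint_split _ d (l - d) l)//; [|lra|lra|]; last first.
  by apply: integrableS if2 => // x /=; rewrite !in_itv/= => /andP[? ?]; apply/andP; split; lra.
have H1 := bd 0 d A (lexx _) (ltW d0) ltac:(lra) A0 ltac:(by move=> x /andP[? ?]; apply: fA; apply/andP; split; lra).
have H2 := bd d (l - d) B ltac:(lra) ltac:(lra) ltac:(lra) B0 fB.
have H3 := bd (l - d) l A ltac:(lra) ltac:(lra) ltac:(lra) A0 ltac:(by move=> x /andP[? ?]; apply: fA; apply/andP; split; lra).
have B20 : 0 <= B ^+ 2 by exact: sqr_ge0.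
by nra.
Qed.

Lemma sn0_gt0 (x : R) : 0 < x < l -> 0 < sn 0 x.
Proof.
move=> /andP[x0 xl]; apply: sin_gt0_pi; rewrite mulr_gt0 ?freq_gt0//=.
have -> : freq 0 * x = pi * (x / l) by rewrite /freq; field; rewrite gt_eqF.
by rewrite -[ltRHS]mulr1 ltr_pM2l ?pi_gt0// ltr_pdivrMr// mul1r.
Qed.

Lemma sn0_ge0 (x : R) : 0 <= x <= l -> 0 <= sn 0 x.
Proof.
move=> /andP[]; rewrite le_eqVlt => /predU1P[<-|x0]; first by rewrite sn0.
rewrite le_eqVlt => /predU1P[->|xl]; first by rewrite snl.
by apply/ltW/sn0_gt0; rewrite x0.
Qed.

Definition sine_dense (g : R -> R) : Prop := forall e : R, 0 < e ->
  exists2 f, sine_poly f & ip (fun x => g x - f x) (fun x => g x - f x) < e.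

(* [g] is approximated by sin * g / (sin + eta), with sin = sin (pi x / l). *)
Lemma sine_dense_continuous (g : R -> R) : {within `[0, l], continuous g} -> sine_dense g.
Proof.
move=> cg e e0.
have [M M0 HM] := within_continuous_bounded cg.
have Lg := within_L2 cg.
(* In the end layers the error is only known to be at most [M]; this width keeps their share
   [2 * M ^+ 2 * d] within [e / 8]. *)
pose d := Num.min (l / 4) (e / (16 * (M ^+ 2 + 1))).
have M21 : 0 < M ^+ 2 + 1 by rewrite ltr_wpDl// sqr_ge0.
have d0 : 0 < d by rewrite lt_min !divr_gt0// mulr_gt0.
have dl : 2 * d < l.
  have : d <= l / 4 by rewrite ge_min lexx.
  by lra.
have de : 2 * M ^+ 2 * d <= e / 8.
  have : d <= e / (16 * (M ^+ 2 + 1)) by rewrite ge_min lexx orbT.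
  rewrite ler_pdivlMr ?mulr_gt0// => H.
  have : 2 * M ^+ 2 * d <= 2 * (M ^+ 2 + 1) * d by rewrite ler_pM2r// ler_pM2l// lerDl.
  by lra.
have cinv : {within `[d, l - d], continuous (fun x => (sn 0 x)^-1)}.
  apply/subspace_continuousP => x; rewrite /= in_itv/= => /andP[x1 x2].
  apply: cvg_within_filter; apply: cvgV; last exact: continuous_sn.
  by rewrite gt_eqF// sn0_gt0//; apply/andP; split; lra.
have [Q Q0 HQ] := within_continuous_bounded cinv.
pose s := Num.sqrt (e / (8 * l)).
have s0 : 0 < s by rewrite sqrtr_gt0 divr_gt0// mulr_gt0.
have s2 : s ^+ 2 * l = e / 8 by rewrite sqr_sqrtr ?ltW ?divr_gt0 ?mulr_gt0//; field; rewrite gt_eqF.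
have MQ : 0 < M * Q + 1 by rewrite ltr_wpDl// mulr_ge0.
(* On the core [1 / sin <= Q], so the relative error [eta / (sin + eta)] is at most [eta * Q], and
   [M * eta * Q <= s] with [s ^+ 2 * l = e / 8]. *)
pose eta := s / (M * Q + 1).
have eta0 : 0 < eta by rewrite divr_gt0.
have den (x : R) : 0 <= x <= l -> 0 < sn 0 x + eta by move=> /sn0_ge0 ?; rewrite ltr_wpDl.
pose k x := g x / (sn 0 x + eta).
have ck : {within `[0, l], continuous k}.
  apply/subspace_continuousP => x xl; apply: cvgM.
    by move/subspace_continuousP : cg; exact.
  have xl' : 0 <= x <= l by move: xl; rewrite /= in_itv.
  apply: cvg_within_filter; apply: cvgV; first by rewrite gt_eqF// den.
  by apply: cvgD; [exact: continuous_sn|exact: cvg_cst].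
have [f sf Hf] := sine_poly_dense_uniform s0 ck.
exists f => //.
have csk : {within `[0, l], continuous (fun x => sn 0 x * k x)}.
  apply/subspace_continuousP => x xl; apply: cvgM.
    by apply: cvg_within_filter; exact: continuous_sn.
  by move/subspace_continuousP : ck; exact.
have Lsk := within_L2 csk.
have Lf : L2 f by case: sf => c [N ->]; exact: L2_psum.
have E1 : ip (fun x => g x - sn 0 x * k x) (fun x => g x - sn 0 x * k x) <= e / 4.
  have -> : e / 4 = e / 8 + e / 8 by field.
  apply: le_trans (@ip_three_pieces _ M s d _ M0 (ltW s0) d0 dl _ _) _.
  - exact: (L2B _ Lg Lsk).
  - move=> x xl; have xl' : 0 <= x <= l by move/andP: xl => [? ?]; rewrite !ltW.
    have dx := den x xl'.
    have -> : g x - sn 0 x * k x = g x * (eta / (sn 0 x + eta)).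
      by rewrite /k; field; rewrite gt_eqF.
    rewrite normrM -[leRHS]mulr1; apply: ler_pM => //; first exact: HM.
    have q0 : 0 <= eta / (sn 0 x + eta) by rewrite divr_ge0// ltW.
    by rewrite (ger0_norm q0) ler_pdivrMr// mul1r lerDr sn0_ge0.
  - move=> x xd; have xl : 0 < x < l by move/andP: xd => [? ?]; apply/andP; split; lra.
    have xl' : 0 <= x <= l by move/andP: xl => [? ?]; rewrite !ltW.
    have dx := den x xl'; have sx := sn0_gt0 xl.
    have -> : g x - sn 0 x * k x = g x * (eta / (sn 0 x + eta)).
      by rewrite /k; field; rewrite gt_eqF.
    rewrite normrM; apply: (@le_trans _ _ (M * (eta * Q))).
      apply: ler_pM => //; first exact: HM.
      have q0 : 0 <= eta / (sn 0 x + eta) by rewrite divr_ge0// ltW.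
      rewrite (ger0_norm q0) ler_pM2l//.
      apply: (@le_trans _ _ (sn 0 x)^-1); first by rewrite lef_pV2 ?posrE// lerDl ltW.
      apply: le_trans (HQ x _); first exact: ler_norm.
      by move/andP: xd => [? ?]; rewrite !ltW.
    have -> : M * (eta * Q) = s * (M * Q / (M * Q + 1)) by rewrite /eta; field; rewrite gt_eqF.
    by rewrite -[leRHS]mulr1 ler_pM2l// ler_pdivrMr// mul1r lerDl.
  by rewrite s2 lerD2r.
have E2 : ip (fun x => sn 0 x * k x - f x) (fun x => sn 0 x * k x - f x) <= e / 8.
  have H := @ip_three_pieces (fun x => sn 0 x * k x - f x) s s.
  have Ls : L2 (fun x => sn 0 x * k x - f x) by exact: (L2B _ Lsk Lf).
  rewrite -s2 /ip; apply: le_trans (ler_norm _) _; rewrite -[X in s ^+ 2 * X](subr0 l).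
  apply: Rint_oo_bound; first exact: ltW.
    by case: Ls => + _ => ms; exact: measurable_funM.
  move=> x xl; rewrite normrM -expr2 lerXn2r ?nnegrE// ?(ltW s0)// Hf//.
  by move/andP: xl => [? ?]; rewrite !ltW.
have Ld1 : L2 (fun x => g x - sn 0 x * k x) by exact: (L2B _ Lg Lsk).
have Ld2 : L2 (fun x => sn 0 x * k x - f x) by exact: (L2B _ Lsk Lf).
have := ip_sqD_le _ Ld1 Ld2 => /(_ (measurable_itv _)).
have -> : ip (fun x => g x - sn 0 x * k x + (sn 0 x * k x - f x))
    (fun x => g x - sn 0 x * k x + (sn 0 x * k x - f x)) =
  ip (fun x => g x - f x) (fun x => g x - f x).
  by apply: eq_ip => x _; ring.
by lra.
Qed.

Lemma sine_dense_limit (g : R -> R) : L2 g -> (forall e : R, 0 < e ->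
  exists2 h, L2 h /\ sine_dense h & ip (fun x => g x - h x) (fun x => g x - h x) < e) ->
  sine_dense g.
Proof.
move=> Lg H e e0; have e4 : 0 < e / 4 by rewrite divr_gt0.
have [h [Lh dh] gh] := H _ e4.
have [f sf hf] := dh _ e4; exists f => //.
have Lf : L2 f by case: sf => c [N ->]; exact: L2_psum.
have Ld1 : L2 (fun x => g x - h x) by exact: (L2B _ Lg Lh).
have Ld2 : L2 (fun x => h x - f x) by exact: (L2B _ Lh Lf).
have := ip_sqD_le _ Ld1 Ld2 => /(_ (measurable_itv _)).
have -> : ip (fun x => g x - h x + (h x - f x)) (fun x => g x - h x + (h x - f x)) =
  ip (fun x => g x - f x) (fun x => g x - f x).
  by apply: eq_ip => x _; ring.
by lra.
Qed.

(** Fourier partial sums are best approximations: once some sine polynomial with [N0] terms is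
    within [e], so is every partial sum with at least [N0] terms. *)
Lemma parseval (g : R -> R) : L2 g -> sine_dense g -> forall e : R, 0 < e ->
  exists N0, forall N, (N0 <= N)%N ->
    ip (fun x => g x - psum (coef g) N x) (fun x => g x - psum (coef g) N x) < e.
Proof.
move=> Lg dg e /dg[f [c [N0 ->]] H]; exists N0 => N N0N; apply: le_lt_trans H.
pose c' n := if (n < N0)%N then c n else 0.
have -> : ip (fun x => g x - psum c N0 x) (fun x => g x - psum c N0 x) =
    ip (fun x => g x - psum c' N x) (fun x => g x - psum c' N x).
  by apply: eq_ip => x _; rewrite (psum_widen c x N0N).
rewrite !best_approx// lerD2l big1 ?mulr0; last by move=> n _; rewrite subrr expr0n.
by rewrite mulr_ge0 ?divr_ge0 ?(ltW hl)//; apply: sumr_ge0 => n _; exact: sqr_ge0.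
Qed.

Lemma sine_complete (g : R -> R) : L2 g -> sine_dense g -> (forall n, coef g n = 0) ->
  \forall x \ae leb R, D x -> g x = 0.
Proof.
move=> Lg dg g0; apply: ip_sq_eq0 => //; apply: le_anti; rewrite ip_ge0 andbT.
apply/ler_addgt0Pl => e e0; rewrite addr0.
have [N0 /(_ N0 (leqnn _)) H] := parseval Lg dg e0; apply/ltW; apply: le_lt_trans H.
rewrite le_eqVlt; apply/orP; left; apply/eqP; apply: eq_ip => x _;
by rewrite /psum big1 ?subr0// => n _; rewrite g0 mul0r.
Qed.

End SineSystem.

(** * Lipschitz primitives and weak derivatives in time *)

Section LipschitzPrimitives.
Variable R : realType.
Local Notation mu := (leb R).
Implicit Types (a b s t T : R) (c h F : R -> R).

Lemma Rint_oo_eq a b (f g : R -> R) : (forall x, a < x < b -> f x = g x) ->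
  \int[mu]_(x in `]a, b[) f x = \int[mu]_(x in `]a, b[) g x.
Proof. by move=> fg; apply: eq_Rintegral => x /set_mem/=; rewrite in_itv/=; exact: fg. Qed.

Lemma Rint_oo_zero a b (f : R -> R) : (forall x, a < x < b -> f x = 0) ->
  \int[mu]_(x in `]a, b[) f x = 0.
Proof. by move=> f0; rewrite (Rint_oo_eq f0) Rintegral_cst ?mul0r. Qed.

Lemma measurable_oo_sub a b s t (f : R -> R) : a <= s -> t <= b ->
  measurable_fun `]a, b[ f -> measurable_fun `]s, t[ f.
Proof.
move=> as_ tb; apply: measurable_funS => // x /=; rewrite !in_itv/= => /andP[? ?].
by apply/andP; split; lra.
Qed.

Lemma derive_locally_cst (f : R -> R) (x k : R) : (\forall y \near x, f y = k) -> 'D_1 f x = 0.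
Proof.
move=> H; rewrite (@near_eq_derive _ _ _ f (cst k)) ?derive_cst//.
Qed.

(* [c] is in W^{1,oo}(0, T) with weak derivative [h]. *)
Definition LI T c h : Prop :=
  [/\ measurable_fun `]0, T[ h, exists M : R, forall t, 0 < t < T -> `|h t| <= M
    & forall s t, 0 <= s -> s <= t -> t <= T -> c t - c s = \int[mu]_(x in `]s, t[) h x].

Lemma LI_bound T c h : LI T c h -> exists2 M : R, 0 <= M &
  (forall t, 0 < t < T -> `|h t| <= M) /\
  (forall s t, 0 <= s -> s <= t -> t <= T -> `|c t - c s| <= M * (t - s)).
Proof.
move=> [mh [M HM] ch]; exists `|M| => //.
have HM' t : 0 < t < T -> `|h t| <= `|M| by move=> /HM /le_trans; apply; exact: ler_norm.
split=> // s t s0 st tT; rewrite ch//; apply: Rint_oo_bound => //.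
  exact: measurable_oo_sub mh.
by move=> x /andP[? ?]; apply: HM'; apply/andP; split; lra.
Qed.

Lemma LI_continuous T c h : LI T c h -> {within `[0, T], continuous c}.
Proof.
move=> /LI_bound[M M0 [_ lip]]; apply/subspace_continuousP => x; rewrite /= in_itv/= => /andP[x0 xT].
apply/cvgrPdist_lt => e e0; rewrite !near_withinE.
have M1 : 0 < M + 1 by rewrite ltr_wpDl.
have : \forall y \near x, `|x - y| < e / (M + 1) by apply: nbhsx_ballx; rewrite divr_gt0.
apply: filterS => y; rewrite ltr_pdivlMr// => xy; rewrite /= in_itv/= => /andP[y0 yT].
apply: le_lt_trans xy; rewrite /from_subspace.
apply: (@le_trans _ _ (M * `|x - y|)); last by rewrite mulrC ler_wpM2l// lerDl.
have [yx|/ltW xy] := leP y x.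
  by rewrite (ger0_norm (_ : 0 <= x - y)) ?subr_ge0// lip.
by rewrite distrC (distrC x) (ger0_norm (_ : 0 <= y - x)) ?subr_ge0// lip.
Qed.

Lemma LI_measurable T c h : LI T c h -> measurable_fun `]0, T[ c.
Proof. by move=> /LI_continuous; exact: within_measurable_oo. Qed.

Lemma LI_bounded T c h : LI T c h -> exists2 M : R, 0 <= M & forall t, 0 <= t <= T -> `|c t| <= M.
Proof. by move=> /LI_continuous; exact: within_continuous_bounded. Qed.

Lemma LI_primitive T (k : R) h (M : R) : measurable_fun `]0, T[ h ->
  (forall t, 0 < t < T -> `|h t| <= M) -> LI T (fun t => k + \int[mu]_(x in `]0, t[) h x) h.
Proof.
move=> mh hM; split=> //; first by exists M.
move=> s t s0 st tT; rewrite (@Rint_split _ 0 s t)//; first by ring.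
apply: (@bounded_integrable_oo _ _ _ _ M); first exact: measurable_oo_sub mh.
by move=> x /andP[? ?]; apply: hM; apply/andP; split; lra.
Qed.

(* Cutting [s, t] into n equal pieces improves the bound to C (t - s)^2 / n. *)
Lemma quadratic_modulus_cst T (D : R -> R) (C : R) :
  (forall s t, 0 <= s -> s <= t -> t <= T -> `|D t - D s| <= C * (t - s) ^+ 2) ->
  forall s t, 0 <= s -> s <= t -> t <= T -> D t = D s.
Proof.
move=> HD s t s0 st tT; apply/eqP; rewrite -subr_eq0 -normr_le0.
apply/ler_addgt0Pl => e e0; rewrite addr0.
pose K := `|C| * (t - s) ^+ 2.
have [N HN] : exists N, K / N.+1%:R <= e.
  exists (Num.truncn (K / e)); rewrite ler_pdivrMr// mulrC -ler_pdivrMr//.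
  by apply: ltW; exact: truncnS_gt.
apply: le_trans HN.
pose u (i : nat) := s + i%:R * ((t - s) / N.+1%:R).
have n0 : N.+1%:R != 0 :> R by rewrite pnatr_eq0.
have d0 : 0 <= (t - s) / N.+1%:R by rewrite divr_ge0// subr_ge0.
have uN : u N.+1 = t by rewrite /u; field.
have u0 : u 0 = s by rewrite /u mul0r addr0.
have uS i : u i.+1 - u i = (t - s) / N.+1%:R by rewrite /u -(addn1 i) natrD; ring.
have umono i : u i <= u i.+1 by rewrite -subr_ge0 uS.
have us i : s <= u i by rewrite /u lerDl mulr_ge0.
have ut i : (i <= N.+1)%N -> u i <= t.
  move=> iN; rewrite -uN /u lerD2l ler_wpM2r// ler_nat//.
have -> : D t - D s = \sum_(0 <= i < N.+1) (D (u i.+1) - D (u i)).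
  by rewrite telescope_sumr// uN u0.
apply: le_trans (ler_norm_sum _ _ _) _.
apply: (@le_trans _ _ (\sum_(0 <= i < N.+1) `|C| * ((t - s) / N.+1%:R) ^+ 2)).
  rewrite !big_mkord; apply: ler_sum => i _; rewrite -(uS i).
  apply: le_trans (HD _ _ _ _ _) _ => //; first exact: le_trans (us i).
    exact: le_trans (ut _ (ltn_ord i)) tT.
  by rewrite ler_wpM2r ?sqr_ge0// ler_norm.
rewrite big_mkord sumr_const card_ord -[X in X <= _]mulr_natl le_eqVlt.
by apply/orP; left; apply/eqP; rewrite /K; field.
Qed.

(** The difference between [c] and the primitive of [h] has a quadratic modulus of continuity, hence
    is constant. The product and chain rules reduce to this estimate. *)
Lemma LI_criterion T c h (C : R) : measurable_fun `]0, T[ h ->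
  (exists M : R, forall t, 0 < t < T -> `|h t| <= M) ->
  (forall s t, 0 <= s -> s <= t -> t <= T ->
     `|c t - c s - \int[mu]_(x in `]s, t[) h x| <= C * (t - s) ^+ 2) -> LI T c h.
Proof.
move=> mh [M HM] H; split=> //; first by exists M.
have [_ _ Hp] := LI_primitive 0 mh HM.
pose D t := c t - (0 + \int[mu]_(x in `]0, t[) h x).
have HD : forall s t, 0 <= s -> s <= t -> t <= T -> `|D t - D s| <= C * (t - s) ^+ 2.
  move=> s t s0 st tT; have -> : D t - D s = c t - c s - \int[mu]_(x in `]s, t[) h x.
    by rewrite -Hp// /D; ring.
  exact: H.
move=> s t s0 st tT; have := quadratic_modulus_cst HD s0 st tT.
by rewrite -Hp// /D; lra.
Qed.

Lemma LI_eq T c h c' h' : (forall t, 0 <= t <= T -> c t = c' t) ->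
  (forall t, 0 < t < T -> h t = h' t) -> LI T c h -> LI T c' h'.
Proof.
move=> cc hh [mh [M HM] H]; split.
- by apply: eq_measurable_fun mh => x /set_mem/=; rewrite in_itv/=; exact: hh.
- by exists M => t tT; rewrite -hh// HM.
- move=> s t s0 st tT; rewrite -!cc ?H//; last 2 first.
  + by rewrite s0 (le_trans st).
  + by rewrite (le_trans s0).
  by apply: Rint_oo_eq => x /andP[? ?]; apply: hh; apply/andP; split; lra.
Qed.

Lemma LI_integrable T c h s t : LI T c h -> 0 <= s -> t <= T -> mu.-integrable `]s, t[ (EFin \o h).
Proof.
move=> [mh [M HM] _] s0 tT; apply: (@bounded_integrable_oo _ _ _ _ M).
  exact: measurable_oo_sub mh.
by move=> x /andP[? ?]; apply: HM; apply/andP; split; lra.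
Qed.

Lemma LI_add T c h c' h' : LI T c h -> LI T c' h' -> LI T (fun t => c t + c' t) (fun t => h t + h' t).
Proof.
move=> L L'; have [[mh [M HM] H] [mh' [M' HM'] H']] := (L, L'); split.
- exact: measurable_funD.
- by exists (M + M') => t tT; apply: le_trans (ler_normD _ _) _; rewrite lerD ?HM ?HM'.
- move=> s t s0 st tT; rewrite RintegralD//; last 2 first.
  + exact: (LI_integrable L).
  + exact: (LI_integrable L').
  by rewrite -H// -H'//; ring.
Qed.

Lemma LI_scale T (k : R) c h : LI T c h -> LI T (fun t => k * c t) (fun t => k * h t).
Proof.
move=> L; have [mh [M HM] H] := L; split.
- by apply: measurable_funM => //; exact: measurable_cst.
- by exists (`|k| * M) => t tT; rewrite normrM ler_wpM2l ?HM.
- move=> s t s0 st tT; rewrite RintegralZl//; last exact: (LI_integrable L).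
  by rewrite -H//; ring.
Qed.

(** The defect on [s, t] is the product of the two increments minus the integral of each derivative
    times the increment of the other factor. With Lipschitz constants [M] and [M'] these are at most
    [M M' (t - s)^2] and [2 M M' (t - s)^2]. *)
Lemma LI_mul T c h c' h' : LI T c h -> LI T c' h' ->
  LI T (fun t => c t * c' t) (fun t => h t * c' t + c t * h' t).
Proof.
move=> L L'.
have [[mh _ H] [mh' _ H']] := (L, L').
have [M M0 [HM lip]] := LI_bound L; have [M' M0' [HM' lip']] := LI_bound L'.
have [B B0 HB] := LI_bounded L; have [B' B0' HB'] := LI_bounded L'.
have mc := LI_measurable L; have mc' := LI_measurable L'.
have mk : measurable_fun `]0, T[ (fun t => h t * c' t + c t * h' t).
  by apply: measurable_funD; exact: measurable_funM.
have bk t : 0 < t < T -> `|h t * c' t + c t * h' t| <= M * B' + B * M'.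
  move=> tT; have tT' : 0 <= t <= T by move/andP: tT => [? ?]; rewrite !ltW.
  apply: le_trans (ler_normD _ _) _; rewrite !normrM.
  by apply: lerD; apply: ler_pM => //; rewrite ?HM ?HM' ?HB ?HB'.
apply: (@LI_criterion _ _ _ (3 * M * M')) => //; first by eexists; exact: bk.
move=> s t s0 st tT.
have sub x : s < x < t -> 0 < x < T by move=> /andP[? ?]; apply/andP; split; lra.
have subc x : s < x < t -> 0 <= x <= T by move=> /andP[? ?]; apply/andP; split; lra.
have ts0 : 0 <= t - s by rewrite subr_ge0.
have E : c t * c' t - c s * c' s - \int[mu]_(x in `]s, t[) (h x * c' x + c x * h' x) =
   (c t - c s) * (c' t - c' s) -
   \int[mu]_(x in `]s, t[) (h x * (c' x - c' s) + (c x - c s) * h' x).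
  have i1 : mu.-integrable `]s, t[ (EFin \o (fun x => h x * c' x + c x * h' x)).
    apply: (@bounded_integrable_oo _ _ _ _ (M * B' + B * M')); first exact: measurable_oo_sub mk.
    by move=> x /sub; exact: bk.
  have i2 := LI_integrable L s0 tT; have i3 := LI_integrable L' s0 tT.
  have -> : \int[mu]_(x in `]s, t[) (h x * (c' x - c' s) + (c x - c s) * h' x) =
    \int[mu]_(x in `]s, t[) ((h x * c' x + c x * h' x) - (c' s * h x + c s * h' x)).
    by apply: Rint_oo_eq => x _; ring.
  rewrite RintegralB//; last first.
    by apply: integrable_add => //; exact: integrable_scale.
  rewrite (@RintegralD _ _ _ mu _ (fun x => c' s * h x) (fun x => c s * h' x))//;
    [|exact: integrable_scale..].
  by rewrite !RintegralZl// -H// -H'//; ring.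
rewrite E; apply: le_trans (ler_normB _ _) _.
have e1 : `|(c t - c s) * (c' t - c' s)| <= M * M' * (t - s) ^+ 2.
  rewrite normrM; apply: le_trans (_ : (M * (t - s)) * (M' * (t - s)) <= _).
    by apply: ler_pM => //; [exact: lip|exact: lip'].
  by rewrite le_eqVlt; apply/orP; left; apply/eqP; ring.
have e2 : `|\int[mu]_(x in `]s, t[) (h x * (c' x - c' s) + (c x - c s) * h' x)| <=
    (2 * M * M' * (t - s)) * (t - s).
  apply: Rint_oo_bound => //.
    apply: (@measurable_oo_sub 0 T) => //; apply: measurable_funD; apply: measurable_funM => //.
      by apply: measurable_funB => //; exact: measurable_cst.
    by apply: measurable_funB => //; exact: measurable_cst.
  move=> x xst; have xT := sub x xst; move/andP: (xst) => [sx xt].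
  have xs0 : 0 <= x - s by rewrite subr_ge0 ltW.
  apply: le_trans (ler_normD _ _) _; rewrite !normrM.
  have l1 : `|c x - c s| <= M * (t - s).
    by apply: le_trans (lip _ _ s0 _ _) _; rewrite ?ler_wpM2l//; lra.
  have l2 : `|c' x - c' s| <= M' * (t - s).
    by apply: le_trans (lip' _ _ s0 _ _) _; rewrite ?ler_wpM2l//; lra.
  apply: (@le_trans _ _ (M * (M' * (t - s)) + (M * (t - s)) * M')).
    by apply: lerD; apply: ler_pM => //; rewrite ?HM ?HM'.
  by rewrite le_eqVlt; apply/orP; left; apply/eqP; ring.
apply: le_trans (lerD e1 e2) _.
by rewrite le_eqVlt; apply/orP; left; apply/eqP; ring.
Qed.

Lemma LI_derive T F f : (forall x : R, is_derive x 1 F (f x)) -> continuous f -> LI T F f.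
Proof.
move=> dF cf; split.
- exact: continuous_measurable_oo.
- have [M _ HM] := @within_continuous_bounded R 0 T _ (continuous_subspaceT cf).
  by exists M => t /andP[? ?]; apply: HM; rewrite !ltW.
- by move=> s t _ st _; rewrite (ftc st dF cf).
Qed.

Lemma taylor2 F f (a b L : R) : (forall x : R, is_derive x 1 F (f x)) -> continuous f ->
  (forall x, `|x - a| <= `|b - a| -> `|f x - f a| <= L * `|b - a|) ->
  `|F b - F a - f a * (b - a)| <= L * (b - a) ^+ 2.
Proof.
move=> dF cf HL; rewrite -real_normK ?num_real// expr2 mulrA.
have i (u v : R) : mu.-integrable `]u, v[ (EFin \o f) by exact: continuous_integrable_oo.
have ic (u v : R) : mu.-integrable `]u, v[ (EFin \o (fun=> f a)).
  by apply: continuous_integrable_oo; move=> ?; exact: cvg_cst.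
have m (u v : R) : measurable_fun `]u, v[ (fun x => f x - f a).
  by apply: measurable_funB; [exact: continuous_measurable_oo|exact: measurable_cst].
have [ab|/ltW ba] := leP a b.
  rewrite -(ftc ab dF cf) -(Rint_oo_cst (f a) ab) -RintegralB//.
  rewrite [X in _ <= _ * X]ger0_norm ?subr_ge0//.
  apply: Rint_oo_bound => // x /andP[ax xb]; apply: HL.
  by rewrite !ger0_norm ?subr_ge0 ?lerD2r ?ltW// (lt_trans ax).
have -> : F b - F a - f a * (b - a) = - (F a - F b - f a * (a - b)) by ring.
rewrite normrN -(ftc ba dF cf) -(Rint_oo_cst (f a) ba) -RintegralB//.
rewrite [X in _ <= _ * X]ler0_norm ?subr_le0// opprB.
apply: Rint_oo_bound => // x /andP[bx xa]; apply: HL.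
by rewrite !ler0_norm ?subr_le0 ?lerN2 ?lerD2r ?ltW// (lt_trans bx).
Qed.

Lemma derive_lipschitz F f (B : R) : (forall x : R, is_derive x 1 F (f x)) -> continuous f ->
  exists2 L : R, 0 <= L & forall x y, `|x| <= B -> `|y| <= B -> `|F x - F y| <= L * `|x - y|.
Proof.
move=> dF cf.
have [L L0 HL] := @within_continuous_bounded R (- B) B _ (continuous_subspaceT cf).
exists L => // x y.
wlog yx : x y / y <= x => [H xB yB|xB yB].
  have [/H|/ltW/H] := leP y x; first exact.
  by move=> /(_ yB xB); rewrite distrC (distrC x).
rewrite (ger0_norm (_ : 0 <= x - y)) ?subr_ge0// -(ftc yx dF cf).
apply: Rint_oo_bound => //; first exact: continuous_measurable_oo.
move=> z /andP[yz zx]; apply: HL.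
move: xB yB; rewrite !ler_norml => /andP[? ?] /andP[? ?]; apply/andP; split; lra.
Qed.

(** The defect is the Taylor remainder of [F] at [c s] minus the integral of
    [(f (c x) - f (c s)) h x]; both are quadratic because [c] is Lipschitz and [f] is Lipschitz on
    bounded sets. *)
Lemma LI_comp T F f f' c h : (forall x : R, is_derive x 1 F (f x)) ->
  (forall x : R, is_derive x 1 f (f' x)) -> continuous f' ->
  LI T c h -> LI T (fun t => F (c t)) (fun t => f (c t) * h t).
Proof.
move=> dF df cf' L; have cf := is_derive_continuous df.
have [mh _ H] := L; have [M M0 [HM lip]] := LI_bound L; have [B B0 HB] := LI_bounded L.
(* Points no farther from [c s] than [c t] have absolute value at most [3 * B]. *)
have [K K0 HK] := derive_lipschitz (3 * B) df cf'.
have cc := LI_continuous L.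
have cfc : {within `[0, T], continuous (fun t => f (c t))}.
  apply/subspace_continuousP => x xT; apply: (@cvg_comp _ _ _ c f _ (nbhs (c x))); last exact: cf.
  by move/subspace_continuousP : cc; exact.
have [Q Q0 HQ] := within_continuous_bounded cfc.
have mfc := within_measurable_oo cfc.
have mk : measurable_fun `]0, T[ (fun t => f (c t) * h t) by exact: measurable_funM.
have bk t : 0 < t < T -> `|f (c t) * h t| <= Q * M.
  move=> tT; have tT' : 0 <= t <= T by move/andP: tT => [? ?]; rewrite !ltW.
  by rewrite normrM ler_pM// ?HQ ?HM.
apply: (@LI_criterion _ _ _ (K * M ^+ 2 + K * M ^+ 2)) => //; first by eexists; exact: bk.
move=> s t s0 st tT.
have sub x : s < x < t -> 0 < x < T by move=> /andP[? ?]; apply/andP; split; lra.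
have ts0 : 0 <= t - s by rewrite subr_ge0.
have sT : 0 <= s <= T by rewrite s0 (le_trans st).
have tT' : 0 <= t <= T by rewrite (le_trans s0 st).
have i1 : mu.-integrable `]s, t[ (EFin \o (fun x => f (c x) * h x)).
  apply: (@bounded_integrable_oo _ _ _ _ (Q * M)); first exact: measurable_oo_sub mk.
  by move=> x /sub; exact: bk.
have i2 := LI_integrable L s0 tT.
have -> : F (c t) - F (c s) - \int[mu]_(x in `]s, t[) (f (c x) * h x) =
    (F (c t) - F (c s) - f (c s) * (c t - c s)) -
    \int[mu]_(x in `]s, t[) ((f (c x) - f (c s)) * h x).
  have -> : \int[mu]_(x in `]s, t[) ((f (c x) - f (c s)) * h x) =
    \int[mu]_(x in `]s, t[) (f (c x) * h x - f (c s) * h x).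
    by apply: Rint_oo_eq => x _; ring.
  by rewrite RintegralB//; [rewrite RintegralZl// -H//; ring|exact: integrable_scale].
apply: le_trans (ler_normB _ _) _; rewrite mulrDl; apply: lerD.
  apply: le_trans (taylor2 (L := K) dF cf _) _.
    move=> x xc; apply: le_trans (HK _ _ _ _) _.
    - have := HB _ sT; have := HB _ tT'; have := ler_normB (c t) (c s).
      have : `|x| <= `|x - c s| + `|c s| by rewrite -[X in `|X| <= _](subrK (c s)) ler_normD.
      by lra.
    - by have := HB _ sT; lra.
    - by rewrite ler_wpM2l.
  rewrite -mulrA ler_wpM2l// -real_normK ?num_real// -exprMn lerXn2r ?nnegrE//.
    by rewrite mulr_ge0.
  exact: lip.
have -> : K * M ^+ 2 * (t - s) ^+ 2 = K * M ^+ 2 * (t - s) * (t - s) by ring.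
apply: Rint_oo_bound => //.
  apply: (@measurable_oo_sub 0 T) => //; apply: measurable_funM => //.
  by apply: measurable_funB => //; exact: measurable_cst.
move=> x xst; have xT := sub x xst; move/andP: (xst) => [sx xt].
have xT' : 0 <= x <= T by move/andP: xT => [? ?]; rewrite !ltW.
rewrite normrM; apply: (@le_trans _ _ (K * (M * (t - s)) * M)); last first.
  by rewrite le_eqVlt; apply/orP; left; apply/eqP; ring.
apply: ler_pM => //; last exact: HM.
apply: le_trans (HK _ _ _ _) _; [by have := HB _ xT'; lra|by have := HB _ sT; lra|].
rewrite ler_wpM2l//; apply: le_trans (lip _ _ s0 _ _) _; rewrite ?ler_wpM2l//; lra.
Qed.

Lemma test_fun_out (A : set R) (th : R -> R) x : test_fun A th -> ~ A x -> th x = 0.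
Proof. by move=> [_ [K [_ KA th0]]] nAx; apply: th0 => /KA. Qed.

(** Let [m] maximize [g t = exp (- k t) N t]. Bounding [N] by [g m exp (k s)] under the integral
    gives [k g(m) E <= M g(m) E] with [E = exp (k m)], so [g m <= 0] because [k = 2 M + 1 > M]. *)
Lemma gronwall T (N : R -> R) (M : R) : 0 <= T -> 0 <= M -> {within `[0, T], continuous N} ->
  (forall t, 0 <= t <= T -> 0 <= N t) ->
  (forall t, 0 <= t <= T -> N t <= M * \int[mu]_(s in `]0, t[) N s) ->
  forall t, 0 <= t <= T -> N t = 0.
Proof.
move=> T0 M0 cN N0 HN.
pose k := 2 * M + 1.
have k0 : 0 < k by rewrite ltr_wpDl// mulr_ge0.
(* The summand 0 keeps the shape produced by [is_derive_affine]. *)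
have dexp (a x : R) : is_derive x 1 (fun y => expR (a * y + 0)) (a * expR (a * x + 0)).
  have := is_derive1_comp (is_derive_expR _) (is_derive_affine a 0 x).
  by move=> H; apply: is_derive_eq H _; rewrite mulrC.
have cexp a : continuous (fun y : R => expR (a * y + 0)) by exact: is_derive_continuous (dexp a).
pose g t := expR (- k * t + 0) * N t.
have cg : {within `[0, T], continuous g}.
  apply/subspace_continuousP => x xT; apply: cvgM; first by apply: cvg_within_filter; exact: cexp.
  by move/subspace_continuousP : cN; exact.
have [m mT Hm] := EVT_max T0 cg.
have mT' : 0 <= m <= T by move: mT; rewrite in_itv.
have gm0 : 0 <= g m by rewrite /g mulr_ge0 ?expR_ge0// N0.
have Ng t : 0 <= t <= T -> N t = g t * expR (k * t + 0).
  by move=> _; rewrite /g mulrAC -expRD (_ : - k * t + 0 + (k * t + 0) = 0) ?expR0 ?mul1r//; ring.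
suff gm : g m <= 0.
  move=> t tT; apply/eqP; rewrite eq_le N0// andbT (Ng t tT).
  rewrite mulr_le0_ge0 ?expR_ge0// (le_trans _ gm)// Hm// in_itv//.
have [m0 mTT] := andP mT'.
have iN : mu.-integrable `]0, m[ (EFin \o N).
  apply: integrableS (within_continuous_integrable_oo cN) => //.
  by move=> x /=; rewrite !in_itv/= => /andP[? ?]; apply/andP; split; lra.
have le1 : \int[mu]_(s in `]0, m[) N s <= g m * ((expR (k * m + 0) - 1) / k).
  have dE (x : R) : is_derive x 1 (fun y => (g m / k) * expR (k * y + 0)) (g m * expR (k * x + 0)).
    by apply: is_derive_eq (is_derive_scale _ (dexp k x)) _; field; rewrite gt_eqF.
  have cE : continuous (fun x : R => g m * expR (k * x + 0)).
    by move=> x; apply: cvgM; [exact: cvg_cst|exact: cexp].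
  have -> : g m * ((expR (k * m + 0) - 1) / k) = \int[mu]_(s in `]0, m[) (g m * expR (k * s + 0)).
    by rewrite (ftc m0 dE cE) (_ : k * 0 + 0 = 0) ?expR0 ?mulr0 ?addr0//; field; rewrite gt_eqF.
  apply: le_Rintegral => //; first exact: continuous_integrable_oo.
  move=> x /=; rewrite in_itv/= => /andP[x0 xm].
  have xT : 0 <= x <= T by apply/andP; split; lra.
  by rewrite (Ng x xT) ler_wpM2r ?expR_ge0// Hm// in_itv.
have := HN m mT'; rewrite (Ng m mT') => H.
have {}H : g m * expR (k * m + 0) <= M * (g m * ((expR (k * m + 0) - 1) / k)).
  by apply: le_trans H _; rewrite ler_wpM2l.
have E0 : 0 < expR (k * m + 0) by exact: expR_gt0.
move: H; move: (expR _) E0 => E E0 H.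
have {}H : k * (g m * E) <= M * (g m * (E - 1)).
  have -> : M * (g m * (E - 1)) = k * (M * (g m * ((E - 1) / k))) by field; rewrite gt_eqF.
  by rewrite ler_pM2l.
have gE : 0 <= g m * E by rewrite mulr_ge0// ltW.
have : M * (g m * (E - 1)) <= M * (g m * E) by rewrite ler_wpM2l// ler_wpM2l// lerBlDr lerDl.
move=> H2; have {H2}H := le_trans H H2.
have : (M + 1) * (g m * E) <= 0 by move: H; rewrite /k; lra.
by rewrite pmulr_rle0 ?ltr_wpDl// pmulr_lle0.
Qed.

(** On one flank of a cutoff [c] is close to the constant [c x0]. As [|th'| <= S / r] on length
    [2 r], the error is at most [e / (16 S) (S / r) 2 r = e / 8], whatever the size of [r]. *)
Lemma cutoff_edge (c th : R -> R) (x0 u v r S e : R) : smooth th -> 0 < r -> 0 < S ->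
  measurable_fun `]u, v[ c -> (exists B : R, forall y, u < y < v -> `|c y| <= B) ->
  (forall y, `|'D_1 th y| <= S / r) -> u <= v -> v - u = 2 * r ->
  (forall y, u < y < v -> `|c x0 - c y| <= e / (16 * S)) ->
  `|\int[mu]_(x in `]u, v[) (c x * 'D_1 th x) - c x0 * (th v - th u)| <= e / 8.
Proof.
move=> sth r0 S0 mc [B HB] dth uv uv2 Hc.
have dths := smooth_is_derive sth.
have cdth : continuous ('D_1 th) by exact/smooth_continuous/smooth_derive.
have mdth : measurable_fun `]u, v[ ('D_1 th) by exact: continuous_measurable_oo.
have idth : mu.-integrable `]u, v[ (EFin \o 'D_1 th) by exact: continuous_integrable_oo.
have -> : c x0 * (th v - th u) = \int[mu]_(x in `]u, v[) (c x0 * 'D_1 th x).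
  by rewrite RintegralZl// (ftc uv dths cdth).
rewrite -RintegralB//; last 2 first.
- apply: (@bounded_integrable_oo _ _ _ _ (B * (S / r))); first exact: measurable_funM.
  by move=> x xuv; rewrite normrM ler_pM// ?dth// HB.
- exact: integrable_scale.
have -> : e / 8 = (e / (16 * S)) * (S / r) * (v - u) by rewrite uv2; field; rewrite !gt_eqF.
apply: Rint_oo_bound => //.
  by apply: measurable_funB; apply: measurable_funM.
by move=> x xuv; rewrite -mulrBl normrM ler_pM// ?dth// distrC; exact: Hc.
Qed.

Lemma derive_cst_zone (th : R -> R) (u v k : R) : (forall y, u < y < v -> th y = k) ->
  forall x, u < x < v -> 'D_1 th x = 0.
Proof.
move=> Hk x xuv; apply: (@derive_locally_cst _ _ k).
have xuv' : x \in `]u, v[ by rewrite in_itv.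
by apply: filterS (near_in_itvoo xuv') => y; rewrite /= in_itv/=; exact: Hk.
Qed.

Lemma Rint_split3 (f : R -> R) (a b c d : R) : a <= b -> b <= c -> c <= d ->
  mu.-integrable `]a, d[ (EFin \o f) ->
  \int[mu]_(x in `]a, d[) f x = \int[mu]_(x in `]a, b[) f x +
    \int[mu]_(x in `]b, c[) f x + \int[mu]_(x in `]c, d[) f x.
Proof.
move=> ab bc cd fi; rewrite (Rint_split ab (le_trans bc cd) fi) (Rint_split bc cd) ?addrA//.
apply: integrableS fi => // x /=; rewrite !in_itv/= => /andP[bx ->]; rewrite andbT.
exact: le_lt_trans bx.
Qed.

(* [th] is a smooth cutoff of ]s, t[ rising and falling over length 2 r: its
   derivative tests c(t) - c(s), while [th] itself tests the integral of [h]. *)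
Lemma cutoff_window (c h th : R -> R) (T s t r S e M B : R) :
  0 <= s -> t <= T -> 0 < r -> 4 * r <= t - s -> 0 < S ->
  {within `[0, T], continuous c} -> (forall y, 0 <= y <= T -> `|c y| <= B) ->
  measurable_fun `]0, T[ h -> (forall t, 0 < t < T -> `|h t| <= M) -> 0 <= M ->
  smooth th -> (forall x, 0 <= th x <= 1) -> (forall x, ~ (s < x < t) -> th x = 0) ->
  (forall x, s + 2 * r <= x <= t - 2 * r -> th x = 1) ->
  (forall y, `|'D_1 th y| <= S / r) ->
  (forall y, s < y < s + 2 * r -> `|c s - c y| <= e / (16 * S)) ->
  (forall y, t - 2 * r < y < t -> `|c t - c y| <= e / (16 * S)) ->
  8 * r * M <= e ->
  \int[mu]_(x in `]0, T[) (c x * 'D_1 th x) = (- \int[mu]_(x in `]0, T[) (h x * th x)) ->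
  `|c t - c s - \int[mu]_(x in `]s, t[) h x| <= e.
Proof.
move=> s0 tT r0 rst S0 cc HB mh hM M0 sth th01 th_out th1 dth Hs Ht rM.
have [l1 l2 l3 l4] : [/\ s <= s + 2 * r, s + 2 * r <= t - 2 * r, t - 2 * r <= t & s <= t].
  by split; lra.
have [l5 l6 l7] : [/\ 0 <= t - 2 * r, s + 2 * r <= T & 0 <= T] by split; lra.
have ths : th s = 0 by apply: th_out; rewrite ltxx.
have tht : th t = 0 by apply: th_out; rewrite ltxx andbF.
have th1s : th (s + 2 * r) = 1 by apply: th1; rewrite lexx.
have th1t : th (t - 2 * r) = 1 by apply: th1; rewrite lexx andbT.
have sub u v : 0 <= u -> v <= T -> forall x, u < x < v -> 0 < x < T.
  by move=> u0 vT x /andP[ux xv]; rewrite (le_lt_trans u0 ux) (lt_le_trans xv vT).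
have mc := within_measurable_oo cc.
have cth := smooth_continuous sth.
have mth : measurable_fun `]0, T[ th by exact: continuous_measurable_oo.
have mdth : measurable_fun `]0, T[ ('D_1 th).
  by apply: continuous_measurable_oo; apply: smooth_continuous; exact: smooth_derive.
have Bc u v : 0 <= u -> v <= T -> forall y, u < y < v -> `|c y| <= B.
  by move=> u0 vT y yuv; apply: HB; have /andP[? ?] := sub u v u0 vT y yuv; rewrite !ltW.
have ic u v : 0 <= u -> v <= T -> mu.-integrable `]u, v[ (EFin \o (fun x => c x * 'D_1 th x)).
  move=> u0 vT; apply: (@bounded_integrable_oo _ _ _ _ (B * (S / r))).
    by apply: (@measurable_oo_sub 0 T) => //; exact: measurable_funM.
  by move=> x xuv; rewrite normrM ler_pM// ?dth//; exact: Bc xuv.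
have ih u v : 0 <= u -> v <= T -> mu.-integrable `]u, v[ (EFin \o h).
  move=> u0 vT; apply: (@bounded_integrable_oo _ _ _ _ M).
    exact: measurable_oo_sub mh.
  by move=> x xuv; exact/hM/(sub u v u0 vT).
have iht u v : 0 <= u -> v <= T -> mu.-integrable `]u, v[ (EFin \o (fun x => h x * th x)).
  move=> u0 vT; apply: (@bounded_integrable_oo _ _ _ _ (M * 1)).
    by apply: (@measurable_oo_sub 0 T) => //; exact: measurable_funM.
  move=> x xuv; rewrite normrM ler_pM//; first exact/hM/(sub u v u0 vT).
  by have /andP[? ?] := th01 x; rewrite ger0_norm.
have z0 : \int[mu]_(x in `]0, s[) (c x * 'D_1 th x) = 0.
  apply: Rint_oo_zero => x xs; rewrite (@derive_cst_zone th 0 s 0) ?mulr0// => y /andP[_ ys].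
  by apply: th_out; rewrite ltNge (ltW ys).
have z1 : \int[mu]_(x in `](s + 2 * r), (t - 2 * r)[) (c x * 'D_1 th x) = 0.
  apply: Rint_oo_zero => x xs; rewrite (@derive_cst_zone th (s + 2 * r) (t - 2 * r) 1) ?mulr0//.
  by move=> y /andP[? ?]; apply: th1; rewrite !ltW.
have z2 : \int[mu]_(x in `]t, T[) (c x * 'D_1 th x) = 0.
  apply: Rint_oo_zero => x xs; rewrite (@derive_cst_zone th t T 0) ?mulr0// => y /andP[ys _].
  by apply: th_out; rewrite andbC ltNge (ltW ys).
have z3 : \int[mu]_(x in `]0, s[) (h x * th x) = 0.
  by apply: Rint_oo_zero => x /andP[_ xs]; rewrite th_out ?mulr0// ltNge (ltW xs).
have z4 : \int[mu]_(x in `]t, T[) (h x * th x) = 0.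
  by apply: Rint_oo_zero => x /andP[tx _]; rewrite th_out ?mulr0// andbC ltNge (ltW tx).
rewrite (Rint_split3 s0 l4 tT) ?z0 ?z2 ?add0r ?addr0//; last exact: ic.
rewrite (Rint_split3 l1 l2 l3) ?z1 ?addr0//; last exact: ic.
rewrite (Rint_split3 s0 l4 tT) ?z3 ?z4 ?add0r ?addr0//; last exact: iht.
have e1 := @cutoff_edge c th s s (s + 2 * r) r S e sth r0 S0
  (measurable_oo_sub s0 l6 mc) (ex_intro _ B (Bc _ _ s0 l6)) dth l1 (ltac:(by rewrite addrC addKr)) Hs.
have e2 := @cutoff_edge c th t (t - 2 * r) t r S e sth r0 S0
  (measurable_oo_sub l5 tT mc) (ex_intro _ B (Bc _ _ l5 tT)) dth l3 (subKr _ _) Ht.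
rewrite ths th1s in e1; rewrite tht th1t in e2.
(* There is no error where [th] equals 1; the two flanks have total length [4 r], which costs at
   most [4 r M <= e / 2]. *)
have e3 : `|\int[mu]_(x in `]s, t[) h x - \int[mu]_(x in `]s, t[) (h x * th x)| <= e / 2.
  rewrite -RintegralB//; [|exact: ih|exact: iht].
  have -> : \int[mu]_(x in `]s, t[) (h x - h x * th x) = \int[mu]_(x in `]s, t[) (h x * (1 - th x)).
    by apply: Rint_oo_eq => x _; ring.
  have ihu u v : 0 <= u -> v <= T -> mu.-integrable `]u, v[ (EFin \o (fun x => h x * (1 - th x))).
    move=> u0 vT; apply: integrable_eq (integrable_sub _ (ih u v u0 vT) (iht u v u0 vT)) => // x _.
    by ring.
  have bd (u v : R) : 0 <= u -> u <= v -> v <= T ->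
     `|\int[mu]_(x in `]u, v[) (h x * (1 - th x))| <= M * (v - u).
    move=> u0 uv vT; apply: Rint_oo_bound => //.
      by have /integrableP[/measurable_EFinP] := ihu u v u0 vT.
    move=> x xuv; rewrite normrM -[leRHS]mulr1 ler_pM//; first exact/hM/(sub u v u0 vT).
    have /andP[th0 th1'] := th01 x; rewrite ger0_norm ?subr_ge0//.
    by rewrite lerBlDr lerDl.
  rewrite (Rint_split3 l1 l2 l3); last exact: ihu.
  rewrite (@Rint_oo_zero (s + 2 * r) (t - 2 * r)) ?addr0; last first.
    by move=> x /andP[? ?]; rewrite th1 ?subrr ?mulr0// !ltW.
  apply: le_trans (ler_normD _ _) _.
  apply: le_trans (lerD (bd _ _ s0 l1 l6) (bd _ _ l5 l3 tT)) _.
  by clear -rM; lra.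
move: e1 e2 e3; move: (Rintegral _ _ _) (Rintegral _ _ _) (Rintegral _ _ _) (Rintegral _ _ _) => I1 I2 I3 I4.
rewrite subr0 sub0r mulr1 mulrN1 opprK !ler_norml; clear.
by move=> /andP[? ?] /andP[? ?] /andP[? ?] ?; apply/andP; split; lra.
Qed.

(** As the cutoffs tend to the indicator of ]s, t[, the left-hand side tends to [c s - c t].
    Continuity of [c] yields the identity for all [s] and [t], including the end points 0 and [T],
    where no test function is supported. *)
Lemma LI_weak T c h (M : R) : {within `[0, T], continuous c} -> measurable_fun `]0, T[ h ->
  (forall t, 0 < t < T -> `|h t| <= M) ->
  (forall th, test_fun (`]0, T[%classic : set R) th ->
    \int[mu]_(t in `]0, T[) (c t * 'D_1 th t) = - \int[mu]_(t in `]0, T[) (h t * th t)) ->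
  LI T c h.
Proof.
move=> cc mh hM Hth; split=> //; first by exists M.
move=> s t s0; rewrite le_eqVlt => /predU1P[->|st] tT; first by rewrite subrr Rint_oo_self.
have [S S0 HS] := cutoff_exists R.
have [B B0 HB] := within_continuous_bounded cc.
have M0 : 0 <= M.
  by apply: le_trans (hM ((s + t) / 2) _) => //; apply/andP; split; lra.
apply/eqP; rewrite -subr_eq0 -normr_le0; apply/ler_addgt0Pl => e e0; rewrite addr0.
have S16 : 0 < 16 * S by rewrite mulr_gt0.
have near_c (x : R) : 0 <= x <= T -> exists2 d : R, 0 < d &
    forall y, 0 <= y <= T -> `|x - y| < d -> `|c x - c y| <= e / (16 * S).
  move=> xT; move/subspace_continuousP : cc => /(_ x); rewrite /= in_itv/= => /(_ xT).
  move=> /cvgrPdist_le/(_ (e / (16 * S)) (divr_gt0 e0 S16)); rewrite near_withinE.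
  move=> /nbhs_ballP[d /= d0 sub]; exists d => // y yT xy.
  by apply: sub => //=; rewrite in_itv.
have sT : 0 <= s <= T by apply/andP; split; lra.
have tT' : 0 <= t <= T by apply/andP; split; lra.
have [d1 d10 Hd1] := near_c s sT; have [d2 d20 Hd2] := near_c t tT'.
have M81 : 0 < 8 * (M + 1) by rewrite mulr_gt0// ltr_wpDl.
(* The first bound leaves a plateau between the flanks, the next two keep flanks of length [2 r]
   where [c] is nearly constant, the last makes the integral of [h] over them small. *)
pose r := Num.min ((t - s) / 8) (Num.min (d1 / 4) (Num.min (d2 / 4) (e / (8 * (M + 1))))).
have r0 : 0 < r by rewrite !lt_min !divr_gt0// subr_gt0.
have r1 : r <= (t - s) / 8 by rewrite !ge_min lexx.
have r2 : r <= d1 / 4 by rewrite !ge_min lexx !orbT.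
have r3 : r <= d2 / 4 by rewrite !ge_min lexx !orbT.
have r4 : r * (8 * (M + 1)) <= e by rewrite -ler_pdivlMr// !ge_min lexx !orbT.
have [th tth [th01 th1 dth]] := HS s t r r0 ltac:(lra).
have [sth [K [cK Kst thK]]] := tth.
have th_out x : ~ (s < x < t) -> th x = 0.
  by move=> nx; apply: thK => /Kst/=; rewrite in_itv.
have tth' : test_fun (`]0, T[%classic : set R) th.
  split=> //; exists K; split=> // x /Kst/=; rewrite !in_itv/= => /andP[sx xt].
  by rewrite (le_lt_trans s0 sx) (lt_le_trans xt tT).
apply: (@cutoff_window c h th T s t r S e M B) => //.
- by lra.
- move=> y /andP[y1 y2]; apply: Hd1; first by apply/andP; split; lra.
  by rewrite ler0_norm; lra.
- move=> y /andP[y1 y2]; apply: Hd2; first by apply/andP; split; lra.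
  by rewrite ger0_norm; lra.
- by apply: le_trans r4; rewrite -mulrA mulrCA ler_pM2l// ler_pM2l// lerDl.
- exact: Hth.
Qed.

End LipschitzPrimitives.

(** * Sobolev functions with zero trace *)

Section SobolevZeroTrace.
Variables (R : realType) (l : R).
Hypothesis hl : 0 < l.
Local Notation mu := (leb R).
Local Notation D := (`]0, l[%classic : set R).
Local Notation L2 := (L2 (leb R) (`]0, l[%classic : set R)).
Local Notation ip := (ip (leb R) (`]0, l[%classic : set R)).

Lemma test_fun_L2 (psi : R -> R) : test_fun D psi -> L2 psi /\ L2 ('D_1 psi).
Proof.
move=> [sp _]; split; first exact/continuous_L2/smooth_continuous.
by apply: continuous_L2; apply: smooth_continuous; exact: smooth_derive.
Qed.

(** Multiplication by a cutoff. The dangerous term [g th'] stays bounded: on layers of width [2 r]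
    one has [|g| <= 2 G r], since [g] vanishes at the ends, while [|th'| <= S / r]. The squared
    errors are thus of order [r]. *)
Lemma test_fun_approx (g : R -> R) : smooth g -> g 0 = 0 -> g l = 0 ->
  forall e : R, 0 < e -> exists2 psi : R -> R, test_fun D psi &
    ip (fun x => g x - psi x) (fun x => g x - psi x) +
    ip (fun x => 'D_1 g x - 'D_1 psi x) (fun x => 'D_1 g x - 'D_1 psi x) < e.
Proof.
move=> sg g0 gl e e0.
have [S S0 HS] := cutoff_exists R.
have cg' : continuous ('D_1 g) by apply: smooth_continuous; exact: smooth_derive.
have [G G0 HG] := @within_continuous_bounded R 0 l _ (continuous_subspaceT cg').
have dg := smooth_is_derive sg.
have mg' (u v : R) : measurable_fun `]u, v[ ('D_1 g) by exact: continuous_measurable_oo.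
have gx x : 0 < x < l -> `|g x| <= G * x.
  move=> /andP[x0 xl]; have := ftc (ltW x0) dg cg'; rewrite g0 subr0 => <-.
  rewrite -[X in G * X]subr0; apply: Rint_oo_bound => //; first exact: ltW.
  by move=> y /andP[y0 yx]; apply: HG; rewrite (ltW y0) (ltW (lt_trans yx xl)).
have glx x : 0 < x < l -> `|g x| <= G * (l - x).
  move=> /andP[x0 xl]; have := ftc (ltW xl) dg cg'; rewrite gl sub0r => H.
  rewrite -normrN -H; apply: Rint_oo_bound => //; first exact: ltW.
  by move=> y /andP[y0 yx]; apply: HG; rewrite (ltW yx) (ltW (lt_trans x0 y0)).
(* Uniform bounds for the error and for its derivative; each squared norm is then at most
   [4 A^2 r]. *)
pose A1 := G * l; pose A2 := G + 2 * G * S.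
have A10 : 0 <= A1 by rewrite mulr_ge0// ltW.
have A20 : 0 <= A2 by rewrite addr_ge0// !mulr_ge0// ltW.
pose K := A1 ^+ 2 + A2 ^+ 2 + 1.
have K0 : 0 < K by rewrite ltr_wpDl// addr_ge0// sqr_ge0.
pose r := Num.min (l / 8) (e / (8 * K)).
have r0 : 0 < r by rewrite lt_min !divr_gt0// mulr_gt0.
have rl : r <= l / 8 by rewrite ge_min lexx.
have re : r * (8 * K) <= e by rewrite -ler_pdivlMr ?mulr_gt0// ge_min lexx orbT.
have r4 : 4 * r < l - 0 by lra.
have d0 : 0 < 2 * r by rewrite mulr_gt0.
have dl : 2 * (2 * r) < l by lra.
have [th tth [th01 th1 dth]] := HS 0 l r r0 r4.
have sth : smooth th by case: tth.
have th1' x : 2 * r < x < l - 2 * r -> th x = 1.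
  by move=> /andP[? ?]; apply: th1; rewrite add0r !ltW.
have dth1 x : 2 * r < x < l - 2 * r -> 'D_1 th x = 0.
  by move=> xr; exact: (@derive_cst_zone R th (2 * r) (l - 2 * r) 1 th1' x xr).
have tpsi : test_fun D (fun x => g x * th x) by exact: test_funM.
exists (fun x => g x * th x) => //.
have dpsi x : 'D_1 (fun x => g x * th x) x = g x * 'D_1 th x + th x * 'D_1 g x.
  by have H := is_derive_mul (dg x) (smooth_is_derive sth x); exact: derive_val.
have [Lp Lp'] := test_fun_L2 tpsi.
have Lg : L2 g by exact/continuous_L2/smooth_continuous.
have Lg' : L2 ('D_1 g) by exact: continuous_L2.
have th01' x : `|1 - th x| <= 1.
  by have /andP[a b] := th01 x; rewrite ger0_norm ?subr_ge0// lerBlDr lerDl.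
have B1 : ip (fun x => g x - g x * th x) (fun x => g x - g x * th x) <= 4 * A1 ^+ 2 * r.
  have -> : 4 * A1 ^+ 2 * r = 2 * A1 ^+ 2 * (2 * r) + 0 ^+ 2 * l by ring.
  apply: ip_three_pieces => //; first exact: (L2B _ Lg Lp).
    move=> x xl; rewrite -[X in X - _]mulr1 -mulrBr normrM -[leRHS]mulr1 ler_pM//.
    apply: le_trans (gx x xl) _; rewrite ler_wpM2l//.
    by move/andP: xl => [_ /ltW].
  by move=> x xl; rewrite th1'// mulr1 subrr normr0.
have B2 : ip (fun x => 'D_1 g x - 'D_1 (fun x => g x * th x) x)
    (fun x => 'D_1 g x - 'D_1 (fun x => g x * th x) x) <= 4 * A2 ^+ 2 * r.
  have -> : 4 * A2 ^+ 2 * r = 2 * A2 ^+ 2 * (2 * r) + 0 ^+ 2 * l by ring.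
  apply: ip_three_pieces => //; first exact: (L2B _ Lg' Lp').
    move=> x xl; rewrite dpsi.
    have -> : 'D_1 g x - (g x * 'D_1 th x + th x * 'D_1 g x) =
      'D_1 g x * (1 - th x) - g x * 'D_1 th x by ring.
    apply: le_trans (ler_normB _ _) _; apply: lerD.
      rewrite normrM -[leRHS]mulr1 ler_pM//; apply: HG.
      by move/andP: xl => [? ?]; rewrite !ltW.
    have key q : q <= 2 * r -> `|g x| <= G * q -> `|g x * 'D_1 th x| <= 2 * G * S.
      move=> q2 gq; rewrite normrM.
      have -> : 2 * G * S = (G * (2 * r)) * (S / r) by field; rewrite gt_eqF.
      by apply: ler_pM => //; apply: le_trans gq _; rewrite ler_wpM2l.
    have [x2|x2] := leP x (2 * r); first exact: key x2 (gx x xl).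
    have [x3|x3] := leP (l - 2 * r) x.
      by apply: (key (l - x)); [lra|exact: glx].
    by rewrite dth1 ?x2// mulr0 normr0 !mulr_ge0// ltW.
  by move=> x xl; rewrite dpsi dth1// th1'// mulr0 add0r mul1r subrr normr0.
apply: le_lt_trans (lerD B1 B2) _; apply: lt_le_trans re.
have -> : 4 * A1 ^+ 2 * r + 4 * A2 ^+ 2 * r = r * (4 * (A1 ^+ 2 + A2 ^+ 2)) by ring.
rewrite ltr_pM2l// /K; have := sqr_ge0 A1; have := sqr_ge0 A2; clear; lra.
Qed.

Lemma H1sqnorm_ip (g g1 : R -> R) : L2 g -> L2 g1 ->
  H1sqnorm l g g1 = (ip g g + ip g1 g1)%:E.
Proof. by move=> Lg Lg1; rewrite /H1sqnorm /L2sqnorm !Lnorm2_ip. Qed.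

Lemma H2sqnorm_ip (g g1 g2 : R -> R) : L2 g -> L2 g1 -> L2 g2 ->
  H2sqnorm l g g1 g2 = (ip g g + ip g1 g1 + ip g2 g2)%:E.
Proof. by move=> Lg Lg1 Lg2; rewrite /H2sqnorm /L2sqnorm !Lnorm2_ip. Qed.

Lemma H1_L2 (g g1 : R -> R) : H1 l g g1 -> L2 g /\ L2 g1.
Proof. by move=> [/Lp_on_L2 ? /Lp_on_L2 ? _]; split; auto. Qed.

Lemma H10P (g g1 : R -> R) : H10 l g g1 <-> H1 l g g1 /\
  forall e : R, 0 < e -> exists2 psi : R -> R, test_fun D psi &
    ip (fun x => g x - psi x) (fun x => g x - psi x) +
    ip (fun x => g1 x - 'D_1 psi x) (fun x => g1 x - 'D_1 psi x) < e.
Proof.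
have E g' g1' psi : H1 l g' g1' -> test_fun D psi ->
  H1sqnorm l (g' \- psi)%R (g1' \- 'D_1 psi)%R =
  (ip (fun x => g' x - psi x) (fun x => g' x - psi x) +
    ip (fun x => g1' x - 'D_1 psi x) (fun x => g1' x - 'D_1 psi x))%:E.
  move=> /H1_L2[Lg Lg1] /test_fun_L2[Lp Lp1].
  by rewrite H1sqnorm_ip//; [exact: (L2B _ Lg Lp)|exact: (L2B _ Lg1 Lp1)].
split=> -[Hg H]; split=> // e /H[psi tpsi]; exists psi => //.
  by rewrite -lte_fin -E.
by rewrite E.
Qed.

(** Cauchy-Schwarz; [a + 1] instead of [a] keeps the division harmless when [a = 0]. *)
Lemma ip_small (f g : R -> R) (a e : R) : L2 f -> L2 g -> 0 <= a -> 0 < e ->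
  ip f f <= a -> ip g g < e ^+ 2 / (a + 1) -> `|ip f g| <= e.
Proof.
move=> Lf Lg a0 e0 fa gb.
have a1 : 0 < a + 1 by rewrite ltr_wpDl.
have H : ip f g ^+ 2 <= ip f f * ip g g by exact: cauchy_schwarz.
rewrite -(ler_pXn2r (n := 2)) ?nnegrE// ?(ltW e0)// real_normK ?num_real//.
apply: le_trans H _.
apply: (@le_trans _ _ ((a + 1) * (e ^+ 2 / (a + 1)))).
  by apply: ler_pM; rewrite ?ip_ge0 ?(ltW gb)// (le_trans fa)// lerDl.
by rewrite mulrC divfK// gt_eqF.
Qed.

Lemma test_fun_parts (psi g g' : R -> R) : test_fun D psi ->
  (forall x : R, is_derive x 1 g (g' x)) -> continuous g' ->
  ip g ('D_1 psi) = - ip g' psi.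
Proof.
move=> tp dg cg'; have [sp _] := tp.
have dp := smooth_is_derive sp.
have cp' : continuous ('D_1 psi) by apply: smooth_continuous; exact: smooth_derive.
have cp := smooth_continuous sp; have cg := is_derive_continuous dg.
have dM x := is_derive_mul (dg x) (dp x).
have cM : continuous (fun x => g x * 'D_1 psi x + psi x * g' x).
  by move=> x; apply: cvgD; apply: cvgM; (exact: cg || exact: cp' || exact: cp || exact: cg').
have := ftc (ltW hl) dM cM.
rewrite (test_fun_out (x := 0) tp) ?(test_fun_out (x := l) tp) /=; last 2 first.
- by rewrite in_itv/= ltxx andbF.
- by rewrite in_itv/= ltxx.
rewrite !mulr0 subr0 RintegralD//; last 2 first.
- by apply: continuous_integrable_oo => x; apply: cvgM; [exact: cg|exact: cp'].
- by apply: continuous_integrable_oo => x; apply: cvgM; [exact: cp|exact: cg'].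
move=> /eqP; rewrite addr_eq0 => /eqP H; rewrite /ip H; congr (- _).
by apply: Rint_oo_eq => x _; rewrite mulrC.
Qed.

(** The two integrations by parts lose their boundary terms for different reasons: in the first the
    sine vanishes at the ends, so nothing is asked of the trace of [wx]; in the second the cosine
    does not vanish there, and the zero trace of [w] is what counts. *)
Lemma ip_second_deriv_sn (w wx wxx : R -> R) n : H2 l w wx wxx -> H10 l w wx ->
  ip wxx (sn l n) = - freq l n ^+ 2 * ip w (sn l n).
Proof.
move=> [_ Hx] /H10P[H1w Hw].
have [Lw Lwx] := H1_L2 H1w; have [_ Lwxx] := H1_L2 Hx.
have [ssn scsn] := smooth_sn_csn l n.
have D1sn : 'D_1 (sn l n) = fun x => freq l n * csn l n x.
  by apply/funext => x; have H := is_derive_sn l n x; exact: derive_val.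
have Lsn := L2_sn l n; have Lcsn := L2_csn l n.
have fcsn : L2 (fun x => freq l n * csn l n x) by apply: L2Z.
have LDsn : L2 ('D_1 (sn l n)) by rewrite D1sn.
have step1 : ip wxx (sn l n) = - (freq l n * ip wx (csn l n)).
  apply/eqP; rewrite -subr_eq0 opprK -normr_le0; apply/ler_addgt0Pl => e e0; rewrite addr0.
  have e2 : 0 < e / 2 by rewrite divr_gt0.
  pose a := ip wxx wxx + ip wx wx.
  have a0 : 0 <= a by rewrite addr_ge0 ?ip_ge0.
  have a1 : 0 < a + 1 by rewrite ltr_wpDl.
  have [psi tpsi] := test_fun_approx ssn (sn0 l n) (snl hl n) (divr_gt0 (exprn_gt0 2 e2) a1).
  have [Lp Lp'] := test_fun_L2 tpsi.
  have := ip_ge0 mu D (fun x => sn l n x - psi x).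
  have := ip_ge0 mu D (fun x => 'D_1 (sn l n) x - 'D_1 psi x) => q1 q2 q3.
  have [_ _ /(_ psi tpsi) wk] := Hx.
  have {}wk : ip wx ('D_1 psi) = - ip wxx psi by exact: wk.
  have -> : ip wxx (sn l n) + freq l n * ip wx (csn l n) =
      ip wxx (fun x => sn l n x - psi x) + ip wx (fun x => 'D_1 (sn l n) x - 'D_1 psi x).
    rewrite ipBr// ipBr//.
    rewrite wk D1sn ipZr//; ring.
  rewrite [leRHS](splitr e); apply: le_trans (ler_normD _ _) _; apply: lerD.
    apply: (@ip_small _ _ a) => //; first exact: (L2B _ Lsn Lp).
      by rewrite /a lerDl ip_ge0.
    by apply: le_lt_trans q3; rewrite lerDl.
  apply: (@ip_small _ _ a) => //; first exact: (L2B _ LDsn Lp').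
    by rewrite /a lerDr ip_ge0.
  by apply: le_lt_trans q3; rewrite lerDr.
have step2 : ip wx (csn l n) = freq l n * ip w (sn l n).
  apply/eqP; rewrite -subr_eq0 -normr_le0; apply/ler_addgt0Pl => e e0; rewrite addr0.
  have e2 : 0 < e / 2 by rewrite divr_gt0.
  pose fs x := freq l n * sn l n x.
  have Lfs : L2 fs by apply: L2Z.
  pose a := ip (csn l n) (csn l n) + ip fs fs.
  have a0 : 0 <= a by rewrite addr_ge0 ?ip_ge0.
  have a1 : 0 < a + 1 by rewrite ltr_wpDl.
  have [psi tpsi] := Hw _ (divr_gt0 (exprn_gt0 2 e2) a1).
  have [Lp Lp'] := test_fun_L2 tpsi.
  have := ip_ge0 mu D (fun x => w x - psi x).
  have := ip_ge0 mu D (fun x => wx x - 'D_1 psi x) => q1 q2 q3.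
  have wk : ip (csn l n) ('D_1 psi) = ip fs psi.
    rewrite (test_fun_parts tpsi (is_derive_csn l n)).
      by rewrite /fs !ipZl//; ring.
    by move=> x; apply: cvgM; [exact: cvg_cst|exact: continuous_sn].
  have -> : ip wx (csn l n) - freq l n * ip w (sn l n) =
      ip (csn l n) (fun x => wx x - 'D_1 psi x) - ip fs (fun x => w x - psi x).
    rewrite !ipBr// wk /fs !ipZl//.
    rewrite (_ : ip wx (csn l n) = ip (csn l n) wx); last exact: ipC.
    by rewrite (_ : ip w (sn l n) = ip (sn l n) w); [ring|exact: ipC].
  rewrite [leRHS](splitr e); apply: le_trans (ler_normB _ _) _; apply: lerD.
    apply: (@ip_small _ _ a) => //; first exact: (L2B _ Lwx Lp').
      by rewrite /a lerDl ip_ge0.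
    by apply: le_lt_trans q3; rewrite lerDr.
  apply: (@ip_small _ _ a) => //; first exact: (L2B _ Lw Lp).
    by rewrite /a lerDr ip_ge0.
  by apply: le_lt_trans q3; rewrite lerDl.
by rewrite step1 step2; ring.
Qed.

(** Test functions are continuous, hence sine dense, and they approximate [w]. This is how
    completeness becomes applicable to differences of solutions. *)
Lemma H10_sine_dense (w wx : R -> R) : H10 l w wx -> sine_dense l w.
Proof.
move=> /H10P[/H1_L2[Lw _] Hw]; apply: sine_dense_limit => // e /Hw[psi tpsi H].
have [sp _] := tpsi; have [Lp _] := test_fun_L2 tpsi.
exists psi; first split => //.
  by apply: sine_dense_continuous => //; apply: continuous_subspaceT; exact: smooth_continuous.
apply: le_lt_trans H; by rewrite lerDl ip_ge0.
Qed.

Lemma sine_denseB (f g : R -> R) : L2 f -> L2 g -> sine_dense l f -> sine_dense l g ->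
  sine_dense l (fun x => f x - g x).
Proof.
move=> Lf Lg df dg e e0; have e4 : 0 < e / 4 by rewrite divr_gt0.
have [p sp Hp] := df _ e4; have [q sq Hq] := dg _ e4.
have Lp : L2 p by case: (sp) => c [N ->]; exact: L2_psum.
have Lq : L2 q by case: (sq) => c [N ->]; exact: L2_psum.
exists (fun x => p x + (-1) * q x); first by apply: sine_polyD => //; exact: sine_polyZ.
have L1 : L2 (fun x => f x - p x) by exact: (L2B _ Lf Lp).
have L2' : L2 (fun x => (-1) * (g x - q x)) by apply: L2Z => //; exact: (L2B _ Lg Lq).
have := ip_sqD_le _ L1 L2' => /(_ (measurable_itv _)).
rewrite ip_sqZ//; last exact: (L2B _ Lg Lq).
rewrite sqrrN expr1n mul1r.
have -> : ip (fun x => f x - p x + (-1) * (g x - q x)) (fun x => f x - p x + (-1) * (g x - q x)) =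
  ip (fun x => f x - g x - (p x + (-1) * q x)) (fun x => f x - g x - (p x + (-1) * q x)).
  by apply: eq_ip => x _; ring.
by move: Hp Hq; clear; lra.
Qed.

End SobolevZeroTrace.

(** * Families of functions depending on time *)

Section TimeFamilies.
Variables (R : realType) (l T : R).
Hypotheses (hl : 0 < l) (hT : 0 < T).
Local Notation mu := (leb R).
Local Notation D := (`]0, l[%classic : set R).
Local Notation L2 := (L2 (leb R) (`]0, l[%classic : set R)).
Local Notation ip := (ip (leb R) (`]0, l[%classic : set R)).
Implicit Types (w a b f u ux uxx ut : R * R -> R).

Definition dist2 w (t s : R) : R :=
  ip (fun x => at_time w t x - at_time w s x) (fun x => at_time w t x - at_time w s x).

(* Continuity from [0, T] to L2(0, l). *)
Definition CL2 w : Prop := (forall t, 0 <= t <= T -> L2 (at_time w t)) /\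
  forall s e : R, 0 <= s <= T -> 0 < e -> exists2 d : R, 0 < d &
    forall t, 0 <= t <= T -> `|s - t| < d -> dist2 w t s < e.

Lemma within_eps_delta (c : R -> R) :
  (forall s e : R, 0 <= s <= T -> 0 < e -> exists2 d : R, 0 < d &
     forall t, 0 <= t <= T -> `|s - t| < d -> `|c t - c s| <= e) ->
  {within `[0, T], continuous c}.
Proof.
move=> H; apply/subspace_continuousP => s; rewrite /= in_itv/= => sT.
apply/cvgrPdist_le => e e0; rewrite near_withinE.
have [d d0 Hd] := H s e sT e0.
have : \forall y \near s, `|s - y| < d by apply: nbhsx_ballx.
apply: filterS => t st; rewrite /= in_itv/= => tT; rewrite distrC; exact: Hd.
Qed.

Lemma CL2_continuous w (g : R -> R) : CL2 w -> L2 g ->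
  {within `[0, T], continuous (fun t => ip (at_time w t) g)}.
Proof.
move=> [Lw cw] Lg; apply: within_eps_delta => s e sT e0.
have g1 : 0 < ip g g + 1 by rewrite ltr_wpDl ?ip_ge0.
have [d d0 Hd] := cw s _ sT (divr_gt0 (exprn_gt0 2 e0) g1).
exists d => // t tT st; rewrite -ipBl//; [|exact: Lw..].
rewrite ipC; apply: (@ip_small _ _ _ _ (ip g g)) => //; rewrite ?ip_ge0//.
  by apply: (L2B _ (Lw t tT) (Lw s sT)).
exact: Hd.
Qed.

Lemma CL2_bounded w : CL2 w -> exists2 B : R, 0 <= B &
  forall t, 0 <= t <= T -> ip (at_time w t) (at_time w t) <= B.
Proof.
move=> [Lw cw].
have c : {within `[0, T], continuous (fun t => ip (at_time w t) (at_time w t))}.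
  apply: within_eps_delta => s e sT e0.
  have g1 : 0 < ip (at_time w s) (at_time w s) + 1 by rewrite ltr_wpDl ?ip_ge0.
  have e4 : 0 < e / 4 by rewrite divr_gt0.
  have [d1 d10 Hd1] := cw s _ sT (divr_gt0 (exprn_gt0 2 e4) g1).
  have [d2 d20 Hd2] := cw s _ sT e4.
  exists (Num.min d1 d2); first by rewrite lt_min d10.
  move=> t tT; rewrite lt_min => /andP[/(Hd1 t tT) H1 /(Hd2 t tT) H2].
  have [Lt Ls] := (Lw t tT, Lw s sT).
  have Ld : L2 (fun x => at_time w t x - at_time w s x) by exact: (L2B _ Lt Ls).
  have H3 : `|ip (at_time w s) (fun x => at_time w t x - at_time w s x)| <= e / 4.
    exact: (ip_small Ls Ld (ip_ge0 _ _ _) e4 (lexx _) H1).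
  have -> : ip (at_time w t) (at_time w t) - ip (at_time w s) (at_time w s) =
     dist2 w t s + 2 * ip (at_time w s) (fun x => at_time w t x - at_time w s x).
    rewrite /dist2 ip_sqB//.
    have E2 : ip (at_time w t) (at_time w s) = ip (at_time w s) (at_time w t) by exact: ipC.
    by rewrite ipBr// E2; ring.
  have d0 : 0 <= dist2 w t s by exact: ip_ge0.
  apply: le_trans (ler_normD _ _) _; rewrite (ger0_norm d0) normrM (ger0_norm (ler0n _ 2)).
  by move: e0 H2 H3; clear; lra.
have [B B0 HB] := within_continuous_bounded c.
by exists B => // t tT; apply: le_trans (ler_norm _) (HB t tT).
Qed.

(** Separating the three functions lets each series be treated on its own, and replaces
    extended-real limits by real inequalities. *)
Lemma C_H2_H10P u ux uxx : C_H2_H10 l T u ux uxx <->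
  (forall t, 0 <= t <= T -> H2 l (at_time u t) (at_time ux t) (at_time uxx t) /\
     H10 l (at_time u t) (at_time ux t)) /\ [/\ CL2 u, CL2 ux & CL2 uxx].
Proof.
have LL t : H2 l (at_time u t) (at_time ux t) (at_time uxx t) ->
    [/\ L2 (at_time u t), L2 (at_time ux t) & L2 (at_time uxx t)].
  by move=> [/H1_L2[? ?] /H1_L2[_ ?]].
have E t s : H2 l (at_time u t) (at_time ux t) (at_time uxx t) ->
    H2 l (at_time u s) (at_time ux s) (at_time uxx s) ->
    H2sqnorm l (at_time u t \- at_time u s) (at_time ux t \- at_time ux s)
      (at_time uxx t \- at_time uxx s) = (dist2 u t s + dist2 ux t s + dist2 uxx t s)%:E.
  move=> /LL[a1 a2 a3] /LL[b1 b2 b3]; rewrite H2sqnorm_ip//.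
  - exact: (L2B _ a1 b1).
  - exact: (L2B _ a2 b2).
  - exact: (L2B _ a3 b3).
have p0 w t s : 0 <= dist2 w t s by exact: ip_ge0.
split.
- move=> [H C].
  have H' t : 0 <= t <= T -> H2 l (at_time u t) (at_time ux t) (at_time uxx t) /\
     H10 l (at_time u t) (at_time ux t) by move=> tT; apply: H; rewrite in_itv.
  split=> //.
  have key s e : 0 <= s <= T -> 0 < e -> exists2 d : R, 0 < d &
    forall t, 0 <= t <= T -> `|s - t| < d -> dist2 u t s + dist2 ux t s + dist2 uxx t s < e.
    move=> sT e0; have := C s; rewrite in_itv/= => /(_ sT) /fine_cvgP[_].
    move=> /cvgrPdist_lt/(_ e e0); rewrite near_withinE => /nbhs_ballP[d /= d0 sub].
    exists d => // t tT st.
    have := sub t st; rewrite /= in_itv/= => /(_ tT).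
    rewrite E//; [|by have [] := H' t tT|by have [] := H' s sT].
    by rewrite /= sub0r normrN ger0_norm// !addr_ge0.
  split; split; try by move=> t /H'[/LL[]].
  - move=> s e sT e0; have [d d0 Hd] := key s e sT e0; exists d => // t tT st.
    by apply: le_lt_trans (Hd t tT st); rewrite -addrA lerDl addr_ge0.
  - move=> s e sT e0; have [d d0 Hd] := key s e sT e0; exists d => // t tT st.
    by apply: le_lt_trans (Hd t tT st); rewrite addrAC lerDr addr_ge0.
  - move=> s e sT e0; have [d d0 Hd] := key s e sT e0; exists d => // t tT st.
    by apply: le_lt_trans (Hd t tT st); rewrite lerDr addr_ge0.
- move=> [H [[_ c1] [_ c2] [_ c3]]]; split; first by move=> t; rewrite in_itv; exact: H.
  move=> s; rewrite in_itv/= => sT; apply/fine_cvgP; split.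
    rewrite near_withinE; apply: nearW => t; rewrite /= in_itv/= => tT.
    by rewrite E//; [have [] := H t tT|have [] := H s sT].
  apply/cvgrPdist_lt => e e0; rewrite near_withinE.
  have e3 : 0 < e / 3 by rewrite divr_gt0.
  have [d1 d10 H1] := c1 s _ sT e3; have [d2 d20 H2'] := c2 s _ sT e3.
  have [d3 d30 H3] := c3 s _ sT e3.
  have d0 : 0 < Num.min d1 (Num.min d2 d3) by rewrite !lt_min d10 d20.
  have : \forall y \near s, `|s - y| < Num.min d1 (Num.min d2 d3) by apply: nbhsx_ballx.
  apply: filterS => t; rewrite !lt_min => /andP[h1 /andP[h2 h3]]; rewrite /= in_itv/= => tT.
  rewrite E//; [|by have [] := H t tT|by have [] := H s sT].
  rewrite /= sub0r normrN ger0_norm ?addr_ge0//.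
  by have := H1 t tT h1; have := H2' t tT h2; have := H3 t tT h3; clear; lra.
Qed.

Lemma rect_measurable : measurable (rect l T).
Proof. exact: measurableX. Qed.

Lemma rect_fin : ((leb R \x leb R)%E (rect l T) < +oo)%E.
Proof.
rewrite /rect product_measure1E//.
by rewrite lte_mul_pinfty ?measure_ge0 ?ge0_fin_numE ?leb_oo_fin.
Qed.

Lemma Lp_on_rect_measurable ut : Lp_on (leb R \x leb R)%E 2%:E (rect l T) ut ->
  measurable_fun setT (ut \_ (rect l T)).
Proof. by rewrite /Lp_on inE => /andP[]; rewrite inE. Qed.

Lemma slice_measurable ut t : Lp_on (leb R \x leb R)%E 2%:E (rect l T) ut ->
  0 < t < T -> measurable_fun D (at_time ut t).
Proof.
move=> /Lp_on_rect_measurable mU tT.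
have m : measurable_fun setT (fun x : R => (ut \_ (rect l T)) (x, t)).
  by apply: (measurableT_comp mU); exact: measurable_pair2.
apply: (@eq_measurable_fun _ _ _ _ _ (fun x : R => (ut \_ (rect l T)) (x, t))).
  move=> x /set_mem xD; have rxt : rect l T (x, t) by split => //=; rewrite in_itv.
  by rewrite patchE mem_set.
exact: (measurable_funS _ _ m).
Qed.

(** On the rectangle, which has finite measure, the bounded [k] is square integrable, so [ut * k] is
    integrable; Fubini's theorem for its extension by zero gives measurability of the inner
    integral. *)
Lemma slice_int_measurable ut (k : R * R -> R) (Q : R) :
  Lp_on (leb R \x leb R)%E 2%:E (rect l T) ut -> measurable_fun setT k ->
  (forall z, rect l T z -> `|k z| <= Q) ->
  measurable_fun `]0, T[ (fun t => \int[mu]_(x in `]0, l[) (ut (x, t) * k (x, t))).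
Proof.
move=> /Lp_on_L2 Lu mk HQ; have mr := rect_measurable; have {}Lu := Lu mr.
have : Lp_on (leb R \x leb R)%E 2%:E (rect l T) k.
  apply/Lp_on_L2; first exact: mr.
  apply: (@L2_bounded _ _ _ _ _ _ _ Q) => //; first exact: rect_fin.
  exact: (measurable_funS (E := setT)).
move=> /Lp_on_L2 Lp; have {}Lp := Lp mr.
have Hi : (leb R \x leb R)%E.-integrable setT
    ((EFin \o (fun z => ut z * k z)) \_ (rect l T)).
  apply: (iffLR (integrable_mkcond _ _)) => //.
  exact: (L2_mul _ Lu Lp).
have := measurable_fubini_G Hi => mG.
apply: (@eq_measurable_fun _ _ _ _ _ (fine \o fubini_G (leb R)
  ((EFin \o (fun z => ut z * k z)) \_ (rect l T)))); last first.
  apply: (measurable_funS (E := setT)) => //.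
  exact: (measurableT_comp (f := fine)).
move=> t /set_mem/=; rewrite in_itv/= => tT.
rewrite /Rintegral /=; congr fine; rewrite integral_mkcond /fubini_G.
apply: eq_integral => x _; rewrite !patchE.
have -> : ((x, t) \in rect l T) = (x \in D).
  by apply/idP/idP => /set_mem H; apply/mem_set; [case: H|split => //=; rewrite in_itv].
by [].
Qed.

Lemma ae_eq_Rint_oo (a b : R) (f g : R -> R) : measurable_fun `]a, b[ f ->
  measurable_fun `]a, b[ g -> (\forall x \ae mu, x \in `]a, b[ -> f x = g x) ->
  \int[mu]_(x in `]a, b[) f x = \int[mu]_(x in `]a, b[) g x.
Proof.
move=> mf mg fg; congr fine; apply: ae_eq_integral => //.
- exact/measurable_EFinP.
- exact/measurable_EFinP.
- by apply: ae_mono fg => x /= H xD; rewrite H.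
Qed.

Lemma CL2_bound_ip w (g : R -> R) (B e : R) : L2 g -> 0 <= B -> 0 < e ->
  (forall t, 0 <= t <= T -> L2 (at_time w t)) ->
  (forall t, 0 <= t <= T -> ip (at_time w t) (at_time w t) <= B) ->
  ip g g < e ^+ 2 / (B + 1) -> forall t, 0 <= t <= T -> `|ip (at_time w t) g| <= e.
Proof. by move=> Lg B0 e0 Lw wB gB t tT; exact: (ip_small (Lw t tT) Lg B0 e0 (wB t tT) gB). Qed.

Lemma test_fun_bounded (A : set R) (th : R -> R) (a b : R) : test_fun A th ->
  exists2 M : R, 0 <= M & forall x, a <= x <= b -> `|th x| <= M.
Proof.
by move=> [sth _]; apply: within_continuous_bounded; apply: continuous_subspaceT; exact: smooth_continuous.
Qed.

Lemma measurable_tensor (f g : R -> R) : continuous f -> continuous g ->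
  measurable_fun setT (fun z : R * R => f z.1 * g z.2).
Proof.
move=> cf cg; apply: measurable_funM.
  by apply: (measurableT_comp (f := f)); [exact: continuous_measurable_fun|exact: measurable_fst].
by apply: (measurableT_comp (f := g)); [exact: continuous_measurable_fun|exact: measurable_snd].
Qed.

(** Testing with a product [psi(x) th(t)] separates the variables: the weak time derivative becomes
    the weak derivative of a scalar function of time. *)
Lemma weak_dt_pairing w wt G (psi : R -> R) :
  Lp_on (leb R \x leb R)%E 2%:E (rect l T) wt -> weak_dt l T w wt ->
  (forall t, 0 < t < T -> L2 (at_time w t)) -> (forall t, 0 < t < T -> L2 (at_time G t)) ->
  measurable_fun `]0, T[ (fun t => ip (at_time G t) psi) ->
  (\forall t \ae mu, t \in `]0, T[ -> \forall x \ae mu, x \in `]0, l[ -> wt (x, t) = G (x, t)) ->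
  test_fun D psi -> forall th, test_fun (`]0, T[%classic : set R) th ->
  \int[mu]_(t in `]0, T[) (ip (at_time w t) psi * 'D_1 th t) =
  - \int[mu]_(t in `]0, T[) (ip (at_time G t) psi * th t).
Proof.
move=> Lwt wk Lw LG mG wG tp th tth; have [Lp _] := test_fun_L2 tp.
have [[sp _] [sth _]] := (tp, tth).
have [cp cth] := (smooth_continuous sp, smooth_continuous sth).
have := wk _ (test_fun_tensor tp tth).
have -> : \int[mu]_(t in `]0, T[) \int[mu]_(x in `]0, l[) (w (x, t) *
    'D_((0, 1) : R * R) (fun z : R * R => psi z.1 * th z.2) (x, t)) =
  \int[mu]_(t in `]0, T[) (ip (at_time w t) psi * 'D_1 th t).
  apply: Rint_oo_eq => t tT; rewrite mulrC /ip -RintegralZl//; last first.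
    by apply: L2_mul => //; exact: Lw.
  by apply: Rint_oo_eq => x _; rewrite derive_tensor// /at_time; ring.
move=> ->; congr (- _).
have [Mp Mp0 HMp] := test_fun_bounded 0 l tp; have [Mt Mt0 HMt] := test_fun_bounded 0 T tth.
apply: ae_eq_Rint_oo.
- apply: (@slice_int_measurable _ (fun z => psi z.1 * th z.2) (Mp * Mt)) => //.
    exact: measurable_tensor.
  move=> [x t] [/=]; rewrite !in_itv/= => /andP[? ?] /andP[? ?].
  by rewrite normrM ler_pM// ?HMp ?HMt// !ltW.
- by apply: measurable_funM => //; exact: continuous_measurable_oo.
- apply: ae_mono wG => t H tT; have {}H := H tT.
  have tT' : 0 < t < T by move: tT; rewrite in_itv.
  rewrite [RHS]mulrC /ip -RintegralZl//; last by apply: L2_mul => //; exact: LG.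
  have mwt := slice_measurable Lwt tT'.
  have [mGt _] := LG t tT'.
  have mp : measurable_fun `]0, l[ psi by exact: continuous_measurable_oo.
  apply: ae_eq_Rint_oo.
  + have m2 : measurable_fun `]0, l[ (fun x => psi x * th t).
      by apply: measurable_funM mp _; exact: measurable_cst.
    exact: (measurable_funM mwt m2).
  + by apply: measurable_funM; [exact: measurable_cst|exact: measurable_funM].
  + by apply: ae_mono H => x Hx xl; rewrite Hx// /at_time/=; ring.
Qed.

Lemma ler_norm4 (x1 x2 x3 x4 y1 y2 y3 y4 : R) : `|x1| <= y1 -> `|x2| <= y2 -> `|x3| <= y3 ->
  `|x4| <= y4 -> `|x1 + x2 + x3 + x4| <= y1 + y2 + y3 + y4.
Proof.
move=> h1 h2 h3 h4; apply: le_trans (ler_normD _ _) (lerD _ h4).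
by apply: le_trans (ler_normD _ _) (lerD _ h3); apply: le_trans (ler_normD _ _) (lerD h1 h2).
Qed.

(* For a test function [g] this is [LI_weak]; a general [g] is an L2 limit of
   those, uniformly in time. *)
Lemma evolution_pairing (w wxx a b f wt : R * R -> R) (q1 q2 : R -> R) (M : R) :
  CL2 w -> CL2 wxx -> CL2 a -> CL2 b -> CL2 f ->
  measurable_fun `]0, T[ q1 -> measurable_fun `]0, T[ q2 ->
  (forall t, 0 < t < T -> `|q1 t| <= M) -> (forall t, 0 < t < T -> `|q2 t| <= M) ->
  Lp_on (leb R \x leb R)%E 2%:E (rect l T) wt -> weak_dt l T w wt ->
  (\forall t \ae mu, t \in `]0, T[ -> \forall x \ae mu, x \in `]0, l[ ->
     wt (x, t) = wxx (x, t) + q1 t * a (x, t) + q2 t * b (x, t) + f (x, t)) ->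
  forall g, L2 g -> (forall e : R, 0 < e -> exists2 psi, test_fun D psi &
     ip (fun x => g x - psi x) (fun x => g x - psi x) < e) ->
  LI T (fun t => ip (at_time w t) g) (fun t => ip (at_time wxx t) g +
    q1 t * ip (at_time a t) g + q2 t * ip (at_time b t) g + ip (at_time f t) g).
Proof.
move=> Cw Cwxx Ca Cb Cf mq1 mq2 Hq1 Hq2 Lwt wk eqn g Lg Hg.
have M0 : 0 <= M.
  by apply: le_trans (Hq1 (T / 2) _) => //; by rewrite divr_gt0//= ltr_pdivrMr// ltr_pMr// ltr1n.
pose H g t := ip (at_time wxx t) g + q1 t * ip (at_time a t) g +
  q2 t * ip (at_time b t) g + ip (at_time f t) g.
have sub t : 0 < t < T -> 0 <= t <= T by move=> /andP[? ?]; rewrite !ltW.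
have mip w' g' : CL2 w' -> L2 g' -> measurable_fun `]0, T[ (fun t => ip (at_time w' t) g').
  by move=> C L; apply: within_measurable_oo; exact: CL2_continuous.
have mH g' : L2 g' -> measurable_fun `]0, T[ (H g').
  move=> L; apply: measurable_funD; [apply: measurable_funD; [apply: measurable_funD|]|];
    try (apply: measurable_funM => //); exact: mip.
have bip w' g' : CL2 w' -> L2 g' -> exists2 B : R, 0 <= B & forall t, 0 <= t <= T ->
    `|ip (at_time w' t) g'| <= B.
  by move=> C L; apply: within_continuous_bounded; exact: CL2_continuous.
have bH g' : L2 g' -> exists B : R, forall t, 0 < t < T -> `|H g' t| <= B.
  move=> L; have [B1 _ H1] := bip _ _ Cwxx L; have [B2 _ H2] := bip _ _ Ca L.
  have [B3 _ H3] := bip _ _ Cb L; have [B4 _ H4] := bip _ _ Cf L.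
  exists (B1 + M * B2 + M * B3 + B4) => t tT; have tT' := sub t tT.
  have -> : H g' t = ip (at_time wxx t) g' + q1 t * ip (at_time a t) g' +
    q2 t * ip (at_time b t) g' + ip (at_time f t) g' by [].
  by apply: ler_norm4; rewrite ?normrM ?H1 ?H4//; apply: ler_pM; rewrite ?Hq1 ?Hq2 ?H2 ?H3.
pose G z := wxx z + q1 z.2 * a z + q2 z.2 * b z + f z.
have LG t : 0 < t < T -> L2 (at_time G t).
  move=> /sub tT; have [[[L1 _] [L2_ _]] [[L3 _] [L4 _]]] := ((Cwxx, Ca), (Cb, Cf)).
  by apply: (L2D _ (L2D _ (L2D _ (L1 t tT) (L2Z _ (q1 t) (L2_ t tT))) (L2Z _ (q2 t) (L3 t tT))) (L4 t tT)).
have GE g' t : L2 g' -> 0 < t < T -> ip (at_time G t) g' = H g' t.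
  move=> L /sub tT; have [[[L1 _] [L2_ _]] [[L3 _] [L4 _]]] := ((Cwxx, Ca), (Cb, Cf)).
  have La : L2 (fun x => q1 t * at_time a t x) by apply: L2Z => //; exact: L2_.
  have Lb : L2 (fun x => q2 t * at_time b t x) by apply: L2Z => //; exact: L3.
  have L12 : L2 (fun x => at_time wxx t x + q1 t * at_time a t x) by exact: (L2D _ (L1 t tT) La).
  have L123 : L2 (fun x => at_time wxx t x + q1 t * at_time a t x + q2 t * at_time b t x).
    exact: (L2D _ L12 Lb).
  rewrite /H -(ipZl _ (q1 t) (L2_ t tT) L)// -(ipZl _ (q2 t) (L3 t tT) L)//.
  by rewrite -(ipDl _ (L1 t tT) La L)// -(ipDl _ L12 Lb L)// -(ipDl _ L123 (L4 t tT) L).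
have step psi : test_fun D psi -> LI T (fun t => ip (at_time w t) psi) (H psi).
  move=> tp; have [Lp _] := test_fun_L2 tp; have [B HB] := bH psi Lp.
  apply: (@LI_weak _ _ _ _ B) => //.
  - exact: CL2_continuous.
  - exact: mH.
  - move=> th tth; rewrite (weak_dt_pairing Lwt wk (G := G) _ LG _ _ tp tth)//.
    + by congr (- _); apply: Rint_oo_eq => t tT; rewrite GE.
    + by move=> t /sub tT; have [L1 _] := Cw; exact: L1.
    + apply: eq_measurable_fun (mH psi Lp) => t /set_mem/=; rewrite in_itv/= => tT.
      by rewrite GE.
split; [exact: mH|exact: bH|].
have [B1 B10 H1] := CL2_bounded Cw; have [B2 B20 H2] := CL2_bounded Cwxx.
have [B3 B30 H3] := CL2_bounded Ca; have [B4 B40 H4] := CL2_bounded Cb.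
have [B5 B50 H5] := CL2_bounded Cf.
pose B := B1 + B2 + B3 + B4 + B5.
have B0 : 0 <= B by rewrite !addr_ge0.
have B1' : 0 < B + 1 by rewrite ltr_wpDl.
move=> s t s0 st tT; apply/eqP; rewrite -subr_eq0 -normr_le0.
apply/ler_addgt0Pl => e e0; rewrite addr0.
(* It counts the errors of size [e / K]: one at each end point, and those of the integrand, with
   weights 1, [M], [M], 1, over a length at most [T]. *)
pose K := 2 + (2 + 2 * M) * T.
have K0 : 0 < K by rewrite ltr_wpDr// mulr_ge0 ?(ltW hT)// addr_ge0// mulr_ge0.
have eK : 0 < e / K by rewrite divr_gt0.
have [psi tp Hp] := Hg _ (divr_gt0 (exprn_gt0 2 eK) B1').
have [Lp _] := test_fun_L2 tp.
have Ld : L2 (fun x => g x - psi x) by exact: (L2B _ Lg Lp).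
have small w' Bw : CL2 w' -> (forall t, 0 <= t <= T -> ip (at_time w' t) (at_time w' t) <= Bw) ->
    Bw <= B -> forall r, 0 <= r <= T -> `|ip (at_time w' r) g - ip (at_time w' r) psi| <= e / K.
  move=> [Lw' _] Hw BB r rT; rewrite -ipBr//; last exact: Lw'.
  apply: (CL2_bound_ip Ld B0 eK Lw' _ Hp) => // r' r'T.
  exact: le_trans (Hw r' r'T) BB.
have S1 : forall r, 0 <= r <= T -> `|ip (at_time w r) g - ip (at_time w r) psi| <= e / K.
  by apply: (small _ B1) => //; rewrite /B -!addrA lerDl !addr_ge0.
have S2 : forall r, 0 <= r <= T -> `|ip (at_time wxx r) g - ip (at_time wxx r) psi| <= e / K.
  by apply: (small _ B2) => //; move: B10 B20 B30 B40 B50; rewrite /B; clear; lra.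
have S3 : forall r, 0 <= r <= T -> `|ip (at_time a r) g - ip (at_time a r) psi| <= e / K.
  by apply: (small _ B3) => //; move: B10 B20 B30 B40 B50; rewrite /B; clear; lra.
have S4 : forall r, 0 <= r <= T -> `|ip (at_time b r) g - ip (at_time b r) psi| <= e / K.
  by apply: (small _ B4) => //; move: B10 B20 B30 B40 B50; rewrite /B; clear; lra.
have S5 : forall r, 0 <= r <= T -> `|ip (at_time f r) g - ip (at_time f r) psi| <= e / K.
  by apply: (small _ B5) => //; move: B10 B20 B30 B40 B50; rewrite /B; clear; lra.
have [_ _ Hpsi] := step psi tp.
have E := Hpsi s t s0 st tT.
have sT : 0 <= s <= T by rewrite s0 (le_trans st).
have tT' : 0 <= t <= T by rewrite (le_trans s0).
have iH g' : L2 g' -> mu.-integrable `]s, t[ (EFin \o H g').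
  move=> L; have [BB HBB] := bH g' L; apply: (@bounded_integrable_oo _ _ _ _ BB).
    exact: (measurable_oo_sub s0 tT (mH g' L)).
  by move=> x /andP[sx xt]; apply: HBB; rewrite (le_lt_trans s0 sx) (lt_le_trans xt tT).
have I1 : `|\int[mu]_(x in `]s, t[) H g x - \int[mu]_(x in `]s, t[) H psi x| <=
    ((2 + 2 * M) * (e / K)) * (t - s).
  rewrite -RintegralB//; [|exact: iH..].
  apply: Rint_oo_bound => //.
    by apply: measurable_funB; apply: (measurable_oo_sub s0 tT); exact: mH.
  move=> x /andP[sx xt].
  have xT : 0 < x < T by rewrite (le_lt_trans s0 sx) (lt_le_trans xt tT).
  have xT' := sub x xT.
  have -> : H g x - H psi x =
     (ip (at_time wxx x) g - ip (at_time wxx x) psi) +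
     q1 x * (ip (at_time a x) g - ip (at_time a x) psi) +
     q2 x * (ip (at_time b x) g - ip (at_time b x) psi) +
     (ip (at_time f x) g - ip (at_time f x) psi) by rewrite /H; ring.
  have -> : (2 + 2 * M) * (e / K) = e / K + M * (e / K) + M * (e / K) + e / K by ring.
  by apply: ler_norm4; rewrite ?normrM ?S2 ?S5//; apply: ler_pM; rewrite ?Hq1 ?Hq2 ?S3 ?S4.
have I2 : ((2 + 2 * M) * (e / K)) * (t - s) <= ((2 + 2 * M) * (e / K)) * T.
  rewrite ler_wpM2l//; first by rewrite mulr_ge0 ?(ltW eK)// addr_ge0// mulr_ge0.
  by move: s0 tT; clear; lra.
have -> : ip (at_time w t) g - ip (at_time w s) g - \int[mu]_(x in `]s, t[) H g x =
  (ip (at_time w t) g - ip (at_time w t) psi) - (ip (at_time w s) g - ip (at_time w s) psi) -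
  (\int[mu]_(x in `]s, t[) H g x - \int[mu]_(x in `]s, t[) H psi x).
  by rewrite -E; ring.
have Ke : e = e / K + e / K + ((2 + 2 * M) * (e / K)) * T.
  by rewrite /K; field; rewrite -/K gt_eqF.
apply: le_trans (ler_normB _ _) _; rewrite [leRHS]Ke; apply: lerD.
  by apply: le_trans (ler_normB _ _) _; apply: lerD; [exact: S1|exact: S1].
exact: le_trans I1 I2.
Qed.

End TimeFamilies.

(** * Uniqueness *)

Section Uniqueness.
Variables (R : realType) (l T : R).
Hypotheses (hl : 0 < l) (hT : 0 < T).
Local Notation mu := (leb R).
Local Notation D := (`]0, l[%classic : set R).
Local Notation L2 := (L2 (leb R) (`]0, l[%classic : set R)).
Local Notation ip := (ip (leb R) (`]0, l[%classic : set R)).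

Lemma within_closed_rect_slice (w : R * R -> R) (t : R) : {within closed_rect l T, continuous w} ->
  0 <= t <= T -> {within `[0, l], continuous (at_time w t)}.
Proof.
move=> /subspace_continuousP cw tT; apply/subspace_continuousP => x xl.
have /cvgrPdist_le H := cw (x, t) (conj xl (tT : t \in `[0, T])).
apply/cvgrPdist_le => e e0; have := H e e0; rewrite !near_withinE => /nbhs_ballP[d /= d0 sub].
apply/nbhs_ballP; exists d => //= y xy yl.
by apply: (sub (y, t)); split => //=; exact: ballxx.
Qed.

(** Compactness of [0, l] makes continuity in time uniform in [x], and uniform closeness controls
    the L2 distance. *)
Lemma continuous_CL2 (w : R * R -> R) : {within closed_rect l T, continuous w} -> CL2 l T w.
Proof.
move=> cw.
have Lw t : 0 <= t <= T -> L2 (at_time w t).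
  by move=> tT; apply: within_L2; exact: within_closed_rect_slice.
split=> // s e sT e0.
(* The minimum with 1 ensures [e' ^+ 2 <= e'], so the squared distance is at most
   [e' * l <= e / 2]. *)
have e'0 : 0 < Num.min 1 (e / (2 * l)) by rewrite lt_min ltr01 divr_gt0// mulr_gt0.
set e' := Num.min _ _ in e'0.
have cK : compact (`[0, l]%classic : set R) by exact: segment_compact.
have /compact_near_coveringP/near_covering_withinP NC := cK.
have := NC _ (nbhs s) (fun t x => `[0, T]%classic t -> `|w (x, t) - w (x, s)| <= e') _.
case.
  move=> x xl; move: cw => /subspace_continuousP/(_ (x, s) (conj xl sT)) /cvgrPdist_le.
  move=> /(_ (e' / 2)) /(_ (divr_gt0 e'0 (ltr0Sn _ 1))).
  rewrite near_withinE => /nbhs_ballP[d /= d0 sub].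
  exists (ball x d, ball s d) => /=; first by split; exact: nbhsx_ballx.
  move=> [y t] [/= xy st] yl tT.
  have H1 := sub (y, t) (conj xy st) (conj yl tT).
  have H2 := sub (y, s) (conj xy (ballxx _ d0)) (conj yl sT).
  rewrite (_ : w (y, t) - w (y, s) = (w (x, s) - w (y, s)) - (w (x, s) - w (y, t))); last by ring.
  by apply: le_trans (ler_normB _ _) _; rewrite [leRHS]splitr; apply: lerD.
move=> d /= d0 sub; exists d => // t tT st.
have H x xl := sub t st x xl tT.
have Ld : L2 (fun x => at_time w t x - at_time w s x) by exact: (L2B _ (Lw t tT) (Lw s sT)).
rewrite /dist2 /ip; apply: le_lt_trans (ler_norm _) _.
apply: le_lt_trans (Rint_oo_bound (M := e') (ltW hl) _ _) _.
- by have [m _] := Ld; exact: measurable_funM.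
- move=> x /andP[x0 xl].
  have h : `|at_time w t x - at_time w s x| <= e' by apply: H; rewrite /= in_itv/= !ltW.
  rewrite normrM; apply: le_trans (ler_pM _ _ h h) _ => //.
  by rewrite ler_piMr ?(ltW e'0)// /e' ge_min lexx.
- rewrite subr0 -ltr_pdivlMr// /e' gt_min; apply/orP; right.
  by rewrite ltr_pM2l// ltf_pV2 ?posrE ?mulr_gt0// ltr_pMl// ltr1n.
Qed.

(** Truncation at the essential bound. The last clause keeps a function that vanishes on [0, T]
    exactly zero, which carries real scalars through the construction. *)
Lemma bounded_representative (p : R -> R) : Lp_on mu +oo%E `[0, T] p ->
  exists (q : R -> R) (M : R), [/\ measurable_fun setT q, forall t, `|q t| <= M,
    \forall t \ae mu, t \in `]0, T[ -> p t = q t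
    & (forall t : R, t \in `[0, T] -> p t = 0) -> forall t, q t = 0].
Proof.
rewrite /Lp_on inE => /andP[]; rewrite !inE => mP fP.
have [M HM] : exists M : R, \forall t \ae mu, `|(p \_ `[0, T]) t| <= M.
  have : (ess_sup mu (EFin \o (fun t => `|(p \_ `[0, T]) t|%R)) < +oo)%E.
    move: fP; rewrite /finite_norm /= unlock.
    case: ifPn => [_|]; first by apply: le_lt_trans; apply: le_ess_sup; exact: nearW.
    (* The default branch of the norm concerns spaces of measure zero and is excluded here. *)
    move=> /negP []; have H : (mu `]0%R, T[ <= mu setT)%E by apply: le_measure; rewrite ?inE.
    by apply: lt_le_trans H; rewrite leb_oo ?ltW// lte_fin subr0.
  by move=> /ess_supr_bounded.
exists (clamp (- `|M|) `|M| \o (p \_ `[0, T])), `|M|; split.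
- apply: (measurableT_comp (f := clamp (- `|M|) `|M|)) => //.
  apply: continuous_measurable_fun.
  apply: (@clamp_continuous _ _ _ _ id); first by rewrite ge0_cp.
  by apply: continuous_subspaceT => x; exact: cvg_id.
- by move=> t; rewrite ler_norml; apply: clamp_itv; rewrite ge0_cp.
- apply: ae_mono HM => t H tT.
  have tT' : t \in `[0, T] by apply: subset_itv_oo_cc.
  move: H; rewrite /= patchE mem_set// => H.
  rewrite clamp_id//; rewrite -ler_norml; exact: le_trans H (ler_norm _).
- move=> p0 t; have -> : p \_ `[0, T] = fun=> 0.
    by apply/funext => r; rewrite patchE; case: ifPn => // /set_mem/p0.
  by rewrite /= clamp_id// oppr_le0 normr_ge0.
Qed.

(** Real and imaginary part of [z' = - (k_n + p) z + F + i G] for [z = c + i d] and [p = pr + i pi],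
    in integrated form. *)
Definition forced_mode (pr pi : R -> R) n (c d F G : R -> R) : Prop :=
  LI T c (fun t => - freq l n ^+ 2 * c t - pr t * c t + pi t * d t + F t) /\
  LI T d (fun t => - freq l n ^+ 2 * d t - pr t * d t - pi t * c t + G t).

(* The cross terms cancel in the derivative of c^2 + d^2. *)
Lemma homogeneous_mode (pr pi : R -> R) (M : R) n (c d : R -> R) :
  measurable_fun setT pr -> (forall t, `|pr t| <= M) ->
  forced_mode pr pi n c d (fun=> 0) (fun=> 0) -> c 0 = 0 -> d 0 = 0 ->
  forall t, 0 <= t <= T -> c t = 0 /\ d t = 0.
Proof.
move=> mpr Hpr [Lc Ld] c0 d0.
have LQ := LI_add (LI_mul Lc Lc) (LI_mul Ld Ld).
pose Q t := c t * c t + d t * d t.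
have M0 : 0 <= M by apply: le_trans (Hpr 0).
have Q0 : forall t, 0 <= Q t by move=> t; rewrite addr_ge0// -expr2 sqr_ge0.
have {}LQ : LI T Q (fun t => 2 * (- freq l n ^+ 2 - pr t) * Q t).
  by apply: LI_eq LQ => // t _; rewrite /Q; ring.
have cQ := LI_continuous LQ.
suff H : forall t, 0 <= t <= T -> Q t = 0.
  move=> t /H /eqP; rewrite /Q paddr_eq0 ?sqr_ge0 -?expr2 ?sqr_ge0//.
  by rewrite !sqrf_eq0 => /andP[/eqP-> /eqP->].
(* The eigenvalue enters with a favourable sign and is dropped; the rate is then at most [2 * M]. *)
apply: (@gronwall _ _ _ (2 * M)) => //; first exact: ltW; first by rewrite mulr_ge0.
move=> t /andP[t0 tT]; have [_ _ HQ] := LQ.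
have Q00 : Q 0 = 0 by rewrite /Q c0 d0; ring.
have := HQ 0 t (lexx 0) t0 tT; rewrite Q00 subr0 => ->.
have iQ : mu.-integrable `]0, t[ (EFin \o Q).
  have [B _ HB] := LI_bounded LQ; apply: (bounded_integrable_oo (M := B)).
    exact: (measurable_oo_sub (lexx 0) tT (LI_measurable LQ)).
  by move=> x /andP[x0 xt]; apply: HB; rewrite !ltW// (lt_le_trans xt).
rewrite -RintegralZl//; apply: le_Rintegral => //.
- exact: (LI_integrable LQ).
- exact: integrable_scale.
- move=> x _; apply: ler_wpM2r => //; rewrite ler_wpM2l//.
  by have := Hpr x; rewrite ler_norml => /andP[+ _]; have := sqr_ge0 (freq l n); clear; lra.
Qed.

Lemma forced_mode_unique (pr pi : R -> R) (M : R) n (c d c' d' F G : R -> R) :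
  measurable_fun setT pr -> (forall t, `|pr t| <= M) ->
  forced_mode pr pi n c d F G -> forced_mode pr pi n c' d' F G ->
  c 0 = c' 0 -> d 0 = d' 0 -> forall t, 0 <= t <= T -> c t = c' t /\ d t = d' t.
Proof.
move=> mpr Hpr [Lc Ld] [Lc' Ld'] c0 d0 t tT.
have [] := @homogeneous_mode pr pi M n (fun t => c t + -1 * c' t) (fun t => d t + -1 * d' t) _ _ _ _ _ t tT => //.
- split.
    by apply: LI_eq (LI_add Lc (LI_scale (-1) Lc')) => // s _; ring.
  by apply: LI_eq (LI_add Ld (LI_scale (-1) Ld')) => // s _; ring.
- by rewrite c0; ring.
- by rewrite d0; ring.
- by rewrite !mulN1r => /eqP + /eqP; rewrite !subr_eq0 => /eqP-> /eqP->.
Qed.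

Lemma sn_approx n (e : R) : 0 < e -> exists2 psi, test_fun D psi &
  ip (fun x => sn l n x - psi x) (fun x => sn l n x - psi x) < e.
Proof.
move=> e0; have [ssn _] := smooth_sn_csn l n.
have [psi tp H] := test_fun_approx hl ssn (sn0 l n) (snl hl n) e0.
by exists psi => //; apply: le_lt_trans H; rewrite lerDl ip_ge0.
Qed.

Variables (p phi : R -> R[i]) (f : R * R -> R[i]) (pr pi : R -> R) (M : R).
Hypotheses (mpr : measurable_fun setT pr) (mpi : measurable_fun setT pi).
Hypotheses (Hpr : forall t, `|pr t| <= M) (Hpi : forall t, `|pi t| <= M).
Hypotheses (Epr : \forall t \ae mu, t \in `]0, T[ -> re p t = pr t).
Hypotheses (Epi : \forall t \ae mu, t \in `]0, T[ -> im p t = pi t).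
Hypotheses (Cfr : CL2 l T (re f)) (Cfi : CL2 l T (im f)).
Hypotheses (Lphr : L2 (re phi)) (Lphi : L2 (im phi)).

(** [evolution_pairing] is applied to [re u] and to [im u], the other part being the coupled term,
    and [ip_second_deriv_sn] turns [uxx] into the eigenvalue. The initial condition holds only
    almost everywhere in [x], a difference that pairings do not see. *)
Lemma solution_forced_mode (u : R * R -> R[i]) n : solution l T p phi f u ->
  forced_mode pr pi n (fun t => ip (at_time (re u) t) (sn l n))
    (fun t => ip (at_time (im u) t) (sn l n))
    (fun t => ip (at_time (re f) t) (sn l n)) (fun t => ip (at_time (im f) t) (sn l n)) /\
  ip (at_time (re u) 0) (sn l n) = ip (re phi) (sn l n) /\
  ip (at_time (im u) 0) (sn l n) = ip (im phi) (sn l n).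
Proof.
move=> [ux [uxx [ut [[Cr Lr Wr] [Ci Li Wi] eqn ini]]]].
have [Hr [cur _ curxx]] := (iffLR (C_H2_H10P _ _ _ _ _) Cr).
have [Hi [cui _ cuixx]] := (iffLR (C_H2_H10P _ _ _ _ _) Ci).
have m0 (q : R -> R) : measurable_fun setT q -> measurable_fun `]0, T[ q.
  by move=> mq; exact: (measurable_funS (E := setT)).
have Lsn := L2_sn l n.
have er : \forall t \ae mu, t \in `]0, T[ -> \forall x \ae mu, x \in `]0, l[ ->
    re ut (x, t) = re uxx (x, t) + (fun t => - pr t) t * re u (x, t) + pi t * im u (x, t) + re f (x, t).
  have E := ae_mono2 (fun t a b => conj a b) Epr Epi.
  apply: ae_mono2 E eqn => t [Er Ei] eqt tT; apply: ae_mono (eqt tT) => x /[apply].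
  rewrite /re /im -(Er tT) -(Ei tT) /re /im.
  case: (ut (x, t)) (uxx (x, t)) (p t) (u (x, t)) (f (x, t)) => [a1 a2] [b1 b2] [c1 c2] [d1 d2] [e1 e2].
  by move=> [-> _]/=; ring.
have ei : \forall t \ae mu, t \in `]0, T[ -> \forall x \ae mu, x \in `]0, l[ ->
    im ut (x, t) = im uxx (x, t) + (fun t => - pr t) t * im u (x, t) + (fun t => - pi t) t * re u (x, t) + im f (x, t).
  have E := ae_mono2 (fun t a b => conj a b) Epr Epi.
  apply: ae_mono2 E eqn => t [Er Ei] eqt tT; apply: ae_mono (eqt tT) => x /[apply].
  rewrite /re /im -(Er tT) -(Ei tT) /re /im.
  case: (ut (x, t)) (uxx (x, t)) (p t) (u (x, t)) (f (x, t)) => [a1 a2] [b1 b2] [c1 c2] [d1 d2] [e1 e2].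
  by move=> [_ ->]/=; ring.
have Npr : measurable_fun `]0, T[ (fun t => - pr t) by apply: measurableT_comp => //; exact: m0.
have Npi : measurable_fun `]0, T[ (fun t => - pi t) by apply: measurableT_comp => //; exact: m0.
split; [split|split].
- have b1 (t : R) : 0 < t < T -> `|- pr t| <= M by rewrite normrN.
  have b2 (t : R) : 0 < t < T -> `|pi t| <= M by [].
  have ev := evolution_pairing hT cur curxx cur cui Cfr Npr (m0 _ mpi) b1 b2 Lr Wr er Lsn (@sn_approx n).
  apply: LI_eq ev => //.
  move=> t /andP[t0 tT]; have t01 : 0 <= t <= T by rewrite !ltW.
    have [h2 h10] := Hr t t01; rewrite (ip_second_deriv_sn hl n h2 h10); ring.
- have b1 (t : R) : 0 < t < T -> `|- pr t| <= M by rewrite normrN.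
  have b2 (t : R) : 0 < t < T -> `|- pi t| <= M by rewrite normrN.
  have ev := evolution_pairing hT cui cuixx cui cur Cfi Npr Npi b1 b2 Li Wi ei Lsn (@sn_approx n).
  apply: LI_eq ev => //.
  move=> t /andP[t0 tT]; have t01 : 0 <= t <= T by rewrite !ltW.
    have [h2 h10] := Hi t t01; rewrite (ip_second_deriv_sn hl n h2 h10); ring.
- have T0 : 0 <= (0 : R) <= T by rewrite lexx ltW.
  apply: ae_eq_ip => //; first by have [L _] := cur; exact: L.
  + by apply: ae_mono ini => x H xl; rewrite /at_time /re H.
  + by apply: nearW.
- have T0 : 0 <= (0 : R) <= T by rewrite lexx ltW.
  apply: ae_eq_ip => //; first by have [L _] := cui; exact: L.
  + by apply: ae_mono ini => x H xl; rewrite /at_time /im H.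
  + by apply: nearW.
Qed.

Lemma solution_unique (u v : R * R -> R[i]) : solution l T p phi f u -> solution l T p phi f v ->
  forall t : R, t \in `[0, T] -> \forall x \ae mu, x \in `]0, l[ -> v (x, t) = u (x, t).
Proof.
move=> su sv t; rewrite in_itv/= => tT.
have [ux [uxx [ut [[/C_H2_H10P[Hur [[Lur _] _ _]] _ _] [/C_H2_H10P[Hui [[Lui _] _ _]] _ _] _ _]]]] := su.
have [vx [vxx [vt [[/C_H2_H10P[Hvr [[Lvr _] _ _]] _ _] [/C_H2_H10P[Hvi [[Lvi _] _ _]] _ _] _ _]]]] := sv.
have E n : ip (at_time (re u) t) (sn l n) = ip (at_time (re v) t) (sn l n) /\
    ip (at_time (im u) t) (sn l n) = ip (at_time (im v) t) (sn l n).
  have [Mu [u0r u0i]] := solution_forced_mode n su.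
  have [Mv [v0r v0i]] := solution_forced_mode n sv.
  have := forced_mode_unique mpr Hpr Mu Mv _ _ tT; apply.
    by rewrite u0r v0r.
  by rewrite u0i v0i.
have key (a b ax bx : R -> R) : L2 a -> L2 b -> H10 l a ax -> H10 l b bx ->
    (forall n, ip a (sn l n) = ip b (sn l n)) -> \forall x \ae mu, x \in `]0, l[ -> b x = a x.
  move=> La Lb Ha Hb ab.
  have Ld : L2 (fun x => b x - a x) by exact: (L2B _ Lb La).
  have c0 n : coef l (fun x => b x - a x) n = 0.
    by rewrite /coef ipBl ?ab ?subrr ?mulr0//; exact: L2_sn.
  have := sine_complete hl Ld (sine_denseB Lb La (H10_sine_dense hl Hb) (H10_sine_dense hl Ha)) c0.
  by apply: ae_mono => x H xl; apply/eqP; rewrite -subr_eq0; apply/eqP; exact: H.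
have [_ h1] := Hur t tT; have [_ h2] := Hvr t tT; have [_ h3] := Hui t tT; have [_ h4] := Hvi t tT.
have kr := key _ _ _ _ (Lur t tT) (Lvr t tT) h1 h2 (fun n => (E n).1).
have ki := key _ _ _ _ (Lui t tT) (Lvi t tT) h3 h4 (fun n => (E n).2).
apply: ae_mono2 kr ki => x hr hi xl; move: (hr xl) (hi xl); rewrite /at_time /re /im.
by case: (v (x, t)) (u (x, t)) => [a b] [c d] /= -> ->.
Qed.

End Uniqueness.

(** * Summable sequences *)

Section SummableSequences.
Variable R : realType.
Implicit Types (a g : nat -> R).

Definition nneg_summable g : Prop :=
  (forall n, 0 <= g n) /\ exists B : R, forall N, \sum_(n < N) g n <= B.

Definition ssum a : R := limn (series a).

Lemma nneg_summable_le a g : nneg_summable g -> (forall n, 0 <= a n <= g n) -> nneg_summable a.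
Proof.
move=> [_ [B HB]] H; split; first by move=> n; have /andP[] := H n.
by exists B => N; apply: le_trans (HB N); apply: ler_sum => n _; have /andP[] := H n.
Qed.

Lemma nneg_summableD a g : nneg_summable a -> nneg_summable g -> nneg_summable (fun n => a n + g n).
Proof.
move=> [a0 [A HA]] [g0 [B HB]]; split; first by move=> n; rewrite addr_ge0.
by exists (A + B) => N; rewrite big_split; exact: lerD.
Qed.

Lemma nneg_summableZ (k : R) g : 0 <= k -> nneg_summable g -> nneg_summable (fun n => k * g n).
Proof.
move=> k0 [g0 [B HB]]; split; first by move=> n; rewrite mulr_ge0.
by exists (k * B) => N; rewrite -mulr_sumr ler_wpM2l.
Qed.

Lemma nneg_summable_cauchy g : nneg_summable g -> forall e : R, 0 < e ->
  exists N0, forall N M, (N0 <= N)%N -> (N <= M)%N -> \sum_(n < M) g n - \sum_(n < N) g n <= e.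
Proof.
move=> [g0 [B HB]] e e0.
have nd : nondecreasing_seq (fun N => \sum_(n < N) g n).
  by apply/nondecreasing_seqP => N; rewrite big_ord_recr/= lerDl.
have cg : cvgn (fun N => \sum_(n < N) g n).
  by apply: nondecreasing_is_cvgn => //; exists B => _ [N _ <-].
move/cvgrPdist_le: (cg) => /(_ e e0)[N0 _ H]; exists N0 => N M N0N NM.
have h := H N N0N; have h2 := nondecreasing_cvgn_le nd cg M.
have h3 := le_trans (ler_norm _) h.
by apply: le_trans h3; rewrite lerD2r.
Qed.

Lemma sum_diff_bound a g N M : (forall n, `|a n| <= g n) -> (N <= M)%N ->
  `|\sum_(n < M) a n - \sum_(n < N) a n| <= \sum_(n < M) g n - \sum_(n < N) g n.
Proof.
move=> ag; elim: M => [|M IH]; first by rewrite leqn0 => /eqP->; rewrite !subrr normr0.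
rewrite leq_eqVlt ltnS => /predU1P[->|/IH NM]; first by rewrite !subrr normr0.
rewrite !big_ord_recr/= addrAC [leRHS]addrAC.
by apply: le_trans (ler_normD _ _) _; exact: lerD.
Qed.

(** [N0] depends on the majorant [g] alone, not on [a]; this is what turns domination into
    convergence uniform in space and time. *)
Lemma ssum_tail g : nneg_summable g -> forall e : R, 0 < e -> exists N0, forall a,
  (forall n, `|a n| <= g n) -> forall N, (N0 <= N)%N -> `|ssum a - \sum_(n < N) a n| <= e.
Proof.
move=> sg e e0; have [N0 HN0] := nneg_summable_cauchy sg e0.
exists N0 => a ag N N0N.
have cser : cvgn (series g).
  have [g0 [B HB]] := sg; apply: nondecreasing_is_cvgn.
    by apply/nondecreasing_seqP => k; rewrite /series/= !big_mkord big_ord_recr/= lerDl.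
  by exists B => _ [k _ <-]; rewrite /series/= big_mkord.
have ca : cvgn (series a).
  have [g0 _] := sg; apply: normed_cvg; apply: series_le_cvg cser => // n; exact: normr_ge0.
have : (fun M => `|series a M - \sum_(n < N) a n|) @ \oo --> `|ssum a - \sum_(n < N) a n|.
  by apply: cvg_norm; apply: cvgB => //; exact: cvg_cst.
move=> h; rewrite -(cvg_lim _ h)//; apply: limr_le; first by apply/cvg_ex; eexists; exact: h.
near=> M; rewrite /series/= big_mkord; apply: le_trans (HN0 N M N0N _).
  by apply: sum_diff_bound => //; near: M; exact: nbhs_infty_ge.
by near: M; exact: nbhs_infty_ge.
Unshelve. all: by end_near. Qed.

Lemma ssum_bound a g (B : R) : nneg_summable g -> (forall n, `|a n| <= g n) ->
  (forall N, \sum_(n < N) g n <= B) -> `|ssum a| <= B.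
Proof.
move=> sg ag gB; apply/ler_addgt0Pl => e e0.
have [N0 /(_ a ag N0 (leqnn _)) H] := ssum_tail sg e0.
rewrite -[ssum a](subrK (\sum_(n < N0) a n)); apply: le_trans (ler_normD _ _) (lerD H _).
by apply: le_trans (gB N0); apply: le_trans (ler_norm_sum _ _ _) _; apply: ler_sum => n _.
Qed.

Lemma ssum0 : ssum (fun=> 0) = 0.
Proof.
apply/eqP; rewrite -normr_le0; apply: (@ssum_bound _ (fun=> 0)) => [|n|N].
- by split=> //; exists 0 => N; rewrite big1.
- by rewrite normr0.
- by rewrite big1.
Qed.

Lemma inv_freq_sq_summable (l : R) : 0 < l -> nneg_summable (fun n => (freq l n ^+ 2)^-1).
Proof.
move=> hl; have s : nneg_summable (fun n : nat => (n.+1%:R ^+ 2)^-1 : R).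
  split; first by move=> n; rewrite invr_ge0 exprn_ge0.
  (* A stronger bound fit for induction: the increment [2/(N+1) - 2/(N+2)] exceeds [1/(N+1)^2] by
     [N / ((N+1)^2 (N+2))], and both sides are 0 at [N = 0]. *)
  exists 2; suff H N : \sum_(n < N) (n.+1%:R ^+ 2)^-1 <= 2 - 2 / N.+1%:R :> R.
    by move=> N; apply: le_trans (H N) _; rewrite gerBl divr_ge0.
  elim: N => [|N IH]; first by rewrite big_ord0 divr1 subrr.
  rewrite big_ord_recr/=; apply: le_trans (lerD IH (lexx _)) _.
  rewrite -subr_ge0 (_ : _ - _ = N%:R / (N.+1%:R ^+ 2 * N.+2%:R)); first by rewrite divr_ge0// mulr_ge0.
  rewrite -(addn1 N.+1) -(addn1 N) !natrD; field.
  by have N0 := ler0n R N; rewrite !gt_eqF// ltr_wpDl// addr_ge0.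
have E n : (freq l n ^+ 2)^-1 = (l / pi) ^+ 2 * (n.+1%:R ^+ 2)^-1.
  rewrite /freq; move: (@pi R) (pi_gt0 R) => q q0; field.
  by rewrite (gt_eqF hl) (gt_eqF q0) nat1r pnatr_eq0.
have := nneg_summableZ (sqr_ge0 (l / pi)) s.
by congr nneg_summable; apply/funext => n; rewrite E.
Qed.

End SummableSequences.

(** * Measurability of uniform limits *)

Section MeasurableLimits.
Context d (S : measurableType d) (R : realType).

Lemma measurable_uniform_limit (D : set S) (g : S -> R) : measurable D ->
  (forall e : R, 0 < e -> exists2 f : S -> R, measurable_fun D f & forall x, D x -> `|g x - f x| <= e) ->
  measurable_fun D g.
Proof.
move=> mD H.
have Hk (k : nat) : {f : S -> R | measurable_fun D f /\ forall x, D x -> `|g x - f x| <= k.+1%:R^-1}.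
  by apply/cid; have [f ? ?] := H k.+1%:R^-1 ltac:(by rewrite invr_gt0); exists f.
apply: (measurable_fun_cvg (h := fun k => sval (Hk k))) => //.
  by move=> k; have [] := svalP (Hk k).
move=> x Dx; apply/cvgrPdist_le => e e0; near=> k.
have [_ /(_ x Dx) h] := svalP (Hk k); apply: le_trans h _.
by apply/ltW; near: k; exact: (near_infty_natSinv_lt (PosNum e0)).
Unshelve. all: by end_near. Qed.

End MeasurableLimits.

(** * Uniform convergence in time *)

Section UniformL2Limits.
Variables (R : realType) (l T : R).
Hypotheses (hl : 0 < l) (hT : 0 < T).
Local Notation mu := (leb R).
Local Notation D := (`]0, l[%classic : set R).
Local Notation L2 := (L2 (leb R) (`]0, l[%classic : set R)).
Local Notation ip := (ip (leb R) (`]0, l[%classic : set R)).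
Implicit Types (w u : R * R -> R) (c h : nat -> R -> R).

Lemma ip_sup_bound (f : R -> R) (e : R) : measurable_fun D f -> 0 <= e ->
  (forall x, 0 < x < l -> `|f x| <= e) -> ip f f <= e ^+ 2 * l.
Proof.
move=> mf e0 H; apply: le_trans (ler_norm _) _; rewrite -[l in leRHS]subr0.
apply: Rint_oo_bound; [exact: ltW|exact: measurable_funM|].
by move=> x /H h; rewrite normrM expr2; apply: ler_pM.
Qed.

Lemma ip_sq_triangle (f g k : R -> R) : L2 f -> L2 g -> L2 k ->
  ip (fun x => f x - k x) (fun x => f x - k x) <=
  2 * (ip (fun x => f x - g x) (fun x => f x - g x) + ip (fun x => g x - k x) (fun x => g x - k x)).
Proof.
move=> Lf Lg Lk; have L1 : L2 (fun x => f x - g x) by exact: (L2B _ Lf Lg).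
have L2' : L2 (fun x => g x - k x) by exact: (L2B _ Lg Lk).
apply: le_trans (ip_sqD_le _ L1 L2') => //.
by rewrite le_eqVlt; apply/orP; left; apply/eqP; apply: eq_ip => x _; ring.
Qed.

Lemma CL2_add w u : CL2 l T w -> CL2 l T u -> CL2 l T (fun z => w z + u z).
Proof.
move=> [Lw cw] [Lu cu]; split; first by move=> t tT; exact: (L2D _ (Lw t tT) (Lu t tT)).
move=> s e sT e0; have e4 : 0 < e / 4 by rewrite divr_gt0.
have [d1 d10 H1] := cw s _ sT e4; have [d2 d20 H2] := cu s _ sT e4.
exists (Num.min d1 d2); first by rewrite lt_min d10.
move=> t tT; rewrite lt_min => /andP[/(H1 t tT) h1 /(H2 t tT) h2].
have L1 : L2 (fun x => at_time w t x - at_time w s x) by exact: (L2B _ (Lw t tT) (Lw s sT)).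
have L2' : L2 (fun x => at_time u t x - at_time u s x) by exact: (L2B _ (Lu t tT) (Lu s sT)).
rewrite /dist2; apply: (@le_lt_trans _ _ (2 * (dist2 l w t s + dist2 l u t s))).
  apply: le_trans (ip_sqD_le _ L1 L2') => //.
  by rewrite le_eqVlt; apply/orP; left; apply/eqP; apply: eq_ip => x _; rewrite /at_time; ring.
by move: h1 h2; clear; lra.
Qed.

Lemma CL2_tensor (c : R -> R) (g : R -> R) : {within `[0, T], continuous c} -> L2 g ->
  CL2 l T (fun z => c z.2 * g z.1).
Proof.
move=> cc Lg; split; first by move=> t _; exact: (L2Z _ (c t) Lg).
move=> s e sT e0.
have g1 : 0 < ip g g + 1 by rewrite ltr_wpDl ?ip_ge0.
have e1 : 0 < Num.min 1 (e / (ip g g + 1)) by rewrite lt_min ltr01 divr_gt0.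
move: cc => /subspace_continuousP/(_ s); rewrite /= in_itv/= => /(_ sT) /cvgrPdist_lt.
move=> /(_ _ e1); rewrite near_withinE => /nbhs_ballP[d /= d0 sub].
exists d => // t tT st; have := sub t st; rewrite /= in_itv/= => /(_ tT).
rewrite lt_min => /andP[h1 h2].
have -> : dist2 l (fun z => c z.2 * g z.1) t s = (c t - c s) ^+ 2 * ip g g.
  by rewrite -ip_sqZ//; apply: eq_ip => x _; rewrite /at_time/=; ring.
have h3 : (c t - c s) ^+ 2 <= `|c s - c t|.
  by rewrite -real_normK ?num_real// distrC expr2 ler_piMr// ltW.
apply: (@le_lt_trans _ _ (`|c s - c t| * (ip g g + 1))).
  by apply: ler_pM => //; rewrite ?sqr_ge0 ?ip_ge0// lerDl.
by rewrite -ltr_pdivlMr.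
Qed.

Lemma CL2_sum (F : nat -> R * R -> R) N : (forall n, CL2 l T (F n)) ->
  CL2 l T (fun z => \sum_(n < N) F n z).
Proof.
move=> HF; elim: N => [|N IH].
  rewrite (_ : (fun _ => _) = fun z : R * R => (cst 0 : R -> R) z.2 * (cst 0 : R -> R) z.1).
    apply: CL2_tensor; last exact: L2_0.
    by apply: continuous_subspaceT => x; exact: cvg_cst.
  by apply/funext => z; rewrite big_ord0 mul0r.
rewrite (_ : (fun _ => _) = fun z => \sum_(n < N) F n z + F N z); first exact: CL2_add.
by apply/funext => z; rewrite big_ord_recr.
Qed.

Lemma CL2_limit w : (forall t, 0 <= t <= T -> L2 (at_time w t)) ->
  (forall e : R, 0 < e -> exists2 u, CL2 l T u & forall t, 0 <= t <= T ->
     ip (fun x => at_time w t x - at_time u t x) (fun x => at_time w t x - at_time u t x) < e) ->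
  CL2 l T w.
Proof.
(* For squared norms the triangle inequality costs a factor 2; used twice it gives
   [2 (1 + 2 (1 + 1)) = 10] times the basic error. *)
move=> Lw H; split=> // s e sT e0; have e10 : 0 < e / 10 by rewrite divr_gt0.
have [u [Lu cu] Hu] := H _ e10; have [d d0 Hd] := cu s _ sT e10; exists d => // t tT st.
have h1 := Hu t tT; have h2 := Hu s sT; have h3 := Hd t tT st.
have T1 := ip_sq_triangle (Lw t tT) (Lu t tT) (Lw s sT).
have T2 := ip_sq_triangle (Lu t tT) (Lu s sT) (Lw s sT).
rewrite /dist2; apply: le_lt_trans T1 _.
have E : ip (fun x => at_time u s x - at_time w s x) (fun x => at_time u s x - at_time w s x) =
   ip (fun x => at_time w s x - at_time u s x) (fun x => at_time w s x - at_time u s x).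
  by congr Rintegral; apply/funext => x; ring.
rewrite E in T2; move: h1 h2 h3 T2; rewrite /dist2; clear; lra.
Qed.

Definition resid c w N t : R :=
  ip (fun x => at_time w t x - psum l (c^~ t) N x) (fun x => at_time w t x - psum l (c^~ t) N x).

(* The sine series with coefficients [c n t] converges to [w] in L2(0, l),
   uniformly in [t]. *)
Definition ucv c w : Prop := (forall t, 0 <= t <= T -> L2 (at_time w t)) /\
  forall e : R, 0 < e -> exists N0, forall N, (N0 <= N)%N ->
    forall t, 0 <= t <= T -> resid c w N t < e.

Lemma ucvD c w h u : ucv c w -> ucv h u -> ucv (fun n t => c n t + h n t) (fun z => w z + u z).
Proof.
move=> [Lw Hw] [Lu Hu]; split; first by move=> t tT; exact: (L2D _ (Lw t tT) (Lu t tT)).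
move=> e e0; have e4 : 0 < e / 4 by rewrite divr_gt0.
have [N1 H1] := Hw _ e4; have [N2 H2] := Hu _ e4; exists (maxn N1 N2) => N.
rewrite geq_max => /andP[/H1 h1 /H2 h2] t tT.
have L1 : L2 (fun x => at_time w t x - psum l (c^~ t) N x).
  by exact: (L2B _ (Lw t tT) (L2_psum _ _ _)).
have L2' : L2 (fun x => at_time u t x - psum l (h^~ t) N x).
  by exact: (L2B _ (Lu t tT) (L2_psum _ _ _)).
apply: (@le_lt_trans _ _ (2 * (resid c w N t + resid h u N t))).
  apply: le_trans (ip_sqD_le _ L1 L2') => //.
  rewrite le_eqVlt; apply/orP; left; apply/eqP; apply: eq_ip => x _.
    rewrite /at_time /psum (_ : \sum_(n < N) _ = \sum_(n < N) (c n t * sn l n x + h n t * sn l n x)).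
      by rewrite big_split/=; ring.
    by apply: eq_bigr => n _; ring.
  rewrite /at_time /psum (_ : \sum_(n < N) _ = \sum_(n < N) (c n t * sn l n x + h n t * sn l n x)).
    by rewrite big_split/=; ring.
  by apply: eq_bigr => n _; ring.
by move: (h1 t tT) (h2 t tT); clear; lra.
Qed.

(** Convergence uniform in time survives multiplication by a bounded factor; [q] stands for a real
    or imaginary part of [p], up to sign, which may be discontinuous. *)
Lemma ucvZ (q : R -> R) (M : R) c w : (forall t, `|q t| <= M) -> ucv c w ->
  ucv (fun n t => q t * c n t) (fun z => q z.2 * w z).
Proof.
move=> Hq [Lw Hw]; split; first by move=> t tT; exact: (L2Z _ (q t) (Lw t tT)).
have M0 : 0 <= M by apply: le_trans (Hq 0).
have M1 : 0 < M ^+ 2 + 1 by rewrite ltr_wpDl// sqr_ge0.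
move=> e e0; have [N1 H1] := Hw _ (divr_gt0 e0 M1); exists N1 => N /H1 h1 t tT.
have L1 : L2 (fun x => at_time w t x - psum l (c^~ t) N x).
  by exact: (L2B _ (Lw t tT) (L2_psum _ _ _)).
have -> : resid (fun n t => q t * c n t) (fun z => q z.2 * w z) N t = q t ^+ 2 * resid c w N t.
  have E x : at_time (fun z => q z.2 * w z) t x - psum l (fun n => q t * c n t) N x =
      q t * (at_time w t x - psum l (c^~ t) N x).
    rewrite /at_time /psum mulrBr mulr_sumr; congr (_ - _).
    by apply: eq_bigr => n _; ring.
  rewrite /resid -ip_sqZ//; exact: eq_ip.
have := h1 t tT; rewrite ltr_pdivlMr//; apply: le_lt_trans; rewrite mulrC ler_wpM2l ?ip_ge0//.
rewrite -real_normK ?num_real//; apply: (@le_trans _ _ (M ^+ 2)); last by rewrite lerDl.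
by apply: lerXn2r; rewrite ?nnegrE.
Qed.

Lemma ucv_CL2 c w : (forall n, {within `[0, T], continuous (c n)}) -> ucv c w -> CL2 l T w.
Proof.
move=> cc [Lw Hw]; apply: CL2_limit => // e /Hw[N0 /(_ N0 (leqnn _)) H].
exists (fun z => psum l (c^~ z.2) N0 z.1) => //.
apply: (CL2_sum N0 (F := fun n z => c n z.2 * sn l n z.1)) => n.
by apply: CL2_tensor => //; exact: L2_sn.
Qed.

Lemma ucv_bounded c w : (forall n, exists B : R, forall t, 0 <= t <= T -> `|c n t| <= B) -> ucv c w ->
  exists B : R, forall t, 0 <= t <= T -> ip (at_time w t) (at_time w t) <= B.
Proof.
move=> cB [Lw Hw]; have [N /(_ N (leqnn _)) H] := Hw 1 ltr01.
have [B HB] : exists B : R, forall t, 0 <= t <= T -> \sum_(n < N) c n t ^+ 2 <= B.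
  elim: N {H} => [|N [B IH]]; first by exists 0 => t _; rewrite big_ord0.
  have [C HC] := cB N; exists (B + C ^+ 2) => t tT; rewrite big_ord_recr/=.
  by apply: lerD; [exact: IH|rewrite -real_normK ?num_real// ler_pXn2r ?nnegrE ?HC// (le_trans _ (HC t tT))].
exists (2 * (1 + l / 2 * B)) => t tT.
have L1 : L2 (fun x => at_time w t x - psum l (c^~ t) N x).
  by exact: (L2B _ (Lw t tT) (L2_psum _ _ _)).
apply: (@le_trans _ _ (2 * (resid c w N t + ip (psum l (c^~ t) N) (psum l (c^~ t) N)))).
  apply: le_trans (ip_sqD_le _ L1 (L2_psum _ _ _)) => //.
  by rewrite le_eqVlt; apply/orP; left; apply/eqP; apply: eq_ip => x _; ring.
rewrite ler_pM2l//; apply: lerD; first exact/ltW/H.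
by rewrite ip_psum_psum// ler_wpM2l ?HB// divr_ge0// ltW.
Qed.

(** By orthogonality a block of the series between [N] and [M] has square norm [l / 2] times a block
    of the squared coefficients, small uniformly in [t] by the majorant. Convergence at each fixed
    [t] provides an [M], depending on [t], beyond which the remainder is small too. *)
Lemma ucv_orthogonal c w (g : nat -> R) : (forall t, 0 <= t <= T -> L2 (at_time w t)) ->
  (forall t, 0 <= t <= T -> forall e : R, 0 < e -> exists N0, forall N, (N0 <= N)%N -> resid c w N t < e) ->
  nneg_summable (fun n => g n ^+ 2) -> (forall n t, 0 <= t <= T -> `|c n t| <= g n) -> ucv c w.
Proof.
move=> Lw Hw sg cg; split=> // e e0.
have e1 : 0 < e / (2 * l) by rewrite divr_gt0// mulr_gt0.
have [N0 HN0] := nneg_summable_cauchy sg e1; exists N0 => N N0N t tT.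
have e5 : 0 < e / 5 by rewrite divr_gt0.
have [N1 HN1] := Hw t tT _ e5.
pose M := maxn N N1; have NM : (N <= M)%N by rewrite leq_maxl.
have h1 : resid c w M t < e / 5 by apply: HN1; rewrite leq_maxr.
have TT := ip_sq_triangle (Lw t tT) (L2_psum l (c^~ t) M) (L2_psum l (c^~ t) N).
apply: le_lt_trans TT _.
have h2 : ip (fun x => psum l (c^~ t) M x - psum l (c^~ t) N x) (fun x => psum l (c^~ t) M x - psum l (c^~ t) N x)
    <= e / 4.
  have E x : psum l (c^~ t) M x - psum l (c^~ t) N x =
      psum l (fun n => if (n < N)%N then 0 else c n t) M x by exact: psum_tail.
  have -> : ip (fun x => psum l (c^~ t) M x - psum l (c^~ t) N x) (fun x => psum l (c^~ t) M x - psum l (c^~ t) N x) =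
      ip (psum l (fun n => if (n < N)%N then 0 else c n t) M) (psum l (fun n => if (n < N)%N then 0 else c n t) M).
    by apply: eq_ip => x _; exact: E.
  rewrite ip_psum_psum//.
  have -> : e / 4 = l / 2 * (e / (2 * l)) by field; rewrite gt_eqF.
  rewrite ler_pM2l ?divr_gt0//; apply: le_trans (HN0 N M N0N NM).
  have -> : \sum_(n < M) (if (n < N)%N then 0 else c n t) ^+ 2 =
     \sum_(n < M) c n t ^+ 2 - \sum_(n < N) c n t ^+ 2.
    rewrite (big_ord_widen _ (fun n => c n t ^+ 2) NM) [X in _ - X]big_mkcond -sumrB.
    by apply: eq_bigr => n _; case: ifP; rewrite ?expr0n ?subrr ?subr0.
  apply: le_trans (ler_norm _) _; apply: (sum_diff_bound (a := fun n => c n t ^+ 2) (g := fun n => g n ^+ 2)) => // n.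
  by rewrite normrX; apply: lerXn2r; rewrite ?nnegrE ?cg// (le_trans _ (cg n t tT)).
by rewrite /resid in h1; move: e0 h1 h2; clear; lra.
Qed.

End UniformL2Limits.

(** * Sine series *)

Section SineSeries.
Variables (R : realType) (l : R).
Hypothesis hl : 0 < l.
Local Notation mu := (leb R).
Local Notation D := (`]0, l[%classic : set R).
Local Notation L2 := (L2 (leb R) (`]0, l[%classic : set R)).
Local Notation ip := (ip (leb R) (`]0, l[%classic : set R)).

Definition cpsum (a : nat -> R) N (x : R) : R := \sum_(n < N) a n * (freq l n * csn l n x).

Lemma is_derive_bigsum N (F f : nat -> R -> R) : (forall n (x : R), is_derive x 1 (F n) (f n x)) ->
  forall x : R, is_derive x 1 (fun y => \sum_(n < N) F n y) (\sum_(n < N) f n x).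
Proof.
move=> dF x; elim: N => [|N IH].
  rewrite big_ord0 (_ : (fun _ => _) = cst 0); first exact: is_derive_cst.
  by apply/funext => y; rewrite big_ord0.
rewrite big_ord_recr (_ : (fun _ => _) = fun y => \sum_(n < N) F n y + F N y).
  exact: is_derive_add.
by apply/funext => y; rewrite big_ord_recr.
Qed.

Lemma is_derive_psum a N (x : R) : is_derive x 1 (psum l a N) (cpsum a N x).
Proof.
apply: (is_derive_bigsum N (F := fun n y => a n * sn l n y)
  (f := fun n y => a n * (freq l n * csn l n y))) => n y.
by apply: is_derive_scale; exact: is_derive_sn.
Qed.

Lemma is_derive_cpsum a N (x : R) :
  is_derive x 1 (cpsum a N) (psum l (fun n => - (freq l n ^+ 2 * a n)) N x).
Proof.
apply: (is_derive_bigsum N (F := fun n y => a n * (freq l n * csn l n y))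
  (f := fun n y => - (freq l n ^+ 2 * a n) * sn l n y)) => n y.
have H := is_derive_scale (a n) (is_derive_scale (freq l n) (is_derive_csn l n y)).
by apply: is_derive_eq H _; ring.
Qed.

Lemma continuous_cpsum a N : continuous (cpsum a N).
Proof. exact: is_derive_continuous (is_derive_cpsum a N). Qed.

Lemma smooth_psum a N : smooth (psum l a N).
Proof.
apply: (smooth_sum N (F := fun n x => a n * sn l n x)) => n; apply: smoothM.
  exact: smooth_cst.
by have [] := smooth_sn_csn l n.
Qed.

(** Integration by parts holds for the C1 approximants, and both of its sides are continuous in
    L2. *)
Lemma weak_deriv_limit (g g' : R -> R) : L2 g -> L2 g' ->
  (forall e : R, 0 < e -> exists G G' : R -> R, [/\ forall x : R, is_derive x 1 G (G' x), continuous G',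
     ip (fun x => g x - G x) (fun x => g x - G x) < e
   & ip (fun x => g' x - G' x) (fun x => g' x - G' x) < e]) -> weak_deriv l g g'.
Proof.
move=> Lg Lg' H psi tp; have [Lp Lp'] := test_fun_L2 tp.
suff : ip g ('D_1 psi) + ip g' psi = 0 by move=> /eqP; rewrite addr_eq0 => /eqP.
apply/eqP; rewrite -normr_le0; apply/ler_addgt0Pl => e e0; rewrite addr0.
have e2 : 0 < e / 2 by rewrite divr_gt0.
pose a := ip psi psi + ip ('D_1 psi) ('D_1 psi).
have a0 : 0 <= a by rewrite addr_ge0 ?ip_ge0.
have a1 : 0 < a + 1 by rewrite ltr_wpDl.
have [G [G' [dG cG' h1 h2]]] := H _ (divr_gt0 (exprn_gt0 2 e2) a1).
have LG : L2 G by apply: continuous_L2; exact: is_derive_continuous dG.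
have LG' : L2 G' by exact: continuous_L2.
have L1 : L2 (fun x => g x - G x) by exact: (L2B _ Lg LG).
have L2' : L2 (fun x => g' x - G' x) by exact: (L2B _ Lg' LG').
have -> : ip g ('D_1 psi) + ip g' psi =
    ip ('D_1 psi) (fun x => g x - G x) + ip psi (fun x => g' x - G' x).
  rewrite !ipBr//.
  have E1 : ip ('D_1 psi) g = ip g ('D_1 psi) by exact: ipC.
  have E2 : ip ('D_1 psi) G = ip G ('D_1 psi) by exact: ipC.
  have E3 : ip psi g' = ip g' psi by exact: ipC.
  have E4 : ip psi G' = ip G' psi by exact: ipC.
  by rewrite E1 E2 E3 E4 (test_fun_parts hl tp dG cG'); ring.
rewrite [leRHS](splitr e); apply: le_trans (ler_normD _ _) _; apply: lerD.
  by apply: (@ip_small _ _ _ _ a) => //; rewrite /a lerDr ip_ge0.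
by apply: (@ip_small _ _ _ _ a) => //; rewrite /a lerDl ip_ge0.
Qed.

(** Partial sums are smooth and vanish at the ends, so [test_fun_approx] places them in the closure
    of the test functions. One [N] must serve [g] and [g1] together, and [g1] and [g2] together. *)
Lemma H2_H10_series (a : nat -> R) (g g1 g2 : R -> R) : L2 g -> L2 g1 -> L2 g2 ->
  (forall e : R, 0 < e -> exists N,
    [/\ ip (fun x => g x - psum l a N x) (fun x => g x - psum l a N x) < e,
        ip (fun x => g1 x - cpsum a N x) (fun x => g1 x - cpsum a N x) < e
      & ip (fun x => g2 x - psum l (fun n => - (freq l n ^+ 2 * a n)) N x)
           (fun x => g2 x - psum l (fun n => - (freq l n ^+ 2 * a n)) N x) < e]) ->
  H2 l g g1 g2 /\ H10 l g g1.
Proof.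
move=> Lg Lg1 Lg2 H.
have h1 : H1 l g g1.
  split; [exact/Lp_on_L2|exact/Lp_on_L2|apply: weak_deriv_limit => // e /H[N [? ? _]]].
  by exists (psum l a N), (cpsum a N); split=> //; [exact: is_derive_psum|exact: continuous_cpsum].
split.
  split=> //; split; [exact/Lp_on_L2|exact/Lp_on_L2|apply: weak_deriv_limit => // e /H[N [_ ? ?]]].
  exists (cpsum a N), (psum l (fun n => - (freq l n ^+ 2 * a n)) N).
  by split=> //; [exact: is_derive_cpsum|exact: continuous_psum].
apply/H10P; split=> // e e0; have e8 : 0 < e / 8 by rewrite divr_gt0.
have [N [q1 q2 _]] := H _ e8.
have s0 : psum l a N 0 = 0 by rewrite /psum big1// => n _; rewrite sn0 mulr0.
have sl : psum l a N l = 0 by rewrite /psum big1// => n _; rewrite snl// mulr0.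
have D1 : 'D_1 (psum l a N) = cpsum a N.
  by apply/funext => x; have dx := is_derive_psum a N x; exact: derive_val.
have [psi tp] := test_fun_approx hl (smooth_psum a N) s0 sl e8.
move=> q0.
have q3 : ip (fun x => psum l a N x - psi x) (fun x => psum l a N x - psi x) +
    ip (fun x => cpsum a N x - 'D_1 psi x) (fun x => cpsum a N x - 'D_1 psi x) < e / 8.
  by rewrite -D1; exact: q0.
exists psi => //; have [Lp Lp'] := test_fun_L2 tp.
have LC : L2 (cpsum a N) by apply: continuous_L2; exact: continuous_cpsum.
have t1 := ip_sq_triangle Lg (L2_psum l a N) Lp.
have t2 := ip_sq_triangle Lg1 LC Lp'.
by move: e0 q1 q2 q3 t1 t2; clear; lra.
Qed.

End SineSeries.

(** * Sums of sine series as functions of space and time *)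

Section SeriesFamilies.
Variables (R : realType) (l T : R).
Hypotheses (hl : 0 < l) (hT : 0 < T).
Local Notation mu := (leb R).
Local Notation D := (`]0, l[%classic : set R).
Local Notation L2 := (L2 (leb R) (`]0, l[%classic : set R)).
Local Notation ip := (ip (leb R) (`]0, l[%classic : set R)).

Definition sser (c : nat -> R -> R) (z : R * R) : R := ssum (fun n => c n z.2 * sn l n z.1).

Lemma measurable_partial_sum (F : nat -> R -> R) (a : nat -> R) N : (forall n, continuous (F n)) ->
  measurable_fun D (fun x => \sum_(n < N) a n * F n x).
Proof.
move=> cF; apply: continuous_measurable_oo => x; elim: N => [|N IH].
  rewrite (_ : (fun _ => _) = cst 0); first exact: cvg_cst.
  by apply/funext => y; rewrite big_ord0.
rewrite (_ : (fun _ => _) = fun y => \sum_(n < N) a n * F n y + a N * F N y).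
  by apply: cvgD IH _; apply: cvgM; [exact: cvg_cst|exact: cF].
by apply/funext => y; rewrite big_ord_recr.
Qed.

(** The Weierstrass test. [F] is left general to cover the sines and the cosines of the
    differentiated series. *)
Lemma uniform_series (F c : nat -> R -> R) (g : nat -> R) : (forall n, continuous (F n)) ->
  (forall n x, `|F n x| <= 1) -> nneg_summable g ->
  (forall n t, 0 <= t <= T -> `|c n t| <= g n) ->
  let w z := ssum (fun n => c n z.2 * F n z.1) in
  (forall t, 0 <= t <= T -> L2 (at_time w t)) /\
  forall e : R, 0 < e -> exists N0, forall N, (N0 <= N)%N -> forall t, 0 <= t <= T ->
    ip (fun x => at_time w t x - \sum_(n < N) c n t * F n x)
       (fun x => at_time w t x - \sum_(n < N) c n t * F n x) < e.
Proof.
move=> cF F1 sg cg w.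
have b n t x : 0 <= t <= T -> `|c n t * F n x| <= g n.
  by move=> /(cg n) h; rewrite normrM; apply: le_trans (ler_pM _ _ h (F1 n x)) _; rewrite ?mulr1.
have mw t : 0 <= t <= T -> measurable_fun D (at_time w t).
  move=> tT; apply: measurable_uniform_limit => // e e0; have [N H] := ssum_tail sg e0.
  exists (fun x => \sum_(n < N) c n t * F n x).
    exact: (measurable_partial_sum (fun n => c n t) N cF).
  by move=> x _; apply: H => // n; exact: b.
have [_ [B HB]] := sg.
split.
  move=> t tT; apply: (@L2_bounded _ _ _ _ _ _ _ B) => //; [exact: leb_oo_fin|exact: mw|].
  by move=> x _; apply: (ssum_bound sg) => // n; exact: b.
move=> e e0; have e'0 : 0 < Num.min 1 (e / (2 * l)) by rewrite lt_min ltr01 divr_gt0// mulr_gt0.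
set e' := Num.min _ _ in e'0.
have [N0 H] := ssum_tail sg e'0; exists N0 => N N0N t tT.
apply: (@le_lt_trans _ _ (e' ^+ 2 * l)).
  apply: ip_sup_bound => //; last 1 first.
  - by move=> x _; apply: H => // n; exact: b.
  - by apply: measurable_funB; [exact: mw|exact: (measurable_partial_sum (fun n => c n t) N cF)].
  - exact: ltW.
have e'1 : e' ^+ 2 <= e' by rewrite expr2 ler_piMr ?(ltW e'0)// /e' ge_min lexx.
apply: (@le_lt_trans _ _ (e' * l)); first by rewrite ler_pM2r.
rewrite -ltr_pdivlMr// /e' gt_min; apply/orP; right.
by rewrite ltr_pM2l// ltf_pV2 ?posrE ?mulr_gt0// ltr_pMl// ltr1n.
Qed.

Lemma ucv_sser (c : nat -> R -> R) (g : nat -> R) : nneg_summable g ->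
  (forall n t, 0 <= t <= T -> `|c n t| <= g n) -> ucv l T c (sser c).
Proof.
move=> sg cg.
exact: (uniform_series (@continuous_sn _ l) (@sn_bound _ l) sg cg).
Qed.

(** The majorant may depend on [t], so the partial sums are only known to converge pointwise on the
    rectangle. [clamp] extends each coefficient continuously to the line, which makes the partial
    sums measurable. *)
Lemma measurable_sser (c : nat -> R -> R) : (forall n, {within `[0, T], continuous (c n)}) ->
  (forall t, 0 < t < T -> exists2 g, nneg_summable g & forall n, `|c n t| <= g n) ->
  measurable_fun (rect l T) (sser c).
Proof.
move=> cc H.
have mr := rect_measurable l T.
apply: (measurable_fun_cvg (h := fun N z => psum l (c^~ z.2) N z.1)) => //.
  move=> N; apply: (@eq_measurable_fun _ _ _ _ _
      (fun z : R * R => \sum_(n < N) (c n \o clamp 0 T) z.2 * sn l n z.1)).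
    move=> [x t] /set_mem[/= _]; rewrite in_itv/= => /andP[t0 tT].
    by apply: eq_bigr => n _; rewrite clamp_id// !ltW.
  elim: N => [|N IH].
    rewrite (_ : (fun _ => _) = cst 0); first exact: measurable_cst.
    by apply/funext => y; rewrite big_ord0.
  rewrite (_ : (fun _ => _) = fun z => \sum_(n < N) (c n \o clamp 0 T) z.2 * sn l n z.1 +
      sn l N z.1 * (c N \o clamp 0 T) z.2).
    apply: measurable_funD => //; apply: (measurable_funS (E := setT)) => //.
    apply: measurable_tensor; first exact: continuous_sn.
    by apply: clamp_continuous; [exact: ltW|exact: cc].
  by apply/funext => y; rewrite big_ord_recr/= [X in _ + X]mulrC.
move=> [x t] [/= _]; rewrite in_itv/= => tT; have [g sg cg] := H t tT.
apply/cvgrPdist_le => e e0; have [N0 H0] := ssum_tail sg e0.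
exists N0 => // N /= N0N; apply: H0 => // n.
by rewrite normrM; apply: le_trans (ler_pM _ _ (cg n) (sn_bound _ _ _)) _; rewrite ?mulr1.
Qed.

(** * Series whose coefficients times the eigenvalues are square summable *)

Section EnergyBounds.
Variables (c : nat -> R -> R) (b : nat -> R) (A0 : R -> R).
Hypothesis cc : forall n, {within `[0, T], continuous (c n)}.
Hypothesis cb : forall n t, 0 <= t <= T -> freq l n ^+ 2 * `|c n t| <= b n.
Hypothesis sb : nneg_summable (fun n => b n ^+ 2).
Hypothesis cpos : forall t, 0 < t <= T ->
  exists2 g, nneg_summable g & forall n, freq l n ^+ 2 * `|c n t| <= g n.
Hypotheses (LA : L2 A0) (dA : sine_dense l A0).
Hypothesis c0 : forall n, coef l A0 n = - (freq l n ^+ 2 * c n 0).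

Definition sser_x (z : R * R) : R := ssum (fun n => c n z.2 * freq l n * csn l n z.1).

(* At [t = 0] the twice differentiated series need not converge pointwise. *)
Definition sser_xx (z : R * R) : R :=
  if z.2 == 0 then A0 z.1 else sser (fun n t => - (freq l n ^+ 2 * c n t)) z.

Lemma freq_le n : freq l 0 <= freq l n.
Proof. by rewrite /freq ler_pM2r ?invr_gt0// ler_pM2r ?pi_gt0// ler_nat. Qed.

(** [|c_n| freq <= b_n / freq], which is at most half of [b_n^2 + 1 / freq^2], a sum of two summable
    sequences. *)
Lemma freq_coef_summable : exists2 g, nneg_summable g &
  forall n t, 0 <= t <= T -> `|c n t * freq l n| <= g n.
Proof.
exists (fun n => 2^-1 * (b n ^+ 2 + (freq l n ^+ 2)^-1)).
  by apply: nneg_summableZ; rewrite ?invr_ge0//; apply: nneg_summableD => //; exact: inv_freq_sq_summable.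
move=> n t tT; have k0 := freq_gt0 hl n; have := cb n tT.
rewrite normrM (gtr0_norm k0) => h.
have -> : `|c n t| * freq l n = freq l n ^+ 2 * `|c n t| * (freq l n)^-1 by field; rewrite gt_eqF.
have k1 : 0 <= (freq l n)^-1 by rewrite invr_ge0 ltW.
apply: le_trans (ler_wpM2r k1 h) _.
rewrite -exprVn; have := sqr_ge0 (b n - (freq l n)^-1); rewrite sqrrB.
by move: (b n) (freq l n)^-1 => x y; lra.
Qed.

Lemma coef_summable : exists2 g, nneg_summable g & forall n t, 0 <= t <= T -> `|c n t| <= g n.
Proof.
have [g sg H] := freq_coef_summable; have k0 := freq_gt0 hl 0.
exists (fun n => (freq l 0)^-1 * g n); first by apply: nneg_summableZ => //; rewrite invr_ge0 ltW.
move=> n t tT; rewrite mulrC ler_pdivlMr//; apply: le_trans (H n t tT).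
by rewrite normrM (gtr0_norm (freq_gt0 hl n)) ler_wpM2l// freq_le.
Qed.

(** No summable majorant is uniform in time here. At each time convergence is known, by [parseval]
    for [A0] when [t = 0] and by absolute convergence when [t > 0]; [ucv_orthogonal] then makes it
    uniform through the square summable [b]. *)
Lemma ucv_sser_xx : ucv l T (fun n t => - (freq l n ^+ 2 * c n t)) sser_xx.
Proof.
have Hpt t : 0 <= t <= T -> L2 (at_time sser_xx t) /\ forall e : R, 0 < e -> exists N0, forall N,
    (N0 <= N)%N -> resid l (fun n t => - (freq l n ^+ 2 * c n t)) sser_xx N t < e.
  move=> /andP[]; rewrite le_eqVlt => /predU1P[<- _|t0 tT].
    have E : at_time sser_xx 0 = A0 by apply/funext => x; rewrite /at_time /sser_xx eqxx.
    rewrite E; split=> // e e0; have [N0 H] := parseval hl LA dA e0; exists N0 => N /H.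
    rewrite /resid E (_ : (fun n => - _) = coef l A0)//.
    by apply/funext => n; rewrite c0.
  have [g sg cg] := cpos (introT andP (conj t0 tT)).
  have cg' n (s : R) : 0 <= s <= T -> `|- (freq l n ^+ 2 * c n t)| <= g n.
    by move=> _; rewrite normrN normrM ger0_norm ?sqr_ge0.
  (* The time is frozen: with coefficients constant in time, the uniform statement can be read at
     time 0. *)
  have [] := ucv_sser (c := fun n _ => - (freq l n ^+ 2 * c n t)) sg cg'.
  have T0 : 0 <= (0 : R) <= T by rewrite lexx ltW.
  move=> /(_ 0 T0) L /= H.
  have E : at_time sser_xx t = at_time (sser (fun n _ => - (freq l n ^+ 2 * c n t))) 0.
    by apply/funext => x; rewrite /at_time /sser_xx /= gt_eqF.
  rewrite /resid E; split=> // e /H[N0 HN0]; exists N0 => N /HN0/(_ 0 T0).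
  exact.
apply: (ucv_orthogonal hl _ _ sb) => //.
- by move=> t /Hpt[].
- by move=> t /Hpt[].
- by move=> n t tT; rewrite normrN normrM ger0_norm ?sqr_ge0// cb.
Qed.

Lemma ucv_sser_coef : ucv l T c (sser c).
Proof. by have [g sg H] := coef_summable; exact: ucv_sser sg H. Qed.

Lemma series_C_H2_H10 : C_H2_H10 l T (sser c) sser_x sser_xx.
Proof.
have [g sg Hg] := freq_coef_summable.
have [Lx Hx] := uniform_series (c := fun n t => c n t * freq l n) (@continuous_csn _ l) (@csn_bound _ l) sg Hg.
have [L0 H0] := ucv_sser_coef; have [Lxx Hxx] := ucv_sser_xx.
apply/C_H2_H10P; split.
  move=> t tT; apply: (H2_H10_series hl (a := c^~ t)); [exact: L0|exact: Lx|exact: Lxx|].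
  move=> e e0; have [N0 q0] := H0 _ e0; have [N1 q1] := Hx _ e0; have [N2 q2] := Hxx _ e0.
  exists (maxn N0 (maxn N1 N2)); split.
  - by apply: q0 => //; rewrite leq_maxl.
  - have := q1 (maxn N0 (maxn N1 N2)) _ t tT; rewrite leq_max leq_maxl orbT => /(_ isT).
    congr (_ < _); apply: eq_ip => x _; congr (_ - _); apply: eq_bigr => n _; ring.
  - by apply: q2 => //; rewrite leq_max [X in _ || X]leq_max leqnn !orbT.
split.
- exact: ucv_CL2 ucv_sser_coef.
- apply: CL2_limit => // e /Hx[N0 /(_ N0 (leqnn _)) H].
  exists (fun z => \sum_(n < N0) c n z.2 * (freq l n * csn l n z.1)).
    apply: (CL2_sum N0 (F := fun n z => c n z.2 * (freq l n * csn l n z.1))) => n.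
    apply: (CL2_tensor (g := fun x => freq l n * csn l n x)) => //.
    exact: (L2Z _ (freq l n) (L2_csn l n)).
  move=> t tT; have := H t tT; congr (_ < _); apply: eq_ip => x _; congr (_ - _).
    by apply: eq_bigr => n _; rewrite /=; ring.
  by apply: eq_bigr => n _; rewrite /=; ring.
- apply: ucv_CL2 ucv_sser_xx => // n x.
  by apply: cvgN; apply: cvgM; [exact: cvg_cst|exact: cc].
Qed.

Lemma measurable_sser_coef : measurable_fun (rect l T) (sser c).
Proof.
have [g sg H] := coef_summable; apply: measurable_sser => // t /andP[t0 tT].
by exists g => // n; apply: H; rewrite !ltW.
Qed.

Lemma measurable_sser_xx : measurable_fun (rect l T) sser_xx.
Proof.
apply: (@eq_measurable_fun _ _ _ _ _ (sser (fun n t => - (freq l n ^+ 2 * c n t)))).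
  by move=> [x t] /set_mem[/= _]; rewrite in_itv/= => /andP[t0 _]; rewrite /sser_xx /= gt_eqF.
apply: measurable_sser.
  by move=> n x; apply: cvgN; apply: cvgM; [exact: cvg_cst|exact: cc].
move=> t /andP[t0 tT]; have [|g sg H] := cpos (t := t); first by rewrite t0 ltW.
by exists g => // n; rewrite normrN normrM ger0_norm ?sqr_ge0.
Qed.

End EnergyBounds.

End SeriesFamilies.

(** * The time derivative *)

Section TimeDerivative.
Variables (R : realType) (l T : R).
Hypotheses (hl : 0 < l) (hT : 0 < T).
Local Notation mu := (leb R).
Local Notation D := (`]0, l[%classic : set R).
Local Notation L2 := (L2 (leb R) (`]0, l[%classic : set R)).
Local Notation ip := (ip (leb R) (`]0, l[%classic : set R)).
Local Notation dt G := ('D_((0, 1) : R * R) G).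

Lemma slice_is_derive (G : R * R -> R) (x t : R) : derivable G (x, t) ((0, 1) : R * R) ->
  is_derive t 1 (fun s => G (x, s)) (dt G (x, t)).
Proof.
have E : (fun h : R => h^-1 *: (G (h *: ((0, 1) : R * R) + (x, t)) - G (x, t))) =
    (fun h : R => h^-1 *: (G (x, h *: (1 : R) + t) - G (x, t))).
  apply/funext => h; congr (_ *: (G _ - _)).
  by apply: injective_projections => //=; rewrite scaler0 add0r.
move=> dG; split.
  by move: dG; rewrite /derivable E.
by rewrite /derive E.
Qed.

Lemma continuous_bounded_rect (G : R * R -> R) : continuous G ->
  exists2 L : R, 0 <= L & forall x t, 0 <= x <= l -> 0 <= t <= T -> `|G (x, t)| <= L.
Proof.
move=> cG; have cK : compact (closed_rect l T) by apply: compact_setX; exact: segment_compact.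
have := compact_bounded (continuous_compact (continuous_subspaceT cG) cK).
move=> /ex_strict_bound_gt0[L L0 HL]; exists L; first exact: ltW.
by move=> x t xl tT; apply/ltW/HL; exists (x, t).
Qed.

Lemma test_fun_rect_out (Phi : R * R -> R) x t : test_fun (rect l T) Phi -> ~ (0 < t < T) -> Phi (x, t) = 0.
Proof. by move=> [_ [K [_ KD H]]] tT; apply: H => /KD[/= _]; rewrite in_itv. Qed.

Lemma test_fun_rect_derivatives (Phi : R * R -> R) : test_fun (rect l T) Phi ->
  [/\ continuous Phi, continuous (dt Phi), continuous (dt (dt Phi)),
      forall x t : R, is_derive t 1 (fun s => Phi (x, s)) (dt Phi (x, t))
    & forall x t : R, is_derive t 1 (fun s => dt Phi (x, s)) (dt (dt Phi) (x, t))].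
Proof.
move=> [sP _]; have [cP HP] := sP 2; have [dP [cP' HP']] := HP ((0, 1) : R * R).
have [dP' [cP'' _]] := HP' ((0, 1) : R * R).
split; [exact: cP|exact: cP'|exact: cP''|move=> x t|move=> x t].
  exact: slice_is_derive (dP (x, t)).
exact: slice_is_derive (dP' (x, t)).
Qed.

Lemma continuous_slice (G : R * R -> R) : continuous G ->
  (forall t, continuous (at_time G t)) /\ (forall x, continuous (fun t => G (x, t))).
Proof.
move=> cG; split=> y z; apply/cvgrPdist_le => e e0.
  have /cvgrPdist_le/(_ e e0)/nbhs_ballP[d /= d0 sub] := cG (z, y).
  by apply/nbhs_ballP; exists d => // x zx; apply: (sub (x, y)); split=> //=; exact: ballxx.
have /cvgrPdist_le/(_ e e0)/nbhs_ballP[d /= d0 sub] := cG (y, z).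
by apply/nbhs_ballP; exists d => // x zx; apply: (sub (y, x)); split=> //=; exact: ballxx.
Qed.

(** The bound [L] on the second time derivative makes [Phit] Lipschitz in time, uniformly in [x].
    The two errors are then at most [L l (t - s)^2] each, and [LI_criterion] takes the place of
    differentiation under the integral. *)
Lemma pairing_LI (Phi Phit Phitt : R * R -> R) n :
  continuous Phi -> continuous Phit -> continuous Phitt ->
  (forall x t : R, is_derive t 1 (fun s => Phi (x, s)) (Phit (x, t))) ->
  (forall x t : R, is_derive t 1 (fun s => Phit (x, s)) (Phitt (x, t))) ->
  LI T (fun t => ip (at_time Phi t) (sn l n)) (fun t => ip (at_time Phit t) (sn l n)).
Proof.
move=> cP cP' cP'' dP dP'.
have [L L0 HL] := continuous_bounded_rect cP''.
have [CP CP'] : CL2 l T Phi /\ CL2 l T Phit.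
  by split; apply: continuous_CL2 => //; exact: continuous_subspaceT.
have Lsn := L2_sn l n.
have cQ := CL2_continuous CP' Lsn.
have [B _ HB] := within_continuous_bounded cQ.
have mQ := within_measurable_oo cQ.
have lip (x s r : R) : 0 < x < l -> 0 <= s -> s <= r -> r <= T -> `|Phit (x, r) - Phit (x, s)| <= L * (r - s).
  move=> /andP[x0 xl] s0 sr rT; rewrite -(ftc sr (dP' x) ((continuous_slice cP'').2 x)).
  apply: Rint_oo_bound => //.
    by apply: continuous_measurable_oo; exact: (continuous_slice cP'').2.
  by move=> y /andP[sy yr]; apply: HL; rewrite ?(ltW x0) ?(ltW xl)// (le_trans s0 (ltW sy)) (le_trans (ltW yr)).
have pair (G : R -> R) (K : R) : measurable_fun D G -> 0 <= K -> (forall x, 0 < x < l -> `|G x| <= K) -> `|ip G (sn l n)| <= K * l.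
  move=> mG K0 GK; rewrite -[l in leRHS]subr0; apply: Rint_oo_bound; first exact: ltW.
    by apply: measurable_funM => //; apply: continuous_measurable_oo; exact: continuous_sn.
  move=> x /GK h; rewrite normrM.
  by apply: le_trans (ler_pM _ _ h (sn_bound _ _ _)) _; rewrite ?mulr1.
have mG (G : R * R -> R) : continuous G -> forall t : R, measurable_fun D (at_time G t).
  by move=> cG t; apply: continuous_measurable_oo; exact: (continuous_slice cG).1.
have [[LP _] [LP' _]] := (CP, CP').
apply: (LI_criterion (C := 2 * (L * l))) => //.
  by exists B => t /andP[t0 tT]; apply: HB; rewrite !ltW.
move=> s t s0 st tT; have sT : 0 <= s <= T by rewrite s0 (le_trans st).
have tT' : 0 <= t <= T by rewrite tT (le_trans s0).
have iQ : mu.-integrable `]s, t[ (EFin \o (fun r => ip (at_time Phit r) (sn l n))).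
  apply: (bounded_integrable_oo (M := B)); first exact: (measurable_oo_sub s0 tT).
  by move=> y /andP[sy yt]; apply: HB; rewrite (le_trans s0 (ltW sy)) (le_trans (ltW yt)).
have -> : ip (at_time Phi t) (sn l n) - ip (at_time Phi s) (sn l n) -
     \int[mu]_(x in `]s, t[) ip (at_time Phit x) (sn l n) =
   ip (fun x => at_time Phi t x - at_time Phi s x - (t - s) * at_time Phit s x) (sn l n) -
   \int[mu]_(r in `]s, t[) (ip (at_time Phit r) (sn l n) - ip (at_time Phit s) (sn l n)).
  have La : L2 (fun x => at_time Phi t x - at_time Phi s x) by exact: (L2B _ (LP t tT') (LP s sT)).
  have Lb : L2 (fun x => (t - s) * at_time Phit s x) by exact: (L2Z _ (t - s) (LP' s sT)).
  rewrite (ipBl _ La Lb Lsn)// (ipBl _ (LP t tT') (LP s sT) Lsn)// (ipZl _ (t - s) (LP' s sT) Lsn)//.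
  have ic : mu.-integrable `]s, t[ (EFin \o (fun=> ip (at_time Phit s) (sn l n))).
    by apply: continuous_integrable_oo; exact: cst_continuous.
  rewrite RintegralB; [|by []|exact: iQ|exact: ic].
  by rewrite Rint_oo_cst//; ring.
rewrite [leRHS](_ : _ = L * (t - s) ^+ 2 * l + (L * l * (t - s)) * (t - s)); last by ring.
apply: le_trans (ler_normB _ _) _; apply: lerD.
  have ts0 : 0 <= t - s by rewrite subr_ge0.
  apply: pair.
  - apply: measurable_funB; first by apply: measurable_funB; exact: mG.
    by apply: measurable_funM; [exact: measurable_cst|exact: mG].
  - by rewrite mulr_ge0// sqr_ge0.
  - move=> x xl; rewrite /at_time -(ftc st (dP x) ((continuous_slice cP').2 x)).
    have cx := (continuous_slice cP').2 x.
    rewrite [_ * Phit (x, s)]mulrC -Rint_oo_cst// -RintegralB//; last 2 first.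
    + exact: continuous_integrable_oo.
    + by apply: continuous_integrable_oo; exact: cst_continuous.
    rewrite expr2 mulrA; apply: Rint_oo_bound => //.
      by apply: measurable_funB; [exact: continuous_measurable_oo|exact: measurable_cst].
    move=> r /andP[sr rt]; apply: le_trans (lip x s r xl s0 (ltW sr) (le_trans (ltW rt) tT)) _.
    by rewrite ler_wpM2l// lerD2r ltW.
apply: Rint_oo_bound => //.
  by apply: measurable_funB; [exact: (measurable_oo_sub s0 tT)|exact: measurable_cst].
move=> r /andP[sr rt]; have rT : 0 <= r <= T by rewrite (le_trans s0 (ltW sr)) (le_trans (ltW rt)).
rewrite -(ipBl _ (LP' r rT) (LP' s sT) Lsn)// mulrAC; apply: pair.
- by apply: measurable_funB; exact: mG.
- by rewrite mulr_ge0// subr_ge0.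
- move=> x xl; rewrite /at_time; apply: le_trans (lip x s r xl s0 (ltW sr) (le_trans (ltW rt) tT)) _.
  by rewrite ler_wpM2l// lerD2r ltW.
Qed.

Lemma test_mode_LI (Phi : R * R -> R) n : test_fun (rect l T) Phi ->
  LI T (fun t => ip (at_time Phi t) (sn l n)) (fun t => ip (at_time (dt Phi) t) (sn l n)).
Proof.
move=> /test_fun_rect_derivatives[cP cP' cP'' dP dP'].
exact: pairing_LI cP cP' cP'' dP dP'.
Qed.

Lemma ucv_pairing (c : nat -> R -> R) (w Psi : R * R -> R) : ucv l T c w -> continuous Psi ->
  forall e : R, 0 < e -> exists N0, forall N, (N0 <= N)%N -> forall t, 0 <= t <= T ->
    `|ip (at_time w t) (at_time Psi t) - \sum_(n < N) c n t * ip (at_time Psi t) (sn l n)| <= e.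
Proof.
move=> [Lw Hw] cP e e0.
have CP : CL2 l T Psi by apply: continuous_CL2 => //; exact: continuous_subspaceT.
have [B B0 HB] := CL2_bounded CP; have [LP _] := CP.
have B1 : 0 < B + 1 by rewrite ltr_wpDl.
have [N0 H] := Hw _ (divr_gt0 (exprn_gt0 2 e0) B1); exists N0 => N NN t tT.
have Ls := L2_psum l (c^~ t) N.
have -> : \sum_(n < N) c n t * ip (at_time Psi t) (sn l n) = ip (psum l (c^~ t) N) (at_time Psi t).
  rewrite ip_psum//; last exact: LP.
  by apply: eq_bigr => n _; congr (_ * _); exact: ipC.
rewrite -(ipBl _ (Lw t tT) Ls (LP t tT))//.
have -> : ip (fun x => at_time w t x - psum l (c^~ t) N x) (at_time Psi t) =
  ip (at_time Psi t) (fun x => at_time w t x - psum l (c^~ t) N x) by exact: ipC.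
apply: (ip_small (LP t tT) _ B0 e0 (HB t tT) (H N NN t tT)).
exact: (L2B _ (Lw t tT) Ls).
Qed.

Lemma pairing_continuous (Psi : R * R -> R) n : continuous Psi ->
  {within `[0, T], continuous (fun t => ip (at_time Psi t) (sn l n))}.
Proof.
move=> cP; apply: CL2_continuous; last exact: L2_sn.
by apply: continuous_CL2 => //; exact: continuous_subspaceT.
Qed.

(** The pairing is a uniform limit of finite sums, which gives its measurability in time without
    joint measurability of [w]; Cauchy-Schwarz bounds it. *)
Lemma ucv_pairing_integrable (c : nat -> R -> R) (w Psi : R * R -> R) : ucv l T c w -> continuous Psi ->
  (forall n, measurable_fun `]0, T[ (c n)) ->
  (forall n, exists B : R, forall t, 0 <= t <= T -> `|c n t| <= B) ->
  mu.-integrable `]0, T[ (EFin \o (fun t => ip (at_time w t) (at_time Psi t))).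
Proof.
move=> uw cP mc cB; have CP : CL2 l T Psi by apply: continuous_CL2 => //; exact: continuous_subspaceT.
have [B B0 HB] := CL2_bounded CP; have [LP _] := CP; have [Lw _] := uw.
have [C HC] := ucv_bounded hl cB uw.
apply: (bounded_integrable_oo (M := Num.sqrt (C * B))).
  apply: measurable_uniform_limit => // e e0; have [N H] := ucv_pairing uw cP e0.
  exists (fun t => \sum_(n < N) c n t * ip (at_time Psi t) (sn l n)).
    elim: N {H} => [|N IH].
      rewrite (_ : (fun _ => _) = cst 0); first exact: measurable_cst.
      by apply/funext => y; rewrite big_ord0.
    rewrite (_ : (fun _ => _) = fun t => \sum_(n < N) c n t * ip (at_time Psi t) (sn l n) +
        c N t * ip (at_time Psi t) (sn l N)).
      apply: measurable_funD => //; apply: measurable_funM => //.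
      by apply: within_measurable_oo; exact: pairing_continuous.
    by apply/funext => y; rewrite big_ord_recr.
  by move=> t /=; rewrite in_itv/= => /andP[t0 tT]; apply: H => //; rewrite !ltW.
move=> t /andP[t0 tT]; have tT' : 0 <= t <= T by rewrite !ltW.
by apply: ip_le_norm; [exact: measurable_itv|exact: Lw|exact: LP|exact: HC|exact: HB].
Qed.

(* The products c_n(t) * <Phi(t), sn_n> vanish at 0 and T, so their derivatives
   have integral zero; sum over n. *)
Lemma series_weak_dt (c h : nat -> R -> R) (u w : R * R -> R) : (forall n, LI T (c n) (h n)) ->
  (forall n, exists B : R, forall t, 0 <= t <= T -> `|h n t| <= B) ->
  ucv l T c u -> ucv l T h w -> weak_dt l T u w.
Proof.
move=> Lc hB cu hw Phi tP; have [cP cP' cP'' dP dP'] := test_fun_rect_derivatives tP.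
pose A t := ip (at_time u t) (at_time (dt Phi) t); pose B t := ip (at_time w t) (at_time Phi t).
suff : \int[mu]_(t in `]0, T[) A t + \int[mu]_(t in `]0, T[) B t = 0.
  by move=> /eqP; rewrite addr_eq0 => /eqP.
have iA : mu.-integrable `]0, T[ (EFin \o A).
  apply: (ucv_pairing_integrable cu cP') => n; first exact: LI_measurable (Lc n).
  by have [Bn _ HBn] := LI_bounded (Lc n); exists Bn.
have iB : mu.-integrable `]0, T[ (EFin \o B).
  by apply: (ucv_pairing_integrable hw cP) => // n; have [] := Lc n.
apply/eqP; rewrite -normr_le0; apply/ler_addgt0Pl => e e0; rewrite addr0.
have e2 : 0 < e / (2 * T) by rewrite divr_gt0// mulr_gt0.
have [N1 H1] := ucv_pairing cu cP' e2; have [N2 H2] := ucv_pairing hw cP e2.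
pose N := maxn N1 N2.
pose P n t := ip (at_time Phi t) (sn l n); pose Q n t := ip (at_time (dt Phi) t) (sn l n).
have LS M : LI T (fun t => \sum_(n < M) c n t * P n t) (fun t => \sum_(n < M) (h n t * P n t + c n t * Q n t)).
  elim: M => [|M IH].
    have := LI_derive T (fun x : R => is_derive_cst (0 : R) x 1) (@cst_continuous _ _ 0).
    by apply: LI_eq => t _; rewrite big_ord0.
  have LP := LI_mul (Lc M) (test_mode_LI M tP).
  by apply: LI_eq (LI_add IH LP) => t _; rewrite big_ord_recr.
have [mS _ HS] := LS N.
have P0 n t : ~ (0 < t < T) -> P n t = 0.
  move=> tT; rewrite /P /ip; apply: Rint_oo_zero => x _.
  by rewrite /at_time (test_fun_rect_out _ tP tT) mul0r.
have := HS 0 T (lexx 0) (ltW hT) (lexx T).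
rewrite !big1; last 2 first.
- by move=> n _; rewrite P0 ?mulr0// ltxx.
- by move=> n _; rewrite P0 ?mulr0// ltxx andbF.
rewrite subr0 => S0.
have iS := LI_integrable (LS N) (lexx 0) (lexx T).
(* The subtracted finite sum has integral zero; what remains is two errors of size [e / (2 T)] on an
   interval of length [T]. *)
have -> : \int[mu]_(t in `]0, T[) A t + \int[mu]_(t in `]0, T[) B t =
   \int[mu]_(t in `]0, T[) ((A t + B t) - \sum_(n < N) (h n t * P n t + c n t * Q n t)).
  rewrite RintegralB//; last exact: integrable_add.
  by rewrite -S0 subr0 RintegralD.
have -> : e = (e / (2 * T) + e / (2 * T)) * (T - 0) by field; rewrite gt_eqF.
have mAB : measurable_fun `]0, T[ (fun t => A t + B t).
  have /measurable_int/measurable_EFinP mA := iA; have /measurable_int/measurable_EFinP mB := iB.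
  exact: measurable_funD.
apply: Rint_oo_bound; first exact: ltW.
  exact: measurable_funB.
move=> t /andP[t0 tT]; have tT' : 0 <= t <= T by rewrite !ltW.
rewrite (_ : _ - _ = (A t - \sum_(n < N) c n t * Q n t) + (B t - \sum_(n < N) h n t * P n t)).
  apply: le_trans (ler_normD _ _) _; apply: lerD.
    by apply: H1 => //; rewrite leq_maxl.
  by apply: H2 => //; rewrite leq_maxr.
by rewrite big_split/=; ring.
Qed.

(** Tonelli's theorem, integrating in [x] first: the bound on the slices gives at most [B * T]. *)
Lemma Lp_on_rect (w : R * R -> R) (B : R) : measurable_fun (rect l T) w ->
  (forall t, 0 < t < T -> L2 (at_time w t) /\ ip (at_time w t) (at_time w t) <= B) ->
  Lp_on (leb R \x leb R)%E 2%:E (rect l T) w.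
Proof.
move=> mw H; have mr := rect_measurable l T; apply/Lp_on_L2; [exact: mr|split=> //].
have mww : measurable_fun (rect l T) (EFin \o (fun z => w z * w z)).
  by apply/measurable_EFinP; exact: measurable_funM.
apply/integrableP; split=> //.
pose F := (fun z => `|(w z * w z)%:E|%E) \_ (rect l T).
have mF : measurable_fun setT F.
  by apply/(measurable_restrictT _ mr); exact: measurableT_comp.
have F0 z : (0 <= F z)%E by rewrite /F patchE; case: ifP.
have E : (\int[leb R \x leb R]_(z in rect l T) `|(w z * w z)%:E| = \int[mu]_t fubini_G mu F t)%E.
  transitivity (\int[leb R \x leb R]_z F z)%E; first exact: integral_mkcond.
  have := (fubini_tonelli2 (m1 := leb R) (m2 := leb R) F mF F0).
  exact.
rewrite [ltLHS]E.
apply: (@le_lt_trans _ _ (\int[mu]_(t in `]0%R, T[) B%:E)%E); last first.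
  rewrite integral_cst// [X in (_ * X)%E](_ : _ = (T - 0)%:E); last exact: leb_oo (ltW hT).
  by rewrite -EFinM ltry.
rewrite [leRHS]integral_mkcond; apply: ge0_le_integral => //.
- by move=> t _; exact: integral_ge0.
- exact: measurable_fun_fubini_tonelli_G.
- by apply/(measurable_restrictT _ (measurable_itv _)); exact: measurable_cst.
move=> t _; rewrite patchE; case: ifPn => [/set_mem/=|/negP tT].
  rewrite in_itv/= => tT; have [Lt Bt] := H t tT.
  have -> : fubini_G mu F t = (ip (at_time w t) (at_time w t))%:E; last by rewrite lee_fin.
  have [_ it] := Lt.
  rewrite /ip /Rintegral fineK; last exact: integrable_fin_num.
  rewrite /fubini_G [RHS]integral_mkcond; apply: eq_integral => x _; rewrite /F !patchE.
  have -> : ((x, t) \in rect l T) = (x \in D).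
    by apply/idP/idP => /set_mem h; apply/mem_set; [case: h|split => //=; rewrite in_itv].
  by case: ifP => // _; rewrite /at_time gee0_abs// lee_fin -expr2 sqr_ge0.
rewrite /fubini_G integral0_eq// => x _; rewrite /F patchE; case: ifP => // /set_mem[/= _ h].
by case: tT; apply/mem_set.
Qed.

End TimeDerivative.

(** * The equation for the coefficients *)

Section ForcedModes.
Variables (R : realType) (l T : R).
Hypotheses (hl : 0 < l) (hT : 0 < T).
Local Notation mu := (leb R).

Lemma LI_integral (h : R -> R) (M : R) : measurable_fun `]0, T[ h ->
  (forall t, 0 < t < T -> `|h t| <= M) -> LI T (fun t => \int[mu]_(x in `]0, t[) h x) h.
Proof. by move=> mh Hh; apply: LI_eq (LI_primitive 0 mh Hh) => // t _; rewrite add0r. Qed.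

(** Comparison with the primitive of [K exp (k s)]. The factor [1 / k] gained here is the smoothing
    of the forcing in time; the spatial regularity of [f] supplies a second one. *)
Lemma exp_integral_bound (k K t : R) (h : R -> R) : 0 < k -> 0 <= K -> 0 <= t -> measurable_fun `]0, t[ h ->
  (forall s, 0 < s < t -> `|h s| <= K * expR (k * s)) ->
  `|\int[mu]_(s in `]0, t[) h s| <= K * expR (k * t) / k.
Proof.
move=> k0 K0 t0 mh Hh.
have cE : continuous (fun s : R => K * expR (k * s)).
  move=> s; apply: cvgM; first exact: cvg_cst.
  apply: (continuous_comp (f := fun s : R => k * s)); last exact: continuous_expR.
  by apply: cvgM; [exact: cvg_cst|exact: cvg_id].
have dE (s : R) : is_derive s 1 (fun s : R => K / k * expR (k * s)) (K * expR (k * s)).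
  have := is_derive1_comp (is_derive_expR _) (is_derive_affine k 0 s).
  rewrite (_ : _ \o _ = fun s => expR (k * s)); last by apply/funext => y; rewrite /= addr0.
  move=> H; have := is_derive_scale (K / k) H => {}H; apply: is_derive_eq H _.
  by rewrite addr0; field; rewrite gt_eqF.
have [B _ HB] : exists2 B : R, 0 <= B & forall s, 0 <= s <= t -> `|K * expR (k * s)| <= B.
  by apply: within_continuous_bounded; exact: continuous_subspaceT.
have ih : mu.-integrable `]0, t[ (EFin \o h).
  apply: (bounded_integrable_oo (M := B)) => // s s0t; have /andP[s0 st] := s0t.
  by apply: le_trans (Hh s s0t) (le_trans (ler_norm _) (HB s _)); rewrite !ltW.
apply: le_trans (le_normr_Rintegral _ ih) _ => //.
apply: (@le_trans _ _ (\int[mu]_(s in `]0, t[) (K * expR (k * s)))).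
  apply: le_Rintegral => //.
  - exact: (integrable_norm ih).
  - exact: continuous_integrable_oo.
rewrite (ftc t0 dE cE) mulr0 expR0 mulr1 [_ * _ / k]mulrAC gerBl.
by rewrite divr_ge0// ltW.
Qed.

Variables (pr pi : R -> R) (M : R).
Hypotheses (mpr : measurable_fun setT pr) (mpi : measurable_fun setT pi).
Hypotheses (Hpr : forall t, `|pr t| <= M) (Hpi : forall t, `|pi t| <= M).

(* With rho = exp (- k t - int pr) and theta = int pi, the solution is
   c + i d = rho exp (- i theta) (G + i H), where
   (G + i H)' = rho^-1 exp (i theta) (f + i g). *)
Lemma forced_mode_exists n (a b : R) (f g : R -> R) (F : R) :
  {within `[0, T], continuous f} -> {within `[0, T], continuous g} ->
  (forall t, 0 <= t <= T -> `|f t| <= F) -> (forall t, 0 <= t <= T -> `|g t| <= F) ->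
  exists c d, [/\ forced_mode l T pr pi n c d f g, c 0 = a, d 0 = b,
    forall t, 0 <= t <= T ->
     `|c t| <= expR (M * T) * expR (- (freq l n ^+ 2 * t)) * (`|a| + `|b|) +
        4 * expR (M * T) ^+ 2 * F / freq l n ^+ 2 /\
     `|d t| <= expR (M * T) * expR (- (freq l n ^+ 2 * t)) * (`|a| + `|b|) +
        4 * expR (M * T) ^+ 2 * F / freq l n ^+ 2
   & (forall t, pi t = 0) -> b = 0 -> (forall t, 0 <= t <= T -> g t = 0) ->
     forall t, 0 <= t <= T -> d t = 0].
Proof.
move=> cf cg Hf Hg; set k := freq l n ^+ 2; set K := expR (M * T).
have k0 : 0 < k by rewrite exprn_gt0// freq_gt0.
have T0 : 0 <= (0 : R) <= T by rewrite lexx ltW.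
have F0 : 0 <= F by apply: le_trans (Hf 0 T0).
have K0 : 0 < K by exact: expR_gt0.
have m0 (q : R -> R) : measurable_fun setT q -> measurable_fun `]0, T[ q.
  by move=> mq; exact: (measurable_funS (E := setT)).
pose P (t : R) := \int[mu]_(x in `]0, t[) pr x; pose Q (t : R) := \int[mu]_(x in `]0, t[) pi x.
have LP : LI T P pr by apply: (LI_integral (M := M)); [exact: m0|move=> t _].
have LQ : LI T Q pi by apply: (LI_integral (M := M)); [exact: m0|move=> t _].
have PT t : 0 <= t <= T -> `|P t| <= M * T.
  move=> /andP[t0 tT]; apply: (@le_trans _ _ (M * (t - 0))).
    by apply: Rint_oo_bound => //; exact: (measurable_oo_sub (lexx 0) tT (m0 _ mpr)).
  by rewrite subr0 ler_wpM2l// (le_trans _ (Hpr 0)).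
pose L t := - k * t - P t.
have LL : LI T L (fun t => - k - pr t).
  have c1 : continuous (fun _ : R => - k) by move=> x; exact: cvg_cst.
  have := LI_add (LI_derive T (fun x : R => is_derive_affine (- k) 0 x) c1) (LI_scale (-1) LP).
  by apply: LI_eq => t _; rewrite /L; ring.
pose rho t := expR (L t).
have Lrho : LI T rho (fun t => rho t * (- k - pr t)).
  exact: (LI_comp (fun x => is_derive_expR x) (fun x => is_derive_expR x) (@continuous_expR R) LL).
have dsin (x : R) : is_derive x 1 (fun y => - sin y) (- cos x) by exact: is_deriveN.
have ccos : continuous (fun x : R => - cos x) by move=> x; apply: cvgN; exact: continuous_cos.
have csin : continuous (fun x : R => - sin x) by move=> x; apply: cvgN; exact: continuous_sin.
pose C t := cos (Q t); pose S t := sin (Q t).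
have LC : LI T C (fun t => - S t * pi t) by exact: (LI_comp (fun x => is_derive_cos x) dsin ccos LQ).
have LS : LI T S (fun t => C t * pi t) by exact: (LI_comp (fun x => is_derive_sin x) (fun x => is_derive_cos x) csin LQ).
have C1 t : `|C t| <= 1 by exact: cos_max.
have S1 t : `|S t| <= 1 by exact: sin_max.
pose sigma t := expR (- L t).
have Lsigma : LI T sigma (fun t => sigma t * (-1 * (- k - pr t))).
  have := LI_comp (fun x => is_derive_expR x) (fun x => is_derive_expR x) (@continuous_expR R) (LI_scale (-1) LL).
  by apply: LI_eq => t _; rewrite /sigma !mulN1r.
have rs t : rho t * sigma t = 1 by rewrite /rho /sigma expRN mulfV// gt_eqF// expR_gt0.
(* [K = exp (M T)] absorbs the exponential of the primitive of [pr], with either sign, here and in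
   [Hrho]. *)
have Hsigma t : 0 <= t <= T -> sigma t <= K * expR (k * t).
  move=> tT; rewrite -expRD ler_expR /L; have := PT t tT; rewrite ler_norml => /andP[_ h].
  by rewrite opprB mulNr opprK lerD2r.
have Hrho t : 0 <= t <= T -> rho t <= K * expR (- (k * t)).
  move=> tT; rewrite -expRD ler_expR /L; have := PT t tT; rewrite ler_norml => /andP[h _].
  by rewrite mulNr addrC lerD2r lerNl.
(* Real and imaginary part of [rho^-1 exp (i theta) (f + i g)]; the primitives [I1] and [I2] below
   are the G and H of the formula. *)
pose G1 t := sigma t * (C t * f t - S t * g t); pose G2 t := sigma t * (C t * g t + S t * f t).
have mf := within_measurable_oo cf; have mg := within_measurable_oo cg.
have mG1 : measurable_fun `]0, T[ G1.
  apply: measurable_funM; first exact: (LI_measurable Lsigma).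
  by apply: measurable_funB; apply: measurable_funM => //; [exact: (LI_measurable LC)|exact: (LI_measurable LS)].
have mG2 : measurable_fun `]0, T[ G2.
  apply: measurable_funM; first exact: (LI_measurable Lsigma).
  by apply: measurable_funD; apply: measurable_funM => //; [exact: (LI_measurable LC)|exact: (LI_measurable LS)].
have s0 t : 0 <= sigma t by exact: expR_ge0.
have pt (x1 x2 y1 y2 : R) : `|x1| <= 1 -> `|x2| <= 1 -> `|y1| <= F -> `|y2| <= F ->
    `|x1 * y1| + `|x2 * y2| <= 2 * F.
  move=> h1 h2 h3 h4; rewrite !normrM mulr2n mulrDl !mul1r; apply: lerD.
    by rewrite -[F]mul1r; apply: ler_pM.
  by rewrite -[F]mul1r; apply: ler_pM.
have HG1 t : 0 <= t <= T -> `|G1 t| <= K * (2 * F) * expR (k * t).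
  move=> tT; rewrite normrM (ger0_norm (s0 t)) mulrAC; apply: ler_pM => //; first exact: Hsigma.
  by apply: le_trans (ler_normB _ _) _; apply: pt => //; [exact: Hf|exact: Hg].
have HG2 t : 0 <= t <= T -> `|G2 t| <= K * (2 * F) * expR (k * t).
  move=> tT; rewrite normrM (ger0_norm (s0 t)) mulrAC; apply: ler_pM => //; first exact: Hsigma.
  by apply: le_trans (ler_normD _ _) _; apply: pt => //; [exact: Hg|exact: Hf].
have KF : 0 <= K * (2 * F) by rewrite mulr_ge0 ?mulr_ge0// ltW.
pose B := K * (2 * F) * expR (k * T).
have leB t : 0 < t < T -> K * (2 * F) * expR (k * t) <= B.
  by move=> /andP[_ tT]; rewrite ler_wpM2l// ler_expR ler_pM2l// ltW.
pose I1 t := a + \int[mu]_(x in `]0, t[) G1 x; pose I2 t := b + \int[mu]_(x in `]0, t[) G2 x.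
have LI1 : LI T I1 G1.
  apply: (@LI_primitive _ _ _ _ B) => // t tT; apply: le_trans (leB t tT); apply: HG1.
  by move: tT => /andP[? ?]; rewrite !ltW.
have LI2 : LI T I2 G2.
  apply: (@LI_primitive _ _ _ _ B) => // t tT; apply: le_trans (leB t tT); apply: HG2.
  by move: tT => /andP[? ?]; rewrite !ltW.
have HI x (G : R -> R) : measurable_fun `]0, T[ G -> (forall t, 0 <= t <= T -> `|G t| <= K * (2 * F) * expR (k * t)) ->
    forall t, 0 <= t <= T -> `|x + \int[mu]_(x in `]0, t[) G x| <= `|x| + K * (2 * F) * expR (k * t) / k.
  move=> mG HG t /andP[t0 tT]; apply: le_trans (ler_normD _ _) _; rewrite lerD2l.
  apply: exp_integral_bound => //; first exact: (measurable_oo_sub (lexx 0) tT).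
  by move=> s /andP[u0 ut]; apply: HG; rewrite !ltW// (lt_le_trans ut).
(* The decay of [rho] cancels the growth [exp (k t)] of the primitives; two integrals with
   integrands at most [2 K F exp (k s)] account for the factor 4. *)
have bnd (x y u v : R) t : 0 <= t <= T -> `|x| <= 1 -> `|y| <= 1 ->
    `|u| <= `|a| + K * (2 * F) * expR (k * t) / k -> `|v| <= `|b| + K * (2 * F) * expR (k * t) / k ->
    rho t * (`|x * u| + `|y * v|) <= K * expR (- (k * t)) * (`|a| + `|b|) + 4 * K ^+ 2 * F / k.
  move=> tT x1 y1 hu hv.
  have E0 : expR (k * t) * expR (- (k * t)) = 1 by rewrite -expRD subrr expR0.
  have -> : K * expR (- (k * t)) * (`|a| + `|b|) + 4 * K ^+ 2 * F / k =
     K * expR (- (k * t)) * ((`|a| + K * (2 * F) * expR (k * t) / k) + (`|b| + K * (2 * F) * expR (k * t) / k)).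
    rewrite -[4 * K ^+ 2 * F / k]mulr1 -{1}E0; field; by rewrite gt_eqF.
  apply: ler_pM; [exact: expR_ge0|by rewrite addr_ge0|exact: Hrho|apply: lerD].
    by rewrite normrM; apply: le_trans _ hu; rewrite ler_piMl.
  by rewrite normrM; apply: le_trans _ hv; rewrite ler_piMl.
have Lc := LI_mul Lrho (LI_add (LI_mul LC LI1) (LI_mul LS LI2)).
have Ld := LI_mul Lrho (LI_add (LI_mul LC LI2) (LI_scale (-1) (LI_mul LS LI1))).
exists (fun t => rho t * (C t * I1 t + S t * I2 t)), (fun t => rho t * (C t * I2 t - S t * I1 t)).
have CS t : C t ^+ 2 + S t ^+ 2 = 1 by rewrite /C /S cos2Dsin2.
have P00 : P 0 = 0 by exact: Rint_oo_self.
have Q00 : Q 0 = 0 by exact: Rint_oo_self.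
have rho0 : rho 0 = 1 by rewrite /rho /L P00 mulr0 subr0 expR0.
have C00 : C 0 = 1 by rewrite /C Q00 cos0.
have S00 : S 0 = 0 by rewrite /S Q00 sin0.
have I10 : I1 0 = a by rewrite /I1 Rint_oo_self addr0.
have I20 : I2 0 = b by rewrite /I2 Rint_oo_self addr0.
split.
- split.
  + apply: LI_eq Lc => // t _; rewrite /G1 /G2.
    transitivity (- k * (rho t * (C t * I1 t + S t * I2 t)) - pr t * (rho t * (C t * I1 t + S t * I2 t)) +
       pi t * (rho t * (C t * I2 t - S t * I1 t)) + (rho t * sigma t) * (C t ^+ 2 + S t ^+ 2) * f t); first by ring.
    by rewrite rs CS !mul1r.
  + apply: LI_eq Ld => // t _; first by ring.
    rewrite /G1 /G2.
    transitivity (- k * (rho t * (C t * I2 t - S t * I1 t)) - pr t * (rho t * (C t * I2 t - S t * I1 t)) -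
       pi t * (rho t * (C t * I1 t + S t * I2 t)) + (rho t * sigma t) * (C t ^+ 2 + S t ^+ 2) * g t); first by ring.
    by rewrite rs CS !mul1r.
- by rewrite rho0 C00 S00 I10 I20; ring.
- by rewrite rho0 C00 S00 I10 I20; ring.
- move=> t tT; have h1 := HI a G1 mG1 HG1 t tT; have h2 := HI b G2 mG2 HG2 t tT.
  split; rewrite normrM (ger0_norm (expR_ge0 _)).
    apply: le_trans (bnd (C t) (S t) (I1 t) (I2 t) t tT (C1 t) (S1 t) h1 h2).
    by apply: ler_wpM2l; [exact: expR_ge0|exact: ler_normD].
  apply: le_trans (bnd (S t) (C t) (I1 t) (I2 t) t tT (S1 t) (C1 t) h1 h2).
  by apply: ler_wpM2l; [exact: expR_ge0|rewrite [leRHS]addrC; exact: ler_normB].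
(* Without imaginary part of [p] the phase vanishes and the imaginary component decouples. *)
- move=> pi0 b0 g0 t tT; have St s : S s = 0.
    by rewrite /S /Q Rint_oo_zero ?sin0// => x _; rewrite pi0.
  rewrite St mul0r subr0 /I2 b0 add0r Rint_oo_zero ?mulr0// => x /andP[x0 xt].
  rewrite /G2 g0 ?St ?mulr0 ?mul0r ?addr0 ?mulr0//.
  by move: tT => /andP[t0 tT]; rewrite !ltW// (lt_le_trans xt).
Qed.

End ForcedModes.

(** * Existence *)

(** A crude polynomial substitute for a bound by the square root of [y]. *)
Lemma norm_le_1Dsqr (R : realType) (x y : R) : x ^+ 2 <= y -> `|x| <= 1 + y.
Proof.
move=> xy; apply: le_trans (lerD (lexx 1) xy); rewrite -real_normK ?num_real//.
by move: `|x| => z; have := sqr_ge0 (z - 1); nra.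
Qed.

Lemma sqrrD_le (R : realType) (x y : R) : (x + y) ^+ 2 <= 2 * x ^+ 2 + 2 * y ^+ 2.
Proof. by have := sqr_ge0 (x - y); nra. Qed.

(** * Coefficients of the data and regularity of one component *)

Section ClassicalCoefficients.
Variables (R : realType) (l T : R).
Hypotheses (hl : 0 < l) (hT : 0 < T).
Local Notation mu := (leb R).
Local Notation D := (`]0, l[%classic : set R).
Local Notation L2 := (L2 (leb R) (`]0, l[%classic : set R)).
Local Notation ip := (ip (leb R) (`]0, l[%classic : set R)).

Lemma coef_second_deriv (g g1 g2 : R -> R) n : has_deriv_on `[0, l] g g1 ->
  has_deriv_on `[0, l] g1 g2 -> {within `[0, l], continuous g2} -> g 0 = 0 -> g l = 0 ->
  coef l g2 n = - (freq l n ^+ 2 * coef l g n).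
Proof.
move=> dg dg1 cg2 g0 gl; have [cg cg1] := (has_deriv_on_within dg, has_deriv_on_within dg1).
have csn0 : {within `[0, l], continuous (sn l n)} by apply: continuous_subspaceT; exact: continuous_sn.
have ccsn0 : {within `[0, l], continuous (csn l n)} by apply: continuous_subspaceT; exact: continuous_csn.
have ck (a : R) : {within `[0, l], continuous (fun=> a)} by apply: continuous_subspaceT => x; exact: cvg_cst.
have wM (a b : R -> R) : {within `[0, l], continuous a} -> {within `[0, l], continuous b} ->
    {within `[0, l], continuous (fun x => a x * b x)} by move=> ca cb x; apply: cvgM; [exact: ca|exact: cb].
(* Green's expression [g' sn - g sn']. At the ends the first product vanishes with the sine and the
   second with [g], so [g'] is unconstrained there. *)
pose F x := g1 x * sn l n x + - freq l n * (g x * csn l n x).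
pose f x := g2 x * sn l n x + freq l n ^+ 2 * (g x * sn l n x).
have wD (a b : R -> R) : {within `[0, l], continuous a} -> {within `[0, l], continuous b} ->
    {within `[0, l], continuous (fun x => a x + b x)} by move=> ca cb x; apply: cvgD; [exact: ca|exact: cb].
have cF : {within `[0, l], continuous F} := wD _ _ (wM _ _ cg1 csn0) (wM _ _ (ck _) (wM _ _ cg ccsn0)).
have cf : {within `[0, l], continuous f} := wD _ _ (wM _ _ cg2 csn0) (wM _ _ (ck _) (wM _ _ cg csn0)).
have dF (x : R) : 0 < x < l -> is_derive x 1 F (f x).
  move=> xl; have d0 := has_deriv_on_interior dg xl; have d1 := has_deriv_on_interior dg1 xl.
  have H := is_derive_add (is_derive_mul d1 (is_derive_sn l n x))
    (is_derive_scale (- freq l n) (is_derive_mul d0 (is_derive_csn l n x))).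
  by apply: is_derive_eq H _; rewrite /f; ring.
have := ftc_interior hl cF dF cf; rewrite /F sn0 snl// g0 gl !mul0r !mulr0 !addr0 subrr.
have Lsn := L2_sn l n; have [Lg Lg2] : L2 g /\ L2 g2 by split; exact: within_L2.
rewrite RintegralD//; last 2 first.
- by apply: within_continuous_integrable_oo; exact: wM cg2 csn0.
- by apply: within_continuous_integrable_oo; exact: wM (ck _) (wM _ _ cg csn0).
rewrite RintegralZl//; last by apply: within_continuous_integrable_oo; exact: wM cg csn0.
move=> /eqP; rewrite addr_eq0 => /eqP H; rewrite /coef.
have -> : ip g2 (sn l n) = - (freq l n ^+ 2 * ip g (sn l n)) by exact: H.
ring.
Qed.

Lemma coef_bound (g : R -> R) (B : R) n : L2 g -> ip g g <= B -> `|coef l g n| <= 1 + 2 / l * B.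
Proof.
move=> Lg gB; have h := le_trans (bessel hl n.+1 Lg) gB.
have h2 : coef l g n ^+ 2 <= 2 / l * B.
  have l2 : 0 < l / 2 by rewrite divr_gt0.
  apply: (@le_trans _ _ (\sum_(k < n.+1) coef l g k ^+ 2)).
    by rewrite big_ord_recr/= lerDr sumr_ge0// => k _; exact: sqr_ge0.
  rewrite -(ler_pM2l l2); apply: le_trans h _.
  by rewrite (_ : _ * (2 / l * B) = B)//; field; rewrite gt_eqF.
exact: norm_le_1Dsqr.
Qed.

Lemma coef_sq_summable (g : R -> R) : L2 g -> nneg_summable (fun n => coef l g n ^+ 2).
Proof.
move=> Lg; split; first by move=> n; exact: sqr_ge0.
exists (2 / l * ip g g) => N; have l2 : 0 < l / 2 by rewrite divr_gt0.
rewrite -(ler_pM2l l2); apply: le_trans (bessel hl N Lg) _.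
by rewrite (_ : _ * (2 / l * _) = ip g g)//; field; rewrite gt_eqF.
Qed.

Lemma C2_coef (g : R -> R) : C2_on l g -> g 0 = 0 -> g l = 0 ->
  L2 g /\ sine_dense l g /\ exists g2, [/\ L2 g2, sine_dense l g2 &
    forall n, coef l g2 n = - (freq l n ^+ 2 * coef l g n)].
Proof.
move=> [g1 [g2 [dg dg1 cg2]]] g0 gl; have cg := has_deriv_on_within dg.
split; first exact: within_L2; split; first exact: sine_dense_continuous.
by exists g2; split=> [||n]; [exact: within_L2|exact: sine_dense_continuous|exact: (coef_second_deriv n dg dg1)].
Qed.

(** The norms of [fxx] in L2(0, l) are bounded uniformly in time, so Bessel's inequality bounds its
    coefficients, which are those of [f] times the eigenvalues up to sign. *)
Lemma C21_coef (f : R * R -> R) : C21_on l T f ->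
  (forall t : R, 0 <= t <= T -> f (0, t) = 0 /\ f (l, t) = 0) ->
  [/\ CL2 l T f, forall t, 0 <= t <= T -> sine_dense l (at_time f t) &
   exists2 A : R, 0 <= A & forall n t, 0 <= t <= T ->
     `|coef l (at_time f t) n| <= A / freq l n ^+ 2].
Proof.
move=> [fx [fxx [ft [[cf cfx cfxx _] df dfx _]]]] f0.
have C := continuous_CL2 hl cf; have Cxx := continuous_CL2 hl cfxx.
split=> //.
  by move=> t tT; apply: sine_dense_continuous => //; exact: within_closed_rect_slice cf tT.
have [B B0 HB] := CL2_bounded Cxx; have [Lxx _] := Cxx.
exists (1 + 2 / l * B); first by rewrite addr_ge0// mulr_ge0// divr_ge0// ltW.
move=> n t tT; have k0 : 0 < freq l n ^+ 2 by rewrite exprn_gt0// freq_gt0.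
have tT' : t \in `[0, T] by rewrite in_itv.
have [z0 zl] := f0 t tT.
rewrite ler_pdivlMr// mulrC -{1}(ger0_norm (ltW k0)) -normrM -normrN.
rewrite -(coef_second_deriv n (df t tT') (dfx t tT') (within_closed_rect_slice cfxx tT) z0 zl).
by apply: coef_bound; [exact: Lxx|exact: HB].
Qed.

Lemma nneg_summable_sq (g : nat -> R) : nneg_summable g -> nneg_summable (fun n => g n ^+ 2).
Proof.
move=> sg; have [g0 [B HB]] := sg.
have gB n : g n <= B by apply: le_trans (HB n.+1); rewrite big_ord_recr/= lerDr sumr_ge0.
have B0 : 0 <= B by apply: le_trans (gB 0%N).
apply: nneg_summable_le (nneg_summableZ B0 sg) _ => n.
by rewrite sqr_ge0/= expr2 ler_wpM2r.
Qed.

(* For t > 0, exp (- k t) <= 1 / (k t) with k = freq ^ 2. *)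
Lemma energy_of_mode_bound (c : nat -> R -> R) (s : nat -> R) (K A : R) : 0 <= K -> 0 <= A ->
  (forall n, 0 <= s n) -> nneg_summable (fun n => s n ^+ 2) ->
  (forall n t, 0 <= t <= T -> freq l n ^+ 2 * `|c n t| <=
     K * expR (- (freq l n ^+ 2 * t)) * s n + A / freq l n ^+ 2) ->
  exists b : nat -> R, [/\ forall n t, 0 <= t <= T -> freq l n ^+ 2 * `|c n t| <= b n,
    nneg_summable (fun n => b n ^+ 2)
  & forall t, 0 < t <= T -> exists2 g, nneg_summable g & forall n, freq l n ^+ 2 * `|c n t| <= g n].
Proof.
move=> K0 A0 s0 ss H; exists (fun n => K * s n + A / freq l n ^+ 2).
have k0 n : 0 < freq l n ^+ 2 by rewrite exprn_gt0// freq_gt0.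
have sk := inv_freq_sq_summable hl.
split.
- move=> n t tT; apply: le_trans (H n t tT) _; rewrite lerD2r ler_wpM2r// ler_piMr//.
  by rewrite -expR0 ler_expR oppr_le0 mulr_ge0 ?(ltW (k0 n))//; case/andP: tT.
- have s1 := nneg_summableZ (mulr_ge0 (ler0n _ 2) (sqr_ge0 K)) ss.
  have s2 := nneg_summableZ (mulr_ge0 (ler0n _ 2) (sqr_ge0 A)) (nneg_summable_sq sk).
  apply: nneg_summable_le (nneg_summableD s1 s2) _ => n; rewrite sqr_ge0/=.
  by apply: le_trans (sqrrD_le _ _) _; rewrite !exprMn !mulrA.
- move=> t /andP[t0 tT]; have [_ [B HB]] := ss.
  have B0 : 0 <= B by apply: le_trans (HB 0%N); rewrite big_ord0.
  have sB n : s n <= 1 + B.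
    have : s n ^+ 2 <= B by apply: le_trans (HB n.+1); rewrite big_ord_recr/= lerDr sumr_ge0// => k _; exact: sqr_ge0.
    by move=> /norm_le_1Dsqr; apply: le_trans; exact: ler_norm.
  have C0 : 0 <= K * (1 + B) / t + A by rewrite addr_ge0// divr_ge0 ?(ltW t0)// mulr_ge0// addr_ge0.
  (* A square summable [s] is bounded, so the exponential and the forcing both contribute a multiple
     of [1 / k_n], which is summable. *)
  exists (fun n => (K * (1 + B) / t + A) * (freq l n ^+ 2)^-1); first exact: nneg_summableZ.
  move=> n; apply: le_trans (H n t _) _; first by rewrite (ltW t0).
  rewrite [leRHS]mulrDl lerD2r.
  have kt : 0 < freq l n ^+ 2 * t by rewrite mulr_gt0.
  have e1 : expR (- (freq l n ^+ 2 * t)) <= (freq l n ^+ 2 * t)^-1.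
    rewrite expRN lef_pV2 ?posrE ?expR_gt0//; apply: le_trans (expR_ge1Dx _).
    by rewrite lerDr.
  have -> : K * (1 + B) / t / freq l n ^+ 2 = K * (freq l n ^+ 2 * t)^-1 * (1 + B).
    by field; rewrite (gt_eqF t0) (gt_eqF (freq_gt0 hl n)).
  by apply: ler_pM => //; [rewrite mulr_ge0// expR_ge0|rewrite ler_wpM2l].
Qed.

(** Both functions are L2 limits of the same partial sums. *)
Lemma ucv_ae (c : nat -> R -> R) (w : R * R -> R) (g : R -> R) t : ucv l T c w -> 0 <= t <= T ->
  L2 g -> sine_dense l g -> (forall n, coef l g n = c n t) ->
  \forall x \ae mu, x \in `]0, l[ -> w (x, t) = g x.
Proof.
move=> [Lw Hw] tT Lg dg gc; have Lt := Lw t tT.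
have Ld : L2 (fun x => at_time w t x - g x) by exact: (L2B _ Lt Lg).
suff E : ip (fun x => at_time w t x - g x) (fun x => at_time w t x - g x) = 0.
  have := ip_sq_eq0 _ Ld E => /(_ (measurable_itv _)).
  by apply: ae_mono => x H xl; apply/eqP; rewrite -subr_eq0; apply/eqP; exact: H.
apply: le_anti; rewrite ip_ge0 andbT; apply/ler_addgt0Pl => e e0; rewrite addr0.
have e4 : 0 < e / 4 by rewrite divr_gt0.
have [N1 H1] := Hw _ e4; have [N2 H2] := parseval hl Lg dg e4.
pose N := maxn N1 N2.
have q1 := H1 N (leq_maxl _ _) t tT; have q2 := H2 N (leq_maxr _ _).
have q3 := ip_sq_triangle Lt (L2_psum l (coef l g) N) Lg.
have E1 : psum l (c^~ t) N = psum l (coef l g) N.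
  by apply/funext => x; apply: eq_bigr => n _; rewrite gc.
have E2 : ip (fun x => psum l (coef l g) N x - g x) (fun x => psum l (coef l g) N x - g x) =
    ip (fun x => g x - psum l (coef l g) N x) (fun x => g x - psum l (coef l g) N x).
  by congr Rintegral; apply/funext => x; ring.
rewrite E2 in q3; rewrite /resid E1 in q1; apply: le_trans q3 _.
by move: e0 q1 q2; clear; lra.
Qed.

(** The time derivative is defined by the right-hand side of the equation: its coefficients are the
    derivatives of the [c n], so [series_weak_dt] identifies it. Real and imaginary part use this
    with the roles of [c] and [d] exchanged. *)
Lemma component_regular (c d F : nat -> R -> R) (b : nat -> R) (A0 : R -> R) (q1 q2 : R -> R) (M : R) (f : R * R -> R) :
  (forall n, LI T (c n) (fun t => - (freq l n ^+ 2 * c n t) + q1 t * c n t + q2 t * d n t + F n t)) ->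
  (forall n t, 0 <= t <= T -> freq l n ^+ 2 * `|c n t| <= b n) ->
  nneg_summable (fun n => b n ^+ 2) ->
  (forall t, 0 < t <= T -> exists2 g, nneg_summable g & forall n, freq l n ^+ 2 * `|c n t| <= g n) ->
  L2 A0 -> sine_dense l A0 -> (forall n, coef l A0 n = - (freq l n ^+ 2 * c n 0)) ->
  ucv l T d (sser l d) -> measurable_fun (rect l T) (sser l d) ->
  (forall n, exists B : R, forall t, 0 <= t <= T -> `|d n t| <= B) ->
  ucv l T F f -> measurable_fun (rect l T) f ->
  (forall n, exists B : R, forall t, 0 <= t <= T -> `|F n t| <= B) ->
  measurable_fun setT q1 -> measurable_fun setT q2 ->
  (forall t, `|q1 t| <= M) -> (forall t, `|q2 t| <= M) ->
  regular l T (sser l c) (sser_x l c) (sser_xx l c A0)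
   (fun z => sser_xx l c A0 z + q1 z.2 * sser l c z + q2 z.2 * sser l d z + f z).
Proof.
move=> Lc cb sb cpos LA dA c0 ud md dB uF mf FB mq1 mq2 Hq1 Hq2.
have cc n : {within `[0, T], continuous (c n)} by exact: LI_continuous (Lc n).
have uc := ucv_sser_coef hl cb sb.
have uxx := ucv_sser_xx hl hT cb sb cpos LA dA c0.
have uh := ucvD (ucvD (ucvD uxx (ucvZ Hq1 uc)) (ucvZ Hq2 ud)) uF.
have hB n : exists B : R, forall t, 0 <= t <= T ->
    `|- (freq l n ^+ 2 * c n t) + q1 t * c n t + q2 t * d n t + F n t| <= B.
  have [B1 B10 H1] := LI_bounded (Lc n); have [B2 H2] := dB n; have [B3 H3] := FB n.
  exists (freq l n ^+ 2 * B1 + M * B1 + M * B2 + B3) => t tT.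
  apply: ler_norm4; last exact: H3.
  - by rewrite normrN normrM ger0_norm ?sqr_ge0// ler_wpM2l ?sqr_ge0// H1.
  - by rewrite normrM; apply: ler_pM => //; exact: H1.
  - by rewrite normrM; apply: ler_pM => //; exact: H2.
have mq (q : R -> R) : measurable_fun setT q -> measurable_fun (rect l T) (fun z => q z.2).
  move=> m; apply: (measurable_funS (E := setT)) => //.
  by apply: (measurableT_comp (f := q)) => //; exact: measurable_snd.
split.
- exact: (series_C_H2_H10 hl hT cc cb sb cpos LA dA c0).
- have [B HB] := ucv_bounded hl hB uh; have [Lh _] := uh.
  apply: (Lp_on_rect hT (B := B)).
    apply: measurable_funD => //; apply: measurable_funD; last by apply: measurable_funM => //; exact: mq.
    apply: measurable_funD; first exact: (measurable_sser_xx hT A0 cc cpos).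
    by apply: measurable_funM; [exact: mq|exact: (measurable_sser_coef hl hT cc cb sb)].
  by move=> t /andP[t0 tT]; split; [apply: Lh|apply: HB]; rewrite !ltW.
- exact: (series_weak_dt hl hT Lc hB uc uh).
Qed.

End ClassicalCoefficients.

Section Existence.
Variables (R : realType) (l T : R).
Hypotheses (hl : 0 < l) (hT : 0 < T).
Local Notation mu := (leb R).
Local Notation L2 := (L2 (leb R) (`]0, l[%classic : set R)).
Variables (p phi : R -> R[i]) (f : R * R -> R[i]) (qr qi : R -> R) (M : R).
Hypotheses (mqr : measurable_fun setT qr) (mqi : measurable_fun setT qi).
Hypotheses (Hqr : forall t, `|qr t| <= M) (Hqi : forall t, `|qi t| <= M).
Hypotheses (Eqr : \forall t \ae mu, t \in `]0, T[ -> re p t = qr t).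
Hypotheses (Eqi : \forall t \ae mu, t \in `]0, T[ -> im p t = qi t).
Hypotheses (phi_re : C2_on l (re phi)) (phi_im : C2_on l (im phi)).
Hypotheses (phi_0 : phi 0 = 0) (phi_l : phi l = 0).
Hypotheses (f_re : C21_on l T (re f)) (f_im : C21_on l T (im f)).
Hypotheses (f_0 : forall t : R, 0 <= t <= T -> f (0, t) = 0).
Hypotheses (f_l : forall t : R, 0 <= t <= T -> f (l, t) = 0).

Lemma solution_exists : exists u : R * R -> R[i], solution l T p phi f u /\
  ((forall t, qi t = 0) -> (forall x, x \in `[0, l] -> im phi x = 0) ->
   (forall z, closed_rect l T z -> im f z = 0) -> forall z, closed_rect l T z -> im u z = 0).
Proof.
have k0 n : 0 < freq l n ^+ 2 by rewrite exprn_gt0// freq_gt0.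
have [Lphr [dphr [gr [Lgr dgr Hgr]]]] : _ := C2_coef hl phi_re (congr1 (@complex.Re R) phi_0) (congr1 (@complex.Re R) phi_l).
have [Lphi [dphi [gi [Lgi dgi Hgi]]]] : _ := C2_coef hl phi_im (congr1 (@complex.Im R) phi_0) (congr1 (@complex.Im R) phi_l).
have fr0 t : 0 <= t <= T -> re f (0, t) = 0 /\ re f (l, t) = 0.
  by move=> tT; rewrite /re f_0// f_l.
have fi0 t : 0 <= t <= T -> im f (0, t) = 0 /\ im f (l, t) = 0.
  by move=> tT; rewrite /im f_0// f_l.
have [Cfr dfr [Ar Ar0 HAr]] := C21_coef hl f_re fr0.
have [Cfi dfi [Ai Ai0 HAi]] := C21_coef hl f_im fi0.
pose A := Ar + Ai; have A0 : 0 <= A by rewrite addr_ge0.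
pose Fr n t := coef l (at_time (re f) t) n; pose Fi n t := coef l (at_time (im f) t) n.
have HFr n t : 0 <= t <= T -> `|Fr n t| <= A / freq l n ^+ 2.
  move=> tT; apply: le_trans (HAr n t tT) _.
  by rewrite ler_pM2r ?invr_gt0// lerDl.
have HFi n t : 0 <= t <= T -> `|Fi n t| <= A / freq l n ^+ 2.
  move=> tT; apply: le_trans (HAi n t tT) _.
  by rewrite ler_pM2r ?invr_gt0// lerDr.
have cF (g : R * R -> R) n : CL2 l T g -> {within `[0, T], continuous (fun t => coef l (at_time g t) n)}.
  by move=> Cg t; apply: cvgM; [exact: cvg_cst|exact: (CL2_continuous Cg (L2_sn l n))].
have cFr n : {within `[0, T], continuous (Fr n)} by exact: cF.
have cFi n : {within `[0, T], continuous (Fi n)} by exact: cF.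
have sA : nneg_summable (fun n => A / freq l n ^+ 2).
  exact: nneg_summableZ A0 (inv_freq_sq_summable hl).
(* [f] enters through its sine series, equal to it almost everywhere at each time; uniform
   convergence and measurability then follow from the coefficient bounds. *)
have [uFr uFi] : ucv l T Fr (sser l Fr) /\ ucv l T Fi (sser l Fi).
  by split; [exact: (ucv_sser hl sA HFr)|exact: (ucv_sser hl sA HFi)].
have [mFr mFi] : measurable_fun (rect l T) (sser l Fr) /\ measurable_fun (rect l T) (sser l Fi).
  split; apply: measurable_sser => // t /andP[t0 tT]; exists (fun n => A / freq l n ^+ 2) => // n.
    by apply: HFr; rewrite !ltW.
  by apply: HFi; rewrite !ltW.
pose K := expR (M * T).
pose mode n (cd : (R -> R) * (R -> R)) :=
  [/\ forced_mode l T qr qi n cd.1 cd.2 (Fr n) (Fi n), cd.1 0 = coef l (re phi) n, cd.2 0 = coef l (im phi) n,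
    forall t, 0 <= t <= T ->
     `|cd.1 t| <= K * expR (- (freq l n ^+ 2 * t)) * (`|coef l (re phi) n| + `|coef l (im phi) n|) +
        4 * K ^+ 2 * (A / freq l n ^+ 2) / freq l n ^+ 2 /\
     `|cd.2 t| <= K * expR (- (freq l n ^+ 2 * t)) * (`|coef l (re phi) n| + `|coef l (im phi) n|) +
        4 * K ^+ 2 * (A / freq l n ^+ 2) / freq l n ^+ 2
   & (forall t, qi t = 0) -> coef l (im phi) n = 0 -> (forall t, 0 <= t <= T -> Fi n t = 0) ->
     forall t, 0 <= t <= T -> cd.2 t = 0].
have /boolp.choice[cd Hcd] n : exists cd, mode n cd.
  have [c [d H]] := forced_mode_exists hl hT mqr mqi Hqr Hqi n (coef l (re phi) n) (coef l (im phi) n)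
    (cFr n) (cFi n) (HFr n) (HFi n).
  by exists (c, d).
pose c n := (cd n).1; pose d n := (cd n).2.
pose s n := `|coef l gr n| + `|coef l gi n|.
have s0 n : 0 <= s n by rewrite addr_ge0.
have ss : nneg_summable (fun n => s n ^+ 2).
  have s1 := nneg_summableZ (ler0n R 2) (coef_sq_summable hl Lgr).
  have s2 := nneg_summableZ (ler0n R 2) (coef_sq_summable hl Lgi).
  apply: nneg_summable_le (nneg_summableD s1 s2) _ => n; rewrite sqr_ge0/=.
  by apply: le_trans (sqrrD_le _ _) _; rewrite !real_normK ?num_real.
have K0 : 0 <= K by exact: expR_ge0.
have A'0 : 0 <= 4 * K ^+ 2 * A by rewrite mulr_ge0// mulr_ge0// sqr_ge0.
(* Multiplication by [k_n] turns [phi_n] into the coefficient of [phi''], up to sign, and leaves a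
   forcing term of order [1 / k_n]. *)
have scale (x : R) n t : `|x| <= K * expR (- (freq l n ^+ 2 * t)) * (`|coef l (re phi) n| + `|coef l (im phi) n|) +
        4 * K ^+ 2 * (A / freq l n ^+ 2) / freq l n ^+ 2 ->
    freq l n ^+ 2 * `|x| <= K * expR (- (freq l n ^+ 2 * t)) * s n + 4 * K ^+ 2 * A / freq l n ^+ 2.
  move=> h; apply: le_trans (ler_wpM2l (ltW (k0 n)) h) _.
  have nrm y : `|- (freq l n ^+ 2 * y)| = freq l n ^+ 2 * `|y|.
    by rewrite normrN normrM ger0_norm ?sqr_ge0.
  rewrite /s Hgr Hgi !nrm le_eqVlt; apply/orP; left; apply/eqP.
  by field; rewrite gt_eqF// freq_gt0.
have [bc [cb sbc cpos]] := energy_of_mode_bound hl (c := c) K0 A'0 s0 ss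
  (fun n t tT => let: And5 _ _ _ h _ := Hcd n in scale _ n t (h t tT).1).
have [bd [db sbd dpos]] := energy_of_mode_bound hl (c := d) K0 A'0 s0 ss
  (fun n t tT => let: And5 _ _ _ h _ := Hcd n in scale _ n t (h t tT).2).
have Lc n : LI T (c n) (fun t => - (freq l n ^+ 2 * c n t) + - qr t * c n t + qi t * d n t + Fr n t).
  by have [[Lc _] _ _ _ _] := Hcd n; apply: LI_eq Lc => // t _; rewrite !mulNr.
have Ld n : LI T (d n) (fun t => - (freq l n ^+ 2 * d n t) + - qr t * d n t + - qi t * c n t + Fi n t).
  by have [[_ Ld] _ _ _ _] := Hcd n; apply: LI_eq Ld => // t _; rewrite !mulNr.
have cc n := LI_continuous (Lc n); have cdd n := LI_continuous (Ld n).
have uc := ucv_sser_coef hl cb sbc; have ud := ucv_sser_coef hl db sbd.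
have mc := measurable_sser_coef hl hT cc cb sbc; have md := measurable_sser_coef hl hT cdd db sbd.
have cB n : exists B : R, forall t, 0 <= t <= T -> `|c n t| <= B.
  by have [B _ HB] := LI_bounded (Lc n); exists B.
have dB n : exists B : R, forall t, 0 <= t <= T -> `|d n t| <= B.
  by have [B _ HB] := LI_bounded (Ld n); exists B.
have FrB n : exists B : R, forall t, 0 <= t <= T -> `|Fr n t| <= B.
  by exists (A / freq l n ^+ 2) => t; exact: HFr.
have FiB n : exists B : R, forall t, 0 <= t <= T -> `|Fi n t| <= B.
  by exists (A / freq l n ^+ 2) => t; exact: HFi.
have c0 n : coef l gr n = - (freq l n ^+ 2 * c n 0) by have [_ E _ _ _] := Hcd n; rewrite /c E.
have d0 n : coef l gi n = - (freq l n ^+ 2 * d n 0) by have [_ _ E _ _] := Hcd n; rewrite /d E.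
have Nm (q : R -> R) : measurable_fun setT q -> measurable_fun setT (fun t => - q t).
  by move=> mq; exact: measurableT_comp.
have Nb (q : R -> R) : (forall t, `|q t| <= M) -> forall t, `|- q t| <= M by move=> H t; rewrite normrN.
have Rc := component_regular hl hT Lc cb sbc cpos Lgr dgr c0 ud md dB uFr mFr FrB (Nm _ mqr) mqi (Nb _ Hqr) Hqi.
have Rd := component_regular hl hT Ld db sbd dpos Lgi dgi d0 uc mc cB uFi mFi FiB (Nm _ mqr) (Nm _ mqi) (Nb _ Hqr) (Nb _ Hqi).
have T0 : 0 <= (0 : R) <= T by rewrite lexx ltW.
exists (fun z => Complex (sser l c z) (sser l d z)); split.
  exists (fun z => Complex (sser_x l c z) (sser_x l d z)),
    (fun z => Complex (sser_xx l c gr z) (sser_xx l d gi z)),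
    (fun z => Complex (sser_xx l c gr z + - qr z.2 * sser l c z + qi z.2 * sser l d z + sser l Fr z)
       (sser_xx l d gi z + - qr z.2 * sser l d z + - qi z.2 * sser l c z + sser l Fi z)).
  split; [exact: Rc|exact: Rd| |].
  - apply: ae_mono2 Eqr Eqi => t er ei tT; have tT' : 0 <= t <= T.
      by move: tT; rewrite in_itv/= => /andP[? ?]; rewrite !ltW.
    have [[Lfr _] [Lfi _]] := (Cfr, Cfi).
    have h1 := ucv_ae hl uFr tT' (Lfr t tT') (dfr t tT') (fun n => erefl).
    have h2 := ucv_ae hl uFi tT' (Lfi t tT') (dfi t tT') (fun n => erefl).
    apply: ae_mono2 h1 h2 => x h1 h2 xl.
    have -> : p t = Complex (qr t) (qi t).
      by move: (er tT) (ei tT); rewrite /re /im; case: (p t) => a b /= -> ->.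
    have -> : f (x, t) = Complex (sser l Fr (x, t)) (sser l Fi (x, t)).
      by rewrite h1// h2// /at_time /re /im; case: (f (x, t)).
    by apply/eqP; rewrite eq_complex /=; apply/andP; split; apply/eqP; ring.
  - have h1 := ucv_ae hl uc T0 Lphr dphr (fun n => let: And5 _ e _ _ _ := Hcd n in esym e).
    have h2 := ucv_ae hl ud T0 Lphi dphi (fun n => let: And5 _ _ e _ _ := Hcd n in esym e).
    by apply: ae_mono2 h1 h2 => x h1 h2 xl; rewrite h1// h2// /re /im; case: (phi x).
(* Every imaginary coefficient vanishes identically, so the sum is zero at each point of the closed
   rectangle, not just almost everywhere. *)
move=> qi0 phi0 f0 [x t] [/= xl tT].
rewrite /im/= /sser (_ : (fun n => _) = fun=> 0) ?ssum0//; apply/funext => n.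
have coef0 (g : R -> R) : (forall x, 0 < x < l -> g x = 0) -> coef l g n = 0.
  by move=> g0; rewrite /coef /ip Rint_oo_zero ?mulr0// => y yl; rewrite g0// mul0r.
have [_ _ _ _ H] := Hcd n; rewrite /= /d H ?mul0r//.
- by apply: coef0 => y /andP[y0 yl]; apply: phi0; rewrite in_itv/= !ltW.
- move=> r rT; apply: coef0 => y /andP[y0 yl]; apply: f0; split=> /=; rewrite in_itv//=.
  by rewrite !ltW.
Qed.

End Existence.

Theorem theorem3p1 (R : realType) (K : set R[i]) (hK : scalar_field K)
    (l T : R) (hl : 0 < l) (hT : 0 < T)
    (p phi : R -> R[i]) (f : R * R -> R[i])
    (pK : forall t : R, t \in `[0, T] -> K (p t))
    (p_re : Lp_on (leb R) +oo%E `[0, T] (re p))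
    (p_im : Lp_on (leb R) +oo%E `[0, T] (im p))
    (phiK : forall x : R, x \in `[0, l] -> K (phi x))
    (phi_re : C2_on l (re phi)) (phi_im : C2_on l (im phi))
    (phi_0 : phi 0 = 0) (phi_l : phi l = 0)
    (fK : forall z, closed_rect l T z -> K (f z))
    (f_re : C21_on l T (re f)) (f_im : C21_on l T (im f))
    (f_0 : forall t : R, t \in `[0, T] -> f (0, t) = 0)
    (f_l : forall t : R, t \in `[0, T] -> f (l, t) = 0) :
  exists u : R * R -> R[i],
    [/\ forall z, closed_rect l T z -> K (u z),
        solution l T p phi f u
      & forall v : R * R -> R[i],
          (forall z, closed_rect l T z -> K (v z)) ->
          solution l T p phi f v ->
          forall t : R, t \in `[0, T] ->
            \forall x \ae leb R, x \in `]0, l[ -> v (x, t) = u (x, t)].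
Proof.
have [qr [Mr [mqr Hqr Eqr _]]] := bounded_representative hT p_re.
have [qi [Mi [mqi Hqi Eqi Zqi]]] := bounded_representative hT p_im.
have Mr0 : 0 <= Mr by apply: le_trans (Hqr 0).
have Mi0 : 0 <= Mi by apply: le_trans (Hqi 0).
have Hr t : `|qr t| <= Mr + Mi by apply: le_trans (Hqr t) _; rewrite lerDl.
have Hi t : `|qi t| <= Mr + Mi by apply: le_trans (Hqi t) _; rewrite lerDr.
have f0' t : 0 <= t <= T -> f (0, t) = 0 by move=> tT; apply: f_0; rewrite in_itv.
have fl' t : 0 <= t <= T -> f (l, t) = 0 by move=> tT; apply: f_l; rewrite in_itv.
have [u [su Ru]] := solution_exists hl hT mqr mqi Hr Hi Eqr Eqi phi_re phi_im phi_0 phi_l f_re f_im f0' fl'.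
exists u; split=> //.
  (* Real scalars are the case left: [im p] vanishes on [0, T], so its representative vanishes
     everywhere and the imaginary parts decouple. *)
  case: hK => KE; rewrite KE // in pK phiK fK *.
  by apply: Ru => //; exact: Zqi.
move=> v _ sv; have cf (g : R * R -> R) : C21_on l T g -> CL2 l T g.
  by move=> [? [? [? [[cg _ _ _] _ _ _]]]]; exact: continuous_CL2.
have Lp (g : R -> R) : C2_on l g -> L2 (leb R) `]0, l[ g.
  by move=> [g1 [g2 [/has_deriv_on_within cg _ _]]]; exact: within_L2.
exact: (solution_unique hl hT mqr mqi Hr Hi Eqr Eqi (cf _ f_re) (cf _ f_im) (Lp _ phi_re) (Lp _ phi_im) su sv).
Qed.
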